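(* Let $q=p^k$ be a power of a prime $p$ ($k\ge 1$), and assume that the exceptional zero for the modulus $q$ does not exist. For a Dirichlet character $\chi$ modulo $q$ let $f_\chi$ be its conductor. Then, for $k=o\left(\frac{p}{(\log p)^4}\right)$, $$\sum_{\substack{\chi \bmod q\\ \chi \neq \chi_0 \\ \chi(-1)=1}} \frac{1}{f_\chi|L(1,\chi)|^{2}}=\frac{\zeta(2)}{2\zeta(4)} \frac{(p-1)^2}{p^2+1}\, k + O\left(\frac{1}{\log p}\right) +O\left(\frac{k^2(\log p)^2(\log k+\log\log p)^2}{p}\right).$$ Otherwise, i.e. for $k\gg \frac{p}{(\log p)^4}$, one has the upper bound $$\sum_{\substack{\chi \bmod q\\ \chi \neq \chi_0 \\ \chi(-1)=1}} \frac{1}{f_\chi|L(1,\chi)|^{2}} \ll \frac{k^2(\log p)^2(\log k+\log\log p)^2}{p}.$$ The implied constants are uniform in $p$ and $k$ (in the second case they may depend on the constant implied in $k\gg p/(\log p)^4$).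
   Context: The sums run over the nonprincipal even Dirichlet characters $\chi$ modulo $q$ (primitive or not); $\chi_0$ is the principal character modulo $q$, and $L(s,\chi)$ is the Dirichlet $L$-function of $\chi$. $\zeta$ is the Riemann zeta-function. Exceptional zero: fix an effectively computable constant $c_0>0$ with the following (known) property: for every $q\ge 2$, the product $\prod_{\chi \bmod q}L(s,\chi)$ has at most one zero in the region $\sigma\ge 1-\frac{c_0}{\log (q(|t|+1))}$ ($s=\sigma+it$), and such a zero, if it exists, is real and simple and corresponds to a nonprincipal real character $\chi_1$ modulo $q$. This zero, if it exists, is called the exceptional zero for the modulus $q$. The assumption is that there is no such zero for the moduli $q$ under consideration. The conditions $k=o(p/(\log p)^4)$ and $k\gg p/(\log p)^4$ are asymptotic conditions on the family of prime powers $p^k$ considered: the first means $k(\log p)^4/p\to 0$ along the family, the second that $k\ge c\,p/(\log p)^4$ for some constant $c>0$. *)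

(* Defs.v *)
From mathcomp Require Import all_boot all_order all_algebra.
From mathcomp Require Import all_classical all_reals all_analysis.
From mathcomp Require Import complex.
Set Implicit Arguments.
Unset Strict Implicit.
Unset Printing Implicit Defensive.

Import Order.TTheory GRing.Theory Num.Theory.
Import numFieldNormedType.Exports.

Local Open Scope classical_set_scope.
Local Open Scope ring_scope.
Local Open Scope complex_scope.

Section DirichletCharacters.
Variable R : realType.
Implicit Types (q d : nat) (chi : int -> R[i]).

Definition dirichlet_character q chi : Prop :=
  [/\ forall a : int, chi (a + q%:Z) = chi a,
      forall a b : int, chi (a * b) = chi a * chi b
    & forall a : int, (chi a != 0) = coprimez a q%:Z].

Definition principal_character q : int -> R[i] :=
  fun a => (coprimez a q%:Z)%:R.

Definition real_character chi : Prop := forall a : int, complex.Im (chi a) = 0.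

Definition factors_through q chi d : Prop :=
  (d %| q)%N /\
  exists2 psi, dirichlet_character d psi &
    forall a : int, coprimez a q%:Z -> chi a = psi a.

(* The least modulus d from which chi is induced; the minimum is taken over
   0 <= d <= q with default value q, which is itself such a modulus. *)
Definition conductor q chi : nat :=
  [arg min_(d < (ord_max : 'I_q.+1) | `[< factors_through q chi d >]) d].

End DirichletCharacters.

Section DirichletLFunctions.
Variable R : realType.
Implicit Types (q n : nat) (chi : int -> R[i]) (s : R[i]).

Definition cabs (z : R[i]) : R := ComplexField.Normc.normc z.

Definition cexp (z : R[i]) : R[i] :=
  (expR (complex.Re z))%:C * (cos (complex.Im z) +i* sin (complex.Im z)).

(* n ^ s, for n >= 1 *)
Definition npow n s : R[i] := cexp (s * (ln n%:R)%:C).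

(* The usual expression of the zeta-function in the half-plane Re s > 0,
   s <> 1; for Re s > 1 the subtracted term tends to 0. *)
Definition zeta s : R[i] :=
  limn (fun N : nat =>
    \sum_(1 <= n < N.+1) npow n (- s) - npow N (1 - s) / (1 - s) : R[i]^o).

(* The value of L(s, chi) for Re s > 0 (and s <> 1 if chi is principal): the
   Dirichlet series of a nonprincipal character converges in this half-plane,
   and L(s, chi_0) is zeta(s) times the Euler factors at the primes dividing q.
   No other values of L are used below. *)
Definition Lfun q chi s : R[i] :=
  if `[< chi = @principal_character R q >] then
    zeta s * \prod_(l <- primes q) (1 - npow l (- s))
  else
    limn (fun N : nat =>
      \sum_(1 <= n < N.+1) chi n%:Z * npow n (- s) : R[i]^o).

Definition Lprod q s : R[i] :=
  \big[*%R/1]_(chi \in dirichlet_character q) Lfun q chi s.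

(* Zeros of the product in the region
   sigma >= 1 - c0 / log (q (|t| + 1)), s = sigma + i t.
   The point s = 1 is excluded because L(s, chi_0), hence the product, has a
   pole there. The condition sigma > 0 is automatic when c0 < log 2, which the
   property [at_most_one_zero] forces when read with the continuation of L to
   the whole plane: for q = 2 the product vanishes at s = 0. *)
Definition zero_in_region (c0 : R) q s : Prop :=
  [/\ 0 < complex.Re s,
      1 - c0 / ln (q%:R * (`|complex.Im s| + 1)) <= complex.Re s,
      s != 1
    & Lprod q s = 0].

Definition simple_zero (f : R[i] -> R[i]) s : Prop :=
  f s = 0 /\
  exists2 l : R[i], l != 0 &
    is_derive (s : R[i]^o) (1 : R[i]^o) (f : R[i]^o -> R[i]^o) l.

Definition at_most_one_zero (c0 : R) : Prop :=
  forall q, (2 <= q)%N ->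
    (forall s1 s2, zero_in_region c0 q s1 -> zero_in_region c0 q s2 -> s1 = s2)
    /\ forall s, zero_in_region c0 q s ->
      [/\ complex.Im s = 0,
          simple_zero (Lprod q) s
        & exists chi1, [/\ dirichlet_character q chi1,
            chi1 <> @principal_character R q,
            real_character chi1
          & Lfun q chi1 s = 0]].

Definition exceptional_zero_exists (c0 : R) q : Prop :=
  exists s, zero_in_region c0 q s.

Definition even_nonprincipal q : set (int -> R[i]) :=
  [set chi | [/\ dirichlet_character q chi,
                 chi <> @principal_character R q & chi (-1) = 1]].

Definition Lsum q : R :=
  \sum_(chi \in even_nonprincipal q)
    ((conductor q chi)%:R * cabs (Lfun q chi 1) ^+ 2)^-1.

Definition error_term (p k : nat) : R :=
  k%:R ^+ 2 * ln p%:R ^+ 2 * (ln k%:R + ln (ln p%:R)) ^+ 2 / p%:R.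

End DirichletLFunctions.

(* Main.v *)
(* Write s0 = 1 + r with r = a / (log q + 2). For nonprincipal chi mod q, L(s, chi)
   has no zero near the disc |s - s0| <= 3 r (by hypothesis for s <> 1; at s = 1 by
   the 3-4-1 inequality for complex chi and Monsky's argument for real chi), and
   it is O(log q) there. A Borel-Caratheodory argument, carried out on
   polynomials so that it is purely finite (Taylor polynomials of the partial sums
   of L converge to L uniformly on the disc), bounds the Taylor coefficients of
   1/L at s0; these coefficients are also the limits of the sums
   \sum mu(n) chi(n) n^-s0 (-log n)^m / m!. Summing O(log log q) Taylor terms at
   s = 1 gives 1/L(1, chi) = \sum mu(n) chi(n) w(n) / n + O((log q)^-3) with a
   smooth weight 0 <= w <= 1 such that W = \sum w(n) / n << log q log log q.

   Orthogonality of the even characters mod p^j turns the mean square of these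
   sums into phi(p^j)/2 \sum_(p not dividing n) mu(n)^2 w(n)^2 / n^2 + O(W^2), and
   \sum_(p not dividing n) mu(n)^2 / n^2 = zeta(2)/zeta(4) p^2/(p^2 + 1). Finally
   1/f_chi is a sum of weights v_j over the j such that chi is a character mod p^j,
   with \sum v_j = 1/p and v_j phi(p^j) = (1 - 1/p)^2 for j < k, which gives the
   main term and the error W^2 / p. *)
Require Import Defs.
From mathcomp Require Import all_boot all_order all_algebra.
From mathcomp Require Import all_classical all_reals all_analysis.
From mathcomp Require Import complex.
From mathcomp Require Import cyclic separable cyclotomic.
From mathcomp Require Import ring lra zify.
Set Implicit Arguments.
Unset Strict Implicit.
Unset Printing Implicit Defensive.

Import Order.TTheory GRing.Theory Num.Theory.
Import numFieldNormedType.Exports.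

Local Open Scope classical_set_scope.
Local Open Scope ring_scope.
Local Open Scope complex_scope.

(** * Complex absolute value, powers and limits *)

(** The precision (log q)^-3 is dictated by the end of the proof: the error is multiplied by W <<
    log q log log q and by the factor k coming from the weights, and k / log q <= 1 / log p. The
    other constants follow. On the disc of radius 3 r, Borel-Caratheodory bounds the m-th
    coefficient of 1/L by (2 r)^-m up to a factor, so that at distance r the series has ratio 1/2.
    The factor is only (log q)^9, because |L(s)/L(s0)| is bounded by a power of log q on the disc;
    twelve terms per binary digit of log q therefore leave (log q)^-3.

    Polynomials stand in for holomorphic functions because they split over a closed field: log |T|
    becomes a finite sum of log |1 - u z|, and the coefficients of 1/T are symmetric functions
    governed by Newton's identities. The cut N of the Dirichlet series and the degree of the
    polynomial enter only qualitatively and vanish in the limit.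

    The factor (log k + log log p)^2 of the error term is (log log q)^2. It has to dominate (log(log
    q + 2))^2, which is possible because log q is bounded away from 1: no integer q is close to
    e. *)

Section Cabs.
Variable R : realType.
Implicit Types (z w : R[i]) (x : R).

Lemma cabsE z : `|z| = (cabs z)%:C. Proof. by []. Qed.

Lemma cabs_ge0 z : 0 <= cabs z.
Proof. by rewrite -lecR -cabsE; exact: (@normr_ge0 _ R[i]). Qed.

Lemma cabs0 : cabs (0 : R[i]) = 0. Proof. exact: ComplexField.Normc.normc0. Qed.
Lemma cabs1 : cabs (1 : R[i]) = 1. Proof. exact: ComplexField.Normc.normc1. Qed.

Lemma cabsM z w : cabs (z * w) = cabs z * cabs w.
Proof. exact: ComplexField.Normc.normcM. Qed.

Lemma cabsV z : cabs z^-1 = (cabs z)^-1.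
Proof. exact: ComplexField.Normc.normcV. Qed.

Lemma cabsN z : cabs (- z) = cabs z.
Proof. exact: normcN. Qed.

Lemma cabsD z w : cabs (z + w) <= cabs z + cabs w.
Proof. exact: le_normcD. Qed.

Lemma cabsB z w : cabs (z - w) <= cabs z + cabs w.
Proof. by rewrite -(cabsN w) cabsD. Qed.

Lemma cabs_distC z w : cabs (z - w) = cabs (w - z).
Proof. by rewrite -cabsN opprB. Qed.

Lemma cabs_eq0 z : (cabs z == 0) = (z == 0).
Proof.
by apply/eqP/eqP => [/ComplexField.Normc.eq0_normc//|->]; rewrite cabs0.
Qed.

Lemma cabs_gt0 z : (0 < cabs z) = (z != 0).
Proof. by rewrite lt0r cabs_eq0 cabs_ge0 andbT. Qed.

Lemma cabsX z n : cabs (z ^+ n) = cabs z ^+ n.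
Proof. by elim: n => [|n IH]; rewrite ?cabs1// !exprS cabsM IH. Qed.

Lemma cabs_sum (I : Type) (s : seq I) (P : pred I) (F : I -> R[i]) :
  cabs (\sum_(i <- s | P i) F i) <= \sum_(i <- s | P i) cabs (F i).
Proof.
elim/big_ind2: _ => // [|a b c d h1 h2]; first by rewrite cabs0.
exact: le_trans (cabsD _ _) (lerD _ _).
Qed.

Lemma cabs_prod (I : Type) (s : seq I) (P : pred I) (F : I -> R[i]) :
  cabs (\prod_(i <- s | P i) F i) = \prod_(i <- s | P i) cabs (F i).
Proof. by elim/big_ind2: _ => // [|a b c d <- <-]; rewrite ?cabs1 ?cabsM. Qed.

Lemma cabs_real x : cabs x%:C = `|x|.
Proof. by rewrite /cabs /= expr0n addr0 sqrtr_sqr. Qed.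

Lemma cabs_nat n : cabs (n%:R : R[i]) = n%:R.
Proof. by rewrite -(rmorph_nat (real_complex R)) cabs_real normr_nat. Qed.

Lemma sqr_cabs z : cabs z ^+ 2 = complex.Re z ^+ 2 + complex.Im z ^+ 2.
Proof. by case: z => a b; rewrite sqr_sqrtr //= addr_ge0 ?sqr_ge0. Qed.

Lemma sqr_cabsC z : (cabs z ^+ 2)%:C = z * conjc z.
Proof. by rewrite -sqr_normc rmorphXn. Qed.

Lemma Re_le_cabs z : `|complex.Re z| <= cabs z.
Proof. by rewrite -lecR; exact: normc_ge_Re. Qed.

Lemma Im_le_cabs z : `|complex.Im z| <= cabs z.
Proof.
rewrite -sqrtr_sqr /cabs; case: z => a b /=; apply: ler_wsqrtr.
by rewrite lerDr sqr_ge0.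
Qed.

Lemma cabs_le_ReIm z : cabs z <= `|complex.Re z| + `|complex.Im z|.
Proof.
rewrite {1}(complexE z); apply: le_trans (cabsD _ _) _.
by rewrite cabsM !cabs_real /cabs /= expr0n expr1n add0r sqrtr1 mul1r.
Qed.

Lemma Re_sum (I : Type) (s : seq I) (P : pred I) (F : I -> R[i]) :
  complex.Re (\sum_(i <- s | P i) F i) = \sum_(i <- s | P i) complex.Re (F i).
Proof.
elim/big_ind2: _ => // a b c d <- <-.
by case: b d => [? ?] [? ?].
Qed.

Lemma Im_sum (I : Type) (s : seq I) (P : pred I) (F : I -> R[i]) :
  complex.Im (\sum_(i <- s | P i) F i) = \sum_(i <- s | P i) complex.Im (F i).
Proof.
elim/big_ind2: _ => // a b c d <- <-.
by case: b d => [? ?] [? ?].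
Qed.

Lemma ReD z w : complex.Re (z + w) = complex.Re z + complex.Re w.
Proof. by case: z w => ? ? []. Qed.
Lemma ImD z w : complex.Im (z + w) = complex.Im z + complex.Im w.
Proof. by case: z w => ? ? []. Qed.
Lemma ReN z : complex.Re (- z) = - complex.Re z. Proof. by case: z. Qed.
Lemma ImN z : complex.Im (- z) = - complex.Im z. Proof. by case: z. Qed.
Lemma ReMr z x : complex.Re (z * x%:C) = complex.Re z * x.
Proof. by case: z => a b /=; rewrite mulr0 subr0. Qed.
Lemma ImMr z x : complex.Im (z * x%:C) = complex.Im z * x.
Proof. by case: z => a b /=; rewrite mulr0 add0r. Qed.
Lemma ReM z w : complex.Re (z * w) = 
  complex.Re z * complex.Re w - complex.Im z * complex.Im w.
Proof. by case: z w => ? ? []. Qed.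
Lemma cexpD z w : cexp (z + w) = cexp z * cexp w.
Proof.
rewrite /cexp ReD ImD expRD cosD sinD rmorphM /= -!mulrA; congr (_ * _).
rewrite [RHS]mulrCA; congr (_ * _).
by apply/eqP; rewrite eq_complex/= !eqxx andTb addrC.
Qed.

Lemma cexp_real x : cexp x%:C = (expR x)%:C.
Proof. by rewrite /cexp /= cos0 sin0 mulr1. Qed.

Lemma cexp0 : cexp 0 = 1 :> R[i].
Proof. by rewrite cexp_real expR0. Qed.

Lemma cabs_cexp z : cabs (cexp z) = expR (complex.Re z).
Proof.
rewrite /cexp cabsM cabs_real gtr0_norm ?expR_gt0//.
by rewrite /cabs/= cos2Dsin2 sqrtr1 mulr1.
Qed.

Lemma cabs_npow n z :
  cabs (npow n z) = expR (complex.Re z * ln n%:R).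
Proof. by rewrite /npow cabs_cexp ReMr. Qed.

Lemma npow1 z : npow 1 z = 1 :> R[i].
Proof. by rewrite /npow ln1 mulr0 cexp0. Qed.

Lemma npow_real n x : npow n x%:C = (expR (x * ln n%:R))%:C.
Proof. by rewrite /npow -rmorphM cexp_real. Qed.

(* The norm of [R[i]^o] takes its values in [R[i]]; complex limits are therefore
   handled through the real-valued [cabs]. *)
Definition cconv (u : nat -> R[i]) (l : R[i]) : Prop :=
  cabs (u n - l) @[n --> \oo] --> (0 : R).

Lemma cconv_limn (u : nat -> R[i]) (l : R[i]) :
  cconv u l -> limn (u : nat -> R[i]^o) = l.
Proof.
move=> h; apply: (@cvg_lim R[i]^o) => //; apply/(@cvgrPdist_le _ R[i]^o) => e e0.
have e0' : 0 < complex.Re e by move: e0; rewrite ltcE => /andP[].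
move/cvgrPdist_le: h => /(_ _ e0'); apply: filterS => n.
rewrite sub0r normrN ger0_norm ?cabs_ge0// distrC cabsE => h.
by rewrite lecE /= h (ger0_Im (ltW e0)) eqxx.
Qed.

(** The Cauchy criterion with its rate kept: letting n tend to infinity in the hypothesis bounds the
    distance to the limit by the same [e m]. Real and imaginary parts converge separately. *)
Lemma cconv_complete (u : nat -> R[i]) (e : nat -> R) :
  (forall m n, (m <= n)%N -> cabs (u n - u m) <= e m) ->
  e @ \oo --> (0 : R) ->
  exists2 l, cconv u l & forall m, cabs (l - u m) <= e m.
Proof.
move=> ue e0.
have cau (f : R[i] -> R) : (forall z w, f (z - w) = f z - f w) ->
    (forall z, `|f z| <= cabs z) -> cvgn (fun n => f (u n)).
  move=> fB fle; apply/cauchy_cvgP; apply: cauchy_exP => d d0.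
  move/cvgrPdist_lt: e0 => /(_ _ d0) [N _ hN].
  exists (f (u N)); exists N => // n /= Nn.
  rewrite /ball/= distrC -fB; apply: le_lt_trans (fle _) _.
  apply: le_lt_trans (ue _ _ Nn) _.
  by have := hN N (leqnn N); rewrite sub0r normrN; apply: le_lt_trans; rewrite ler_norm.
have cR := cau (@complex.Re R) (fun z w => etrans (ReD _ _) (congr1 _ (ReN w))) Re_le_cabs.
have cI := cau (@complex.Im R) (fun z w => etrans (ImD _ _) (congr1 _ (ImN w))) Im_le_cabs.
set l : R[i] := limn (fun n => complex.Re (u n)) +i* limn (fun n => complex.Im (u n)).
have cl : cabs (u n - l) @[n --> \oo] --> (0 : R).
  apply: (@squeeze_cvgr _ _ _ _ (fun=> 0) (fun n =>
    `|complex.Re (u n) - complex.Re l| + `|complex.Im (u n) - complex.Im l|)).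
  - apply: nearW => n; rewrite cabs_ge0 /=; apply: le_trans (cabs_le_ReIm _) _.
    by rewrite ReD ImD ReN ImN.
  - exact: cvg_cst.
  - rewrite -[X in _ --> X](addr0 0); apply: cvgD.
      by apply/norm_cvg0P; apply/subr_cvg0.
    by apply/norm_cvg0P; apply/subr_cvg0.
exists l => // m.
have h : \forall n \near \oo, cabs (l - u m) - e m <= cabs (u n - l).
  exists m => // n /= mn; rewrite lerBlDl.
  have -> : l - u m = (u n - u m) - (u n - l) by ring.
  exact: le_trans (cabsB _ _) (lerD (ue _ _ mn) (lexx _)).
by rewrite -subr_le0; apply: cvgr_to_ge cl h.
Qed.
End Cabs.

(** * Real powers of integers and tails of their sums *)

Section RealPowers.
Variable R : realType.
Implicit Types (x y : R) (m n : nat).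

(** This is n^-x. As [ln 0 = 0], it equals 1 at n = 0, so that bounds of the form C * [rpw x m] also
    cover the empty partial sum. *)
Definition rpw x n : R := expR (- (x * ln n%:R)).

Lemma rpw_gt0 x n : 0 < rpw x n. Proof. exact: expR_gt0. Qed.
Lemma rpw_ge0 x n : 0 <= rpw x n. Proof. exact: expR_ge0. Qed.
Hint Resolve rpw_gt0 rpw_ge0 : core.

Lemma rpwD x y n : rpw (x + y) n = rpw x n * rpw y n.
Proof. by rewrite /rpw mulrDl opprD expRD. Qed.

Lemma rpwM x m n : (0 < m)%N -> (0 < n)%N -> rpw x (m * n) = rpw x m * rpw x n.
Proof.
by move=> m0 n0; rewrite /rpw natrM lnM ?posrE ?ltr0n// mulrDr opprD expRD.
Qed.

Lemma rpw_1 n : (0 < n)%N -> rpw 1 n = n%:R^-1.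
Proof. by move=> n0; rewrite /rpw mul1r expRN lnK// posrE ltr0n. Qed.

Lemma rpw_one x : rpw x 1 = 1. Proof. by rewrite /rpw ln1 mulr0 oppr0 expR0. Qed.

Lemma ln_nat_ge0 n : 0 <= ln n%:R :> R.
Proof. by case: n => [|n]; [rewrite ln0|rewrite ln_ge0// ler1n]. Qed.

Lemma rpw_le x m n : 0 <= x -> (0 < m)%N -> (m <= n)%N -> rpw x n <= rpw x m.
Proof.
move=> x0 m0 mn; rewrite /rpw ler_expR lerN2 ler_wpM2l// ler_ln ?posrE ?ltr0n//.
  by rewrite ler_nat.
exact: leq_trans mn.
Qed.

Lemma rpw_le1 x n : 0 <= x -> rpw x n <= 1.
Proof.
move=> x0; rewrite /rpw -[leRHS]expR0 ler_expR oppr_le0 mulr_ge0//.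
exact: ln_nat_ge0.
Qed.

Lemma rpw_ler x y n : x <= y -> rpw y n <= rpw x n.
Proof. by move=> xy; rewrite /rpw ler_expR lerN2 ler_wpM2r// ln_nat_ge0. Qed.

Lemma ln_succ_ge n : (0 < n)%N -> n.+1%:R^-1 <= ln n.+1%:R - ln n%:R :> R.
Proof.
move=> n0; rewrite -ln_div ?posrE ?ltr0n//.
have h : 0 < n%:R / n.+1%:R :> R by rewrite divr_gt0 ?ltr0n.
rewrite -[X in ln X]invf_div lnV ?posrE// lerNr.
have -> : n%:R / n.+1%:R = 1 + - n.+1%:R^-1 :> R.
  by rewrite -natr1; field; rewrite natr1 pnatr_eq0.
apply: le_ln1Dx; rewrite ltrN2 invf_lt1 ?ltr0n// ltr1n ltnS //.
Qed.

Lemma ln_succ_le n : (0 < n)%N -> ln n.+1%:R - ln n%:R <= n%:R^-1 :> R.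
Proof.
move=> n0; rewrite -ln_div ?posrE ?ltr0n//.
have -> : n.+1%:R / n%:R = 1 + n%:R^-1 :> R.
  by rewrite -natr1; field; rewrite pnatr_eq0 -lt0n.
by apply: le_ln1Dx; rewrite (lt_le_trans (y := 0))// ?invr_ge0// oppr_lt0.
Qed.

(** Discrete form of integrating t^(-1-x): by e^u >= 1 + u, the quotient of n^-x by (n+1)^-x is at
    least 1 + x log((n+1)/n), and this logarithm is at least 1/(n+1). *)
Lemma rpw_step x n : 0 <= x -> (0 < n)%N ->
  x * rpw (1 + x) n.+1 <= rpw x n - rpw x n.+1.
Proof.
move=> x0 n0; rewrite rpwD rpw_1//.
have -> : rpw x n = rpw x n.+1 * expR (x * (ln n.+1%:R - ln n%:R)).
  by rewrite /rpw -expRD; congr expR; ring.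
rewrite mulrA mulrC -[X in _ <= _ - X]mulr1 -mulrBr ler_wpM2l// lerBrDl.
apply: le_trans (expR_ge1Dx _); rewrite lerD2l ler_wpM2l//.
exact: ln_succ_ge.
Qed.

Lemma sum_rpw_tail x m n : 0 <= x -> (0 < m)%N ->
  x * \sum_(m.+1 <= i < n) rpw (1 + x) i <= rpw x m.
Proof.
move=> x0 m0; have [nm|mn] := leqP n m.+1; first by rewrite big_geq// mulr0.
case: n mn => // n; rewrite ltnS => mn; rewrite big_add1/= mulr_sumr.
apply: le_trans (_ : \sum_(m <= i < n) (rpw x i - rpw x i.+1) <= _).
  rewrite !big_nat; apply: ler_sum => i /andP[mi _].
  by apply: rpw_step => //; apply: leq_trans mi.
rewrite -(opprK (\sum_(_ <= _ < _) _)) -sumrN.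
under eq_bigr do rewrite opprB.
by rewrite telescope_sumr 1?ltnW// opprB gerBl.
Qed.

Lemma sum_rpw x n : 0 < x -> \sum_(1 <= i < n) rpw (1 + x) i <= 1 + x^-1.
Proof.
move=> x0; have [n1|n1] := leqP n 1.
  by rewrite big_geq// addr_ge0// invr_ge0 ltW.
rewrite big_ltn// rpw_one lerD2l -[leRHS]mul1r ler_pdivlMr// mulrC.
by apply: le_trans (sum_rpw_tail _ (ltW x0) _) _ => //; rewrite rpw_one.
Qed.

Lemma sum_harmonic n : (0 < n)%N -> \sum_(1 <= i < n.+1) (i%:R^-1 : R) <= 1 + ln n%:R.
Proof.
case: n => // n _; rewrite big_ltn// invr1 lerD2l.
elim: n => [|n IH]; first by rewrite big_geq// ln1.
rewrite big_nat_recr//= -lerBrDr; apply: le_trans IH _.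
by rewrite lerBrDl -lerBrDr ln_succ_ge.
Qed.

Lemma rpw_cvg0 x : 0 < x -> rpw x n @[n --> \oo] --> 0.
Proof.
move=> x0; apply/cvgrPdist_le => e e0.
have [N hN] : exists N : nat, expR (- ln e / x) <= N%:R.
  by exists (Num.truncn (expR (- ln e / x))).+1; rewrite ltW// truncnS_gt.
exists N.+1 => // n /= Nn; rewrite sub0r normrN ger0_norm//.
rewrite /rpw -[leRHS](@lnK R) ?posrE// ler_expR lerNl mulrC -ler_pdivrMr//.
rewrite -(expRK (- ln e / x)) ler_ln ?posrE ?expR_gt0 ?ltr0n//; last exact: leq_trans Nn.
by apply: le_trans hN _; rewrite ler_nat ltnW.
Qed.

Lemma ln_le_rpw x n : 0 < x -> ln n%:R <= x^-1 * expR (x * ln n%:R).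
Proof.
move=> x0; rewrite mulrC ler_pdivlMr// mulrC.
by apply: le_trans (expR_ge1Dx _); rewrite lerDr.
Qed.

Lemma expr_fact_le_expR y m : 0 <= y -> y ^+ m / m`!%:R <= expR y.
Proof.
case: m => [|m] y0; first by rewrite expr0 fact0 divr1 -expR0 ler_expR.
by apply: le_trans (expR_ge1Dxn m y0); rewrite lerDr.
Qed.

End RealPowers.

#[export] Hint Resolve rpw_gt0 rpw_ge0 : core.

Section Calculus.
Variable R : realType.
Implicit Types (f df : R -> R) (p : {poly R}) (x : R).

(** The complex logarithm and exponential are estimated below along segments t w, 0 <= t <= 1, by
    applying this to real functions of t; no complex differentiation is involved. *)
Lemma mvt_le f df (B : R) :
  (forall x, 0 <= x <= 1 -> is_derive x 1 f (df x)) ->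
  (forall x, 0 <= x <= 1 -> `|df x| <= B) -> `|f 1 - f 0| <= B.
Proof.
move=> fd dfB.
have [|||c] := @MVT_segment R f df 0 1; first exact: ler01.
- by move=> x; rewrite in_itv/= => /andP[? ?]; apply: fd; rewrite !ltW.
- apply: derivable_within_continuous => x; rewrite in_itv/= => hx.
  by have [] := fd _ hx.
- by rewrite in_itv/= subr0 mulr1 => hc ->; apply: dfB.
Qed.

Lemma is_derive_comp_horner f (df : R) p x :
  is_derive p.[x] 1 f df -> is_derive x 1 (fun t => f p.[t]) (df * p^`().[x]).
Proof.
move=> h; have := @is_derive1_comp R f (horner p) x _ _ h (is_derive_poly p x).
by [].
Qed.

Lemma abs_sin_le x : `|sin x| <= `|x|.
Proof.
have h : `|sin (x *: 'X).[1] - sin (x *: 'X).[0]| <= `|x|.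
  apply: (@mvt_le (fun t => sin (x *: 'X).[t])
      (fun t => cos (x *: 'X).[t] * (x *: 'X)^`().[t])) => t _.
  have -> : (x *: 'X)^`().[t] = x by rewrite derivZ derivX hornerZ hornerC mulr1.
  by rewrite normrM -[leRHS]mul1r; apply: ler_wpM2r => //; exact: cos_max.
by rewrite !hornerE sin0 subr0 in h.
Qed.

End Calculus.

Section CexpBounds.
Variable R : realType.
Implicit Types (s z w : R[i]) (x y : R) (m n : nat).

Lemma cabs_npowN n s : cabs (npow n (- s)) = rpw (complex.Re s) n.
Proof. by rewrite cabs_npow ReN mulNr. Qed.

(** With w = a + i b, the modulus e^-a differs from 1 by at most a, and the rotation contributes |1
    - e^(-i b)| = 2 |sin(b/2)| <= |b|. *)
Lemma cabs_1cexpN w : 0 <= complex.Re w -> cabs (1 - cexp (- w)) <= 2 * cabs w.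
Proof.
case: w => a b; rewrite [complex.Re _]/= => a0.
have -> : - (a +i* b) = - a%:C + (0 +i* (- b)).
  by apply/eqP; rewrite eq_complex/= addr0 oppr0 add0r !eqxx.
rewrite cexpD -rmorphN cexp_real.
set u := cexp (0 +i* - b).
have u1 : cabs u = 1 by rewrite cabs_cexp expR0.
have -> : 1 - (expR (- a))%:C * u = (1 - expR (- a))%:C * u + (1 - u).
  by rewrite rmorphB rmorph1; ring.
apply: le_trans (cabsD _ _) _; rewrite mulr2n mulrDl !mul1r; apply: lerD.
  rewrite cabsM u1 mulr1 cabs_real; apply: le_trans (Re_le_cabs _) => /=.
  rewrite !ger0_norm// ?subr_ge0 -1?expR0 ?ler_expR ?oppr_le0//.
  by rewrite expR0 lerBlDl -lerBlDr expR_ge1Dx.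
apply: le_trans (Im_le_cabs _) => /=.
rewrite /u /cexp /= expR0 mul1r cosN sinN.
rewrite /cabs/= -[leRHS]sqrtr_sqr; apply: ler_wsqrtr.
rewrite !mul0r subr0 addr0 mul1r sub0r opprK.
have -> : (1 - cos b) ^+ 2 + sin b ^+ 2 = 2 * (1 - cos b).
  transitivity (1 - 2 * cos b + (cos b ^+ 2 + sin b ^+ 2)); first by ring.
  by rewrite cos2Dsin2; ring.
have -> : cos b = 1 - sin (b / 2) ^+ 2 *+ 2.
  rewrite {1}(_ : b = (b / 2) *+ 2); last by rewrite -mulr_natr divfK ?pnatr_eq0.
  by rewrite cos_mulr2n cos2sin2 mulr2n; ring.
have := abs_sin_le (b / 2); rewrite -ler_sqr ?nnegrE// !real_normK ?num_real//.
have -> : (b / 2) ^+ 2 = b ^+ 2 / 4 by field.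
by rewrite mulr2n; set c := sin _ ^+ 2; set d := b ^+ 2; lra.
Qed.

Lemma npow_step n s : (0 < n)%N -> 0 <= complex.Re s ->
  cabs (npow n (- s) - npow n.+1 (- s)) <= 2 * cabs s * rpw (1 + complex.Re s) n.
Proof.
move=> n0 s0; set d : R := ln n.+1%:R - ln n%:R.
have d0 : 0 <= d by rewrite subr_ge0 ler_ln ?posrE ?ltr0n// ler_nat.
have -> : npow n.+1 (- s) = npow n (- s) * cexp (- (s * d%:C)).
  by rewrite /npow -cexpD; congr cexp; rewrite /d rmorphB/=; ring.
rewrite -{1}[npow n _]mulr1 -mulrBr cabsM cabs_npowN rpwD rpw_1//.
apply: le_trans (_ : rpw (complex.Re s) n * (2 * cabs (s * d%:C)) <= _).
  by rewrite ler_wpM2l ?rpw_ge0// cabs_1cexpN// ReMr mulr_ge0.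
rewrite mulrC mulrA ler_wpM2r ?rpw_ge0//.
rewrite cabsM cabs_real ger0_norm// -!mulrA ler_pM2l// ler_wpM2l ?cabs_ge0//.
exact: ln_succ_le.
Qed.

End CexpBounds.

Section Limits.
Variable R : realType.
Implicit Types (e : nat -> R) (a b x : R).

(** Limits are mostly taken in this shape: an inequality at level n with an error tending to 0. *)
Lemma ler_add_cvg0 e a b n0 : e @ \oo --> (0 : R) ->
  (forall n, (n0 <= n)%N -> a <= b + e n) -> a <= b.
Proof.
move=> e0 h; have h1 : b + e n @[n --> \oo] --> b + 0.
  by apply: cvgD => //; exact: cvg_cst.
have h2 : \forall n \near \oo, a <= b + e n by exists n0.
by rewrite -[leRHS]addr0; exact: cvgr_to_ge h1 h2.
Qed.

Lemma cvg0_Ml e x : e @ \oo --> (0 : R) -> x * e n @[n --> \oo] --> (0 : R).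
Proof. by move=> e0; rewrite -(mulr0 x); exact: cvgMr. Qed.

Lemma cvg_half : (2^-1 : R) ^+ n @[n --> \oo] --> (0 : R).
Proof. by apply: cvg_expr; rewrite ger0_norm// invf_lt1// ltr1n. Qed.

Lemma sum_half n m : \sum_(n <= k < m) (2^-1 : R) ^+ k <= 2 * 2^-1 ^+ n.
Proof.
have [mn|nm] := leqP m n.
  by rewrite big_geq// mulr_ge0// exprn_ge0.
rewrite -(subnKC (ltnW nm)); elim: (m - n)%N => [|k IH].
  by rewrite addn0 big_geq// mulr_ge0// exprn_ge0.
have key : forall k, \sum_(n <= i < n + k) (2^-1 : R) ^+ i =
   2 * 2^-1 ^+ n - 2 * 2^-1 ^+ (n + k).
  elim=> [|j IHj]; first by rewrite addn0 big_geq// subrr.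
  by rewrite addnS big_nat_recr ?leq_addr//= IHj exprS; field.
by rewrite key gerBl mulr_ge0// exprn_ge0.
Qed.

End Limits.

(** * Reciprocals of zero-free polynomials *)

Section LogSeries.
Variable R : realType.
Implicit Types (w z u : R[i]) (K m n N : nat).

(** The series of Re log(1 - w) with remainder. Along t w the derivative of log |1 - t w| is -Re(w /
    (1 - t w)); adding the geometric sum leaves -Re(w (t w)^K / (1 - t w)). *)
Lemma ln_cabs_1B w K : cabs w < 1 ->
  `|ln (cabs (1 - w)) + complex.Re (\sum_(i < K) w ^+ i.+1 / i.+1%:R)|
  <= cabs w ^+ K.+1 / (1 - cabs w).
Proof.
move=> w1; set a := complex.Re w; set b := complex.Im w.
have wE : w = a +i* b by rewrite /a /b; case: (w).
(* [p] is |1 - t w|^2 as a real polynomial in t, so half its logarithm is log |1 - t w|. *)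
pose p : {poly R} := (1%:P - a *: 'X) ^+ 2 + (b *: 'X) ^+ 2.
pose S : {poly R} := \sum_(i < K) (complex.Re (w ^+ i.+1) / i.+1%:R) *: 'X^(i.+1).
pose f (t : R) := 2^-1 * ln p.[t] + S.[t].
have pE t : p.[t] = cabs (1 - t%:C * w) ^+ 2.
  by rewrite sqr_cabs wE /p !hornerE /=; ring.
have u0 t : 0 <= t <= 1 -> 1 - cabs w <= cabs (1 - t%:C * w).
  move=> /andP[t0 t1]; rewrite lerBlDr.
  apply: le_trans (_ : cabs (1 - t%:C * w) + cabs (t%:C * w) <= _).
    by have := cabsD (1 - t%:C * w) (t%:C * w); rewrite subrK cabs1.
  by rewrite lerD2l cabsM cabs_real ger0_norm// ler_piMl ?cabs_ge0.
have u0' t : 0 <= t <= 1 -> 0 < cabs (1 - t%:C * w).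
  by move=> /u0; apply: lt_le_trans; rewrite subr_gt0.
have f1 : f 1 = ln (cabs (1 - w)) + complex.Re (\sum_(i < K) w ^+ i.+1 / i.+1%:R).
  rewrite /f pE rmorph1 mul1r lnXn ?(u0' 1) ?ler01 ?lexx//; last first.
    by have := u0' 1; rewrite rmorph1 mul1r ler01 lexx; apply.
  have -> (x : R) : 2^-1 * (x *+ 2) = x by field.
  rewrite Re_sum /S horner_sum; congr (_ + _); apply: eq_bigr => i _.
  rewrite hornerZ hornerXn expr1n mulr1 -[_.+1%:R in RHS](rmorph_nat (real_complex R)).
  by rewrite -fmorphV ReMr.
have f0 : f 0 = 0.
  rewrite /f pE rmorph0 mul0r subr0 cabs1 expr1n ln1 mulr0 add0r /S horner_sum.
  by apply: big1 => i _; rewrite hornerZ hornerXn expr0n mulr0.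
pose df (t : R) := 2^-1 * ((p.[t])^-1 * p^`().[t]) + S^`().[t].
rewrite -f1 -[X in `|X|]subr0 -f0; apply: (@mvt_le _ f df) => t t01.
  have pt0 : 0 < p.[t] by rewrite pE exprn_gt0// u0'.
  apply: is_deriveD.
  have := @is_deriveZ _ _ _ (fun t => ln p.[t]) 2^-1 t 1 ((p.[t])^-1 * p^`().[t]).
  apply; apply: (@is_derive_comp_horner _ (@ln R)); exact: is_derive1_ln.
have un0 : 1 - t%:C * w != 0 by rewrite -cabs_gt0 u0'.
rewrite /df; have -> : 2^-1 * (p.[t]^-1 * p^`().[t]) + S^`().[t] =
    - complex.Re (w * (t%:C * w) ^+ K / (1 - t%:C * w)).
  have -> : S^`().[t] = complex.Re (w * \sum_(i < K) (t%:C * w) ^+ i).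
    rewrite mulr_sumr Re_sum /S linear_sum horner_sum; apply: eq_bigr => i _.
    rewrite /= derivZ derivXn /= hornerZ hornerMn hornerXn -[t ^+ i *+ _]mulr_natr.
    rewrite [_ * i.+1%:R]mulrC mulrA divfK ?pnatr_eq0// exprMn -rmorphXn mulrCA.
    by rewrite -exprS [in RHS]mulrC ReMr.
  have -> : 2^-1 * ((p.[t])^-1 * p^`().[t]) = - complex.Re (w / (1 - t%:C * w)).
    have -> : w / (1 - t%:C * w) = w * conjc (1 - t%:C * w) * ((p.[t])^-1)%:C.
      rewrite pE fmorphV/= sqr_cabsC invfM; move: (1 - _) un0 => u un0.
      by rewrite [RHS]mulrACA divff ?mulr1// conjc_eq0.
    rewrite ReMr; have -> : p^`().[t] = - 2 * complex.Re (w * conjc (1 - t%:C * w)).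
      rewrite /p !expr2 !(derivD, derivM, derivN, derivZ, derivX, derivC).
      by rewrite !hornerE wE /=; ring.
    by field; rewrite pE expf_eq0 /= gt_eqF// u0'.
  rewrite addrC -ReN -ReD -ReN; congr complex.Re.
  have -> : \sum_(i < K) (t%:C * w) ^+ i = (1 - (t%:C * w) ^+ K) / (1 - t%:C * w).
    by apply: (mulIf un0); rewrite mulfVK// mulrC -opprB mulNr -subrX1 opprB.
  by field.
rewrite normrN; apply: le_trans (Re_le_cabs _) _.
rewrite !cabsM cabsV cabsX cabsM exprMn; apply: ler_pM.
- by rewrite !mulr_ge0 ?exprn_ge0 ?cabs_ge0.
- by rewrite invr_ge0 cabs_ge0.
- rewrite exprS ler_wpM2l ?cabs_ge0// ler_piMl ?exprn_ge0 ?cabs_ge0//.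
  by rewrite cabs_real exprn_ile1//; case/andP: t01 => ? ?; rewrite ger0_norm.
- by rewrite lef_pV2 ?posrE ?subr_gt0 ?u0' ?u0.
Qed.

Lemma prim_root_exists N : (0 < N)%N -> exists z : R[i], N.-primitive_root z.
Proof.
move=> N0; pose p : {poly R[i]} := 'X^N - 1.
have [r Dp] := closed_field_poly_normal p; move: Dp.
rewrite (monicP _) ?monicXnsubC// scale1r => Dp.
have rn1 : all N.-unity_root r by apply/allP => z; rewrite -root_prod_XsubC -Dp.
have sz_r : (N < (size r).+1)%N.
  by rewrite -(size_prod_XsubC r id) -Dp size_XnsubC.
have [|z] := hasP (has_prim_root N0 rn1 _ sz_r); last by exists z.
by rewrite -separable_prod_XsubC -Dp separable_Xn_sub_1// pnatr_eq0 -lt0n.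
Qed.

Lemma prim_root_cabs N z : (0 < N)%N -> N.-primitive_root z -> cabs z = 1.
Proof.
move=> N0 /prim_expr_order /(congr1 (@cabs R)); rewrite cabsX cabs1 => /eqP.
by rewrite pexpr_eq1 ?cabs_ge0// => /eqP.
Qed.

Lemma prim_root_sum N z k : (0 < N)%N -> N.-primitive_root z ->
  \sum_(j < N) z ^+ (j * k) = if (N %| k)%N then N%:R else 0.
Proof.
move=> N0 hz; under eq_bigr do rewrite mulnC exprM.
case: ifP => [/dvdnP[c ->]|Nk].
  under eq_bigr do rewrite mulnC exprM (prim_expr_order hz) expr1n expr1n.
  by rewrite sumr_const card_ord.
have h : z ^+ k != 1 by rewrite -(prim_order_dvd hz) Nk.
apply: (mulfI (x := z ^+ k - 1)); first by rewrite subr_eq0.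
by rewrite -subrX1 mulr0 -exprM mulnC exprM (prim_expr_order hz) expr1n subrr.
Qed.

End LogSeries.

(** * Symmetric functions and a discrete Borel-Caratheodory inequality *)

Section BorelCaratheodory.
Variable R : realType.
Implicit Types (w z u : R[i]) (us : seq R[i]) (K m n N : nat) (M : R).

Definition psum us m : R[i] := \sum_(u <- us) u ^+ m.
Definition tau us z : R[i] := \prod_(u <- us) (1 - u * z).

(** Complete homogeneous symmetric functions, that is, the coefficients of the series 1 / [tau us],
    built by multiplying in one geometric series 1 / (1 - u z) per entry. *)
Fixpoint hsym us : nat -> R[i] :=
  if us is u :: us' then
    fun m => \sum_(i < m.+1) u ^+ (m - i) * hsym us' i
  else fun m => (m == 0)%:R.

Arguments hsym : simpl never.

Lemma hsym_nil m : hsym [::] m = (m == 0)%:R.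
Proof. by []. Qed.

Lemma hsym_consS u us m :
  hsym (u :: us) m.+1 = hsym us m.+1 + u * hsym (u :: us) m.
Proof.
rewrite /hsym -/hsym big_ord_recr /= subnn mul1r addrC; congr (_ + _).
rewrite mulr_sumr; apply: eq_bigr => i _.
by rewrite mulrA -exprS subSn// -ltnS.
Qed.

Lemma hsym_cons0 u us : hsym (u :: us) 0 = hsym us 0.
Proof. by rewrite /hsym -/hsym big_ord1 subnn mul1r. Qed.

(** Newton's identities: the logarithmic derivative of 1 / [tau us] generates the power sums. The
    induction on the list adds one factor; the inner one on m uses the recursion [hsym_consS]. *)
Lemma hsym_newton us m :
  m%:R * hsym us m = \sum_(i < m) psum us i.+1 * hsym us (m - i.+1).
Proof.
elim: us m => [|u us IH] m.
  rewrite big1 => [|i _]; last by rewrite /psum big_nil mul0r.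
  by case: m => [|m]; rewrite ?mul0r// hsym_nil mulr0.
elim: m => [|m IHm]; first by rewrite big_ord0 mul0r.
have pc i : psum (u :: us) i = psum us i + u ^+ i by rewrite /psum big_cons addrC.
transitivity (m.+1%:R * hsym us m.+1 + u * hsym (u :: us) m +
    u * (m%:R * hsym (u :: us) m)).
  by rewrite hsym_consS -natr1; ring.
rewrite IH IHm.
rewrite [X in X + _ + _ = _]big_ord_recr [RHS]big_ord_recr /= subnn hsym_cons0.
have -> : \sum_(i < m) psum (u :: us) i.+1 * hsym (u :: us) (m.+1 - i.+1) =
  \sum_(i < m) psum us i.+1 * hsym us (m.+1 - i.+1) +
  u * \sum_(i < m) psum us i.+1 * hsym (u :: us) (m - i.+1) +
  \sum_(i < m) u ^+ i.+1 * hsym (u :: us) (m - i).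
  rewrite mulr_sumr -!big_split /=; apply: eq_bigr => i _.
  rewrite pc mulrDl subSS; congr (_ + _).
  by rewrite -(subnSK (ltn_ord i)) hsym_consS; ring.
have h : u * hsym (u :: us) m + u * (\sum_(i < m) u ^+ i.+1 * hsym (u :: us) (m - i.+1)) =
  \sum_(i < m) u ^+ i.+1 * hsym (u :: us) (m - i) + u ^+ m.+1 * hsym us 0.
  transitivity (\sum_(i < m.+1) u ^+ i.+1 * hsym (u :: us) (m - i)).
    rewrite big_ord_recl expr1 subn0; congr (_ + _); rewrite mulr_sumr.
    by apply: eq_bigr => i _; rewrite mulrA -exprS.
  by rewrite big_ord_recr subnn hsym_cons0.
have -> : \sum_(i < m) psum (u :: us) i.+1 * hsym (u :: us) (m - i.+1) =
   \sum_(i < m) psum us i.+1 * hsym (u :: us) (m - i.+1) +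
   \sum_(i < m) u ^+ i.+1 * hsym (u :: us) (m - i.+1).
  by rewrite -big_split; apply: eq_bigr => i _; rewrite pc mulrDl.
rewrite pc mulrDl mulrDr.
set A := \sum_(i < m) psum us i.+1 * hsym us _.
set B := \sum_(i < m) psum us i.+1 * hsym (u :: us) _.
move: h; set E := \sum_(i < m) _; set F := \sum_(i < m) _ => h.
set G := psum us _ * _; set H := u ^+ _ * _.
transitivity (A + u * B + G + (u * hsym (u :: us) m + u * E)); first by ring.
by rewrite h -/H; ring.
Qed.

Definition taup us : {poly R[i]} := \prod_(u <- us) (1 - u *: 'X).

Lemma taupE us z : (taup us).[z] = tau us z.
Proof.
by rewrite horner_prod; apply: eq_bigr => u _; rewrite !hornerE.
Qed.

Lemma taup_hsym us m :
  \sum_(i < m.+1) (taup us)`_i * hsym us (m - i) = (m == 0)%:R.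
Proof.
elim: us m => [|u us IH] m.
  rewrite big_ord_recl hsym_nil subn0 /taup big_nil coef1 mul1r big1 ?addr0// => i _.
  by rewrite coef1 mul0r.
have cE i : (taup (u :: us))`_i.+1 = (taup us)`_i.+1 - u * (taup us)`_i.
  by rewrite /taup big_cons mulrBl mul1r coefB -scalerAl coefZ coefXM.
have c0 : (taup (u :: us))`_0 = (taup us)`_0.
  by rewrite /taup big_cons mulrBl mul1r coefB -scalerAl coefZ coefXM mulr0 subr0.
case: m => [|m].
  by rewrite big_ord1 c0 subnn hsym_cons0 -IH big_ord1.
have hA : \sum_(i < m.+1) (taup us)`_i.+1 * hsym (u :: us) (m - i) =
    \sum_(i < m.+1) (taup us)`_i.+1 * hsym us (m - i) +
    u * \sum_(i < m) (taup us)`_i.+1 * hsym (u :: us) (m - i.+1).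
  rewrite big_ord_recr [X in _ = X + _]big_ord_recr /= subnn hsym_cons0 addrAC.
  congr (_ + _); rewrite mulr_sumr -big_split /=; apply: eq_bigr => i _.
  by rewrite -(subnSK (ltn_ord i)) hsym_consS; ring.
have hB : \sum_(i < m.+1) u * (taup us)`_i * hsym (u :: us) (m - i) =
   u * ((taup us)`_0 * hsym (u :: us) m) +
   u * \sum_(i < m) (taup us)`_i.+1 * hsym (u :: us) (m - i.+1).
  rewrite big_ord_recl subn0 -mulrA; congr (_ + _); rewrite mulr_sumr.
  by apply: eq_bigr => i _; rewrite mulrA.
rewrite -IH big_ord_recl [RHS]big_ord_recl c0 subn0.
have -> : \sum_(i < m.+1) (taup us)`_(lift ord0 i) * hsym us (m.+1 - lift ord0 i) =
    \sum_(i < m.+1) (taup us)`_i.+1 * hsym us (m - i) by apply: eq_bigr.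
have -> : \sum_(i < m.+1) (taup (u :: us))`_(lift ord0 i) *
      hsym (u :: us) (m.+1 - lift ord0 i) =
    \sum_(i < m.+1) (taup us)`_i.+1 * hsym (u :: us) (m - i) -
    \sum_(i < m.+1) u * (taup us)`_i * hsym (u :: us) (m - i).
  by rewrite -sumrB; apply: eq_bigr => i _; rewrite cE mulrBl.
by rewrite hA hB hsym_consS; ring.
Qed.

(* The real parts of a trigonometric polynomial [Re \sum h_m z^m <= M] control
   its coefficients: average [M - log |tau|], which is nonnegative, against the
   N-th roots of unity. *)
Lemma psum_bound us M n : (0 < n)%N ->
  {in us, forall u, cabs u < 1} ->
  (forall z, cabs z = 1 -> cabs (tau us z) <= expR M) ->
  cabs (psum us n) <= 2 * M * n%:R.
Proof.
move=> n0 us1 tauM.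
pose h m : R[i] := psum us m / m%:R.
(* Error of cutting every log |1 - u z| after K terms. It vanishes as K grows, so it suffices to
   bound [h n] for each fixed K. *)
pose del K : R := \sum_(u <- us) cabs u ^+ K.+1 / (1 - cabs u).
suff key K : (n <= K)%N -> cabs (h n) <= 2 * M + 4 * del K.
  have hn : cabs (psum us n) = cabs (h n) * n%:R.
    by rewrite -(cabs_nat R) -cabsM /h divfK// pnatr_eq0 -lt0n.
  rewrite hn; apply: ler_wpM2r => //.
  have dcvg : 4 * del K @[K --> \oo] --> 0.
    rewrite -(mulr0 4); apply: cvgMr.
    have -> : (0 : R) = \sum_(u <- us) 0 by rewrite big1.
    rewrite /del; elim: us us1 {tauM h key hn del} => [|u us IH] us1.
      under eq_cvg do rewrite big_nil; rewrite big_nil; exact: cvg_cst.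
    under eq_cvg do rewrite big_cons; rewrite big_cons; apply: cvgD.
      rewrite -(mul0r (1 - cabs u)^-1); apply: cvgMl.
      rewrite (cvg_shiftS (fun k => cabs u ^+ k)); apply: cvg_expr.
      by rewrite ger0_norm ?cabs_ge0// us1 ?mem_head.
    by apply: IH => v vus; apply: us1; rewrite in_cons vus orbT.
  have kcvg : 2 * M + 4 * del K @[K --> \oo] --> 2 * M + 0.
    by apply: cvgD => //; exact: cvg_cst.
  have kle : \forall K \near \oo, cabs (h n) <= 2 * M + 4 * del K.
    by exists n => // K; exact: key.
  by rewrite -[leRHS]addr0; exact: cvgr_to_ge kcvg kle.
(* N = 2 K + 1 keeps the frequencies -K, ..., K distinct modulo N, so that averages over the N-th
   roots of unity are exact. *)
move=> nK; pose N := (K.*2).+1.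
have N0 : (0 < N)%N by [].
have [om omP] := prim_root_exists R N0.
have om1 := prim_root_cabs N0 omP.
pose lam (j : 'I_N) : R := M - ln (cabs (tau us (om ^+ j))).
pose G (j : 'I_N) : R[i] := \sum_(m < K) h m.+1 * om ^+ (j * m.+1).
have omj (j : nat) : cabs (om ^+ j) = 1 by rewrite cabsX om1 expr1n.
have ltu u j : u \in us -> cabs (u * om ^+ j) < 1.
  by move=> uus; rewrite cabsM omj mulr1 us1.
have tau0 (j : 'I_N) : 0 < cabs (tau us (om ^+ j)).
  rewrite cabs_gt0 /tau prodf_seq_neq0; apply/allP => u uus /=.
  rewrite subr_eq0; apply/eqP => /esym h1.
  by have := ltu u j uus; rewrite h1 cabs1 ltxx.
have lam0 j : 0 <= lam j.
  by rewrite subr_ge0 -(expRK M) ler_ln ?posrE ?expR_gt0// tauM.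
have lamG j : `|lam j - M - complex.Re (G j)| <= del K.
  rewrite /lam (_ : M - _ - M - _ = - (ln (cabs (tau us (om ^+ j))) +
    complex.Re (G j))); last by ring.
  rewrite normrN.
  have -> : ln (cabs (tau us (om ^+ j))) + complex.Re (G j) =
    \sum_(u <- us) (ln (cabs (1 - u * om ^+ j)) +
       complex.Re (\sum_(i < K) (u * om ^+ j) ^+ i.+1 / i.+1%:R)).
    rewrite big_split /=; congr (_ + _).
      rewrite /tau cabs_prod; have : {in us, forall u, 0 < cabs (1 - u * om ^+ j)}.
        move=> u uus; rewrite cabs_gt0 subr_eq0; apply/eqP => /esym h1.
        by have := ltu u j uus; rewrite h1 cabs1 ltxx.
      elim: us {us1 tauM h del lam G ltu tau0 lam0} => [|u us IH] hp.
        by rewrite !big_nil ln1.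
      rewrite !big_cons lnM ?posrE ?IH//.
      - by move=> v vus; rewrite hp// in_cons vus orbT.
      - by rewrite hp// mem_head.
      - rewrite big_seq; apply: prodr_gt0 => v vus.
        by rewrite hp// in_cons vus orbT.
    rewrite -Re_sum exchange_big /=; congr complex.Re; apply: eq_bigr => i _.
    rewrite /h /psum !mulr_suml; apply: eq_bigr => u _.
    by rewrite exprMn -exprM mulrAC.
  apply: le_trans (ler_norm_sum _ _ _) _; rewrite /del big_seq [leRHS]big_seq.
  apply: ler_sum => u uus; have := ln_cabs_1B K (ltu u j uus).
  by rewrite cabsM omj mulr1.
have sumG : \sum_j G j = 0.
  rewrite exchange_big /= big1 // => m _.
  rewrite -mulr_sumr (prim_root_sum _ N0 omP) gtnNdvd ?mulr0//.
  by rewrite /N ltnS -addnn; apply: leq_trans (ltn_ord m) (leq_addr _ _).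
have sumGc : \sum_j G j * om ^+ (j * (N - n)) = N%:R * h n.
  under eq_bigr do rewrite mulr_suml.
  have nK' : (n.-1 < K)%N by rewrite prednK.
  rewrite exchange_big /= (bigD1 (Ordinal nK'))//= [X in _ + X]big1 ?addr0 => [|m mn].
    under eq_bigr do rewrite -mulrA -exprD -mulnDr prednK//.
    rewrite -mulr_sumr (prim_root_sum _ N0 omP) subnKC ?dvdnn ?prednK// 1?mulrC//.
    by rewrite /N -addnn; apply: leq_trans nK _; rewrite leqW// leq_addr.
  under eq_bigr do rewrite -mulrA -exprD -mulnDr.
  rewrite -mulr_sumr (prim_root_sum _ N0 omP) ifF ?mulr0//.
  apply/negP => /dvdnP[c hc]; move: mn; rewrite -val_eqE /=.
  by have := ltn_ord m; move: hc nK n0; rewrite /N -addnn; case: c => [|[|c]]; nia.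
have sumGJ : \sum_j conjc (G j) * om ^+ (j * (N - n)) = 0.
  have omJ : conjc om = om ^+ N.-1.
    have om0 : om != 0 by rewrite -cabs_gt0 om1.
    apply: (mulfI om0); rewrite -sqr_cabsC om1 expr1n rmorph1 -exprS prednK//.
    by rewrite (prim_expr_order omP).
  have GJ j : conjc (G j) = \sum_(m < K) conjc (h m.+1) * om ^+ (j * (N.-1 * m.+1)).
    rewrite /G rmorph_sum /=; apply: eq_bigr => m _.
    by rewrite rmorphM rmorphXn /= omJ -exprM mulnCA.
  under eq_bigr do rewrite GJ mulr_suml.
  rewrite exchange_big big1//= => m _.
  under eq_bigr do rewrite -mulrA -exprD -mulnDr.
  rewrite -mulr_sumr (prim_root_sum _ N0 omP) ifF ?mulr0//.
  apply/negP => /dvdnP[c hc].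
  have : (N %| n + m.+1)%N.
    apply/dvdnP; exists (m.+1 + 1 - c)%N.
    by have := ltn_ord m; move: hc nK n0; rewrite /N -addnn /=; nia.
  by rewrite gtnNdvd// ?addn_gt0 ?n0// /N -addnn; have := ltn_ord m; lia.
have sum1 : \sum_(j < N) om ^+ (j * (N - n)) = 0.
  rewrite (prim_root_sum _ N0 omP) gtnNdvd// ?subn_gt0 /N -?addnn; last by lia.
  by rewrite ltnS; apply: leq_trans nK (leq_addr _ _).
have sumRe : \sum_j complex.Re (G j) = 0 by rewrite -Re_sum sumG.
have sumlam : \sum_j lam j <= N%:R * (M + del K).
  have -> : \sum_j lam j = \sum_j (lam j - M - complex.Re (G j)) + N%:R * M.
    rewrite !sumrB sumRe subr0 sumr_const card_ord mulr_natl.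
    by rewrite subrK.
  rewrite mulrDr addrC lerD2l; apply: le_trans (ler_norm _) _.
  apply: le_trans (ler_norm_sum _ _ _) _.
  apply: le_trans (ler_sum _ (fun j _ => lamG j)) _.
  by rewrite sumr_const card_ord mulr_natl.
(* At frequency -n, written N - n, the sum of 2 Re G = G + conj G picks out h_n. The constant M sums
   to 0 there, so 2 Re G may be replaced by 2 [lam], up to an error controlled by [del K]. *)
have hN : (N%:R * h n) = \sum_j (2 * (lam j)%:C * om ^+ (j * (N - n)))
     - \sum_j (2 * (lam j - M - complex.Re (G j))%:C * om ^+ (j * (N - n))).
  rewrite -sumrB.
  transitivity (\sum_(j < N) (2 * M%:C * om ^+ (j * (N - n)) + G j * om ^+ (j * (N - n)) +
     conjc (G j) * om ^+ (j * (N - n)))).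
    by rewrite !big_split /= sumGc sumGJ -mulr_sumr sum1 mulr0 add0r addr0.
  apply: eq_bigr => j _; set e := om ^+ _.
  transitivity (2 * M%:C * e + 2 * (complex.Re (G j))%:C * e).
    by rewrite -addcJ; ring.
  by rewrite !rmorphB /=; ring.
have : N%:R * cabs (h n) <= N%:R * (2 * M + 4 * del K).
  rewrite -[X in X * _](cabs_nat R) -cabsM hN; apply: le_trans (cabsB _ _) _.
  have b1 (x : R) j : cabs (2 * x%:C * om ^+ (j * (N - n))) = 2 * `|x|.
    by rewrite !cabsM omj mulr1 cabs_real cabs_nat.
  apply: le_trans (lerD (cabs_sum _ _ _) (cabs_sum _ _ _)) _.
  under eq_bigr do rewrite b1 ger0_norm//.
  under [X in _ + X]eq_bigr do rewrite b1.
  rewrite -!mulr_sumr.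
  apply: le_trans (_ : 2 * (N%:R * (M + del K)) + 2 * (N%:R * del K) <= _).
    apply: lerD; rewrite ler_pM2l//.
    apply: le_trans (ler_sum _ (fun j _ => lamG j)) _.
    by rewrite sumr_const card_ord mulr_natl.
  by rewrite le_eqVlt; apply/orP; left; apply/eqP; ring.
by rewrite ler_pM2l ?ltr0n.
Qed.

End BorelCaratheodory.

(** * Coefficients of the reciprocal of a zero-free polynomial *)

Section InverseBound.
Variable R : realType.
Implicit Types (w z u x : R[i]) (vs : seq R[i]) (m n : nat) (M rho B : R).

Lemma horner_ge0 (p : {poly R}) (t : R) :
  (forall i, 0 <= p`_i) -> 0 <= t -> 0 <= p.[t].
Proof.
move=> p0 t0; rewrite horner_coef; apply: sumr_ge0 => i _.
by rewrite mulr_ge0// exprn_ge0.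
Qed.

(** By the recursion the truncated generating polynomial S satisfies S' <= H' S coefficientwise,
    where H' has the coefficients 2 M (m + 1). Hence S e^(-H) decreases on [0, 2/3], and S(2/3) <=
    e^(H(2/3)). *)
Lemma newton_gronwall (c : nat -> R) M n : (forall m, 0 <= c m) -> c 0%N <= 1 ->
  0 <= M ->
  (forall m, m%:R * c m <= \sum_(i < m) 2 * M * i.+1%:R * c (m - i.+1)%N) ->
  c n * (2 / 3) ^+ n <= expR (4 * M).
Proof.
(* The value 2/3 makes 2 M [th] / (1 - [th]) = 4 M, which is the exponent obtained. *)
move=> c0 c1 M0 cle; set th : R := 2 / 3.
have th0 : 0 <= th by rewrite /th; lra.
pose S := \poly_(i < n.+1) c i.
pose H : {poly R} := \sum_(i < n) (2 * M) *: 'X^(i.+1).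
have dH m : H^`()`_m = if (m < n)%N then 2 * M * m.+1%:R else 0.
  rewrite coef_deriv /H coef_sum; case: ltnP => mn.
    rewrite (bigD1 (Ordinal mn))//= big1 => [|i im].
      by rewrite coefZ coefXn eqxx mulr1 addr0 mulr_natr.
    rewrite coefZ coefXn eqSS; case: eqP => [e|]; last by rewrite mulr0.
    by move: im; rewrite -val_eqE /= e eqxx.
  rewrite big1 ?mul0rn// => i _; rewrite coefZ coefXn eqSS gtn_eqF ?mulr0//.
  exact: leq_trans (ltn_ord i) mn.
have D0 i : 0 <= (H^`() * S - S^`())`_i.
  rewrite coefB coefM coef_deriv coef_poly ltnS subr_ge0.
  have all0 (j : 'I_i.+1) : 0 <= H^`()`_j * S`_(i - j).
    rewrite dH coef_poly; do 2 case: ifP => _ //; rewrite ?mulr0 ?mul0r//.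
    by rewrite !mulr_ge0.
  have [iltn|nlei] := ltnP i n; last by rewrite mul0rn sumr_ge0.
  rewrite -mulr_natl; apply: le_trans (cle _) _; apply: ler_sum => j _.
  rewrite dH coef_poly (leq_ltn_trans _ iltn) ?subSS -1?ltnS//.
  by rewrite ifT// !ltnS (leq_trans (leq_subr _ _))// ltnW.
pose F (t : R) := S.[t] * expR (- H.[t]).
pose dF (t : R) := - ((H^`() * S - S^`()).[t] * expR (- H.[t])).
have dFP (t : R) : is_derive t (1 : R) F (dF t).
  have h1 : is_derive t (1 : R) (fun t => expR (- H).[t]) (expR (- H).[t] * (- H)^`().[t]).
    exact: (@is_derive_comp_horner _ expR).
  have -> : F = (fun t => S.[t]) * (fun t => expR (- H).[t]).
    by apply/funext => y; rewrite /F -hornerN.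
  have := @is_deriveM _ _ (fun t => S.[t]) _ _ _ _ _ (is_derive_poly S t) h1.
  move=> /is_derive_eq; apply; rewrite /dF derivN !hornerE /GRing.scale /=.
  by ring.
have : F th <= F 0.
  have [|c' c'P] := @MVT_segment R F dF 0 th th0.
    by apply: derivable_within_continuous => t _; have [] := dFP t.
  rewrite -subr_le0 subr0 => ->; rewrite mulNr oppr_le0 !mulr_ge0 ?expR_ge0//.
  by rewrite horner_ge0//; move: c'P; rewrite in_itv => /andP[].
have F0 : F 0 <= 1.
  rewrite /F (_ : H.[0] = 0) ?oppr0 ?expR0 ?mulr1.
    by rewrite horner_coef0 coef_poly.
  by rewrite /H horner_sum big1// => i _; rewrite hornerZ hornerXn expr0n mulr0.
move=> /le_trans/(_ F0); rewrite /F expRN ler_pdivrMr ?expR_gt0// mul1r => hS.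
apply: le_trans (_ : S.[th] <= _).
  rewrite /S horner_poly big_ord_recr /= lerDr sumr_ge0// => i _.
  by rewrite mulr_ge0// exprn_ge0.
apply: le_trans hS _; rewrite ler_expR /H horner_sum.
under eq_bigr do rewrite hornerZ hornerXn exprS.
rewrite -!mulr_sumr.
have -> : \sum_(i < n) th ^+ i = 3 * (1 - th ^+ n).
  apply: (mulfI (x := th - 1)); first by rewrite /th; apply/eqP; lra.
  by rewrite -subrX1 /th; field.
have := exprn_ge0 n th0; rewrite {2}/th; nra.
Qed.

Lemma taup_scale vs u l :
  (taup [seq u * v | v <- vs])`_l = u ^+ l * (taup vs)`_l.
Proof.
elim: vs l => [|v vs IH] l.
  by rewrite /taup !big_nil coef1; case: l => [|l]; rewrite ?mulr0// expr0 mul1r.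
rewrite /= /taup !big_cons !mulrBl !mul1r -!scalerAl !coefB !coefZ !coefXM.
rewrite -/(taup _) -/(taup _) IH; case: l => [|l] /=; first by rewrite !mulr0 !subr0.
by rewrite IH exprS; ring.
Qed.

(** [T] splits, and [rho] times its reciprocal roots lie in the open unit disc. Then [b] is [hsym]
    up to scaling: [psum_bound] gives 2 M m for the m-th power sum, and Newton's identities turn
    this into a bound for the coefficients of 1 / T. *)
Lemma poly_inverse_bound (T : {poly R[i]}) rho M : 0 < rho ->
  (forall z, cabs z <= rho -> T.[z] != 0) ->
  (forall z, cabs z = rho -> cabs T.[z] <= expR M * cabs T`_0) ->
  exists2 b : nat -> R[i],
    (forall m, \sum_(l < m.+1) T`_l * b (m - l)%N = (m == 0)%:R) &
    forall m, cabs (b m) <= (cabs T`_0)^-1 * expR (4 * M) * (3 / 2 / rho) ^+ m.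
Proof.
move=> rho0 Tn0 TM.
have [rs Trs] := closed_field_poly_normal T.
have T0 : T`_0 != 0 by rewrite -horner_coef0 Tn0// cabs0 ltW.
have rsP z : z \in rs -> rho < cabs z.
  move=> zrs; rewrite ltNge; apply/negP => /Tn0; rewrite Trs hornerZ => /negP; apply.
  rewrite horner_prod (big_rem z)//= hornerXsubC subrr mul0r mulr0 //.
have rs0 z : z \in rs -> z != 0.
  by move=> /rsP h; rewrite -cabs_gt0 (lt_trans rho0).
pose vs := [seq z^-1 | z <- rs].
pose us := [seq rho%:C * v | v <- vs].
have Tvs : T = T`_0 *: taup vs.
  have [c Tc] : exists c, T = c *: taup vs.
    exists (lead_coef T * \prod_(z <- rs) (- z)).
    rewrite {1}Trs -scalerA; congr (_ *: _); rewrite /vs /taup big_map.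
    elim: rs rs0 {Trs rsP vs us} => [|z s IH] s0; first by rewrite !big_nil scale1r.
    rewrite !big_cons IH => [|y ys]; last by rewrite s0// in_cons ys orbT.
    have -> : 'X - z%:P = - z *: (1 - z^-1 *: 'X).
      rewrite scalerBr scalerA mulNr divff ?s0 ?mem_head//.
      by rewrite scaleN1r opprK addrC -mul_polyC mulr1 polyCN.
    by rewrite -scalerAr -scalerAl scalerA [_ * - z]mulrC.
  have t0 : (taup vs)`_0 = 1.
    by rewrite -horner_coef0 taupE /tau big1// => u _; rewrite mulr0 subr0.
  by rewrite {1}Tc [in RHS]Tc coefZ t0 mulr1.
have us1 : {in us, forall u, cabs u < 1}.
  move=> _ /mapP[_ /mapP[z zrs ->] ->].
  rewrite cabsM cabsV cabs_real ger0_norm ?(ltW rho0)// ltr_pdivrMr ?mul1r ?rsP//.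
  by rewrite cabs_gt0 rs0.
have cT0 : 0 < cabs T`_0 by rewrite cabs_gt0.
have tauM z : cabs z = 1 -> cabs (tau us z) <= expR M.
  move=> z1; have := TM (rho%:C * z).
  rewrite cabsM z1 mulr1 cabs_real ger0_norm ?(ltW rho0)// => /(_ erefl).
  rewrite {1}Tvs hornerZ cabsM mulrC ler_pM2r// taupE.
  have -> // : tau us z = tau vs (rho%:C * z).
  by rewrite /tau [LHS]big_map; apply: eq_bigr => v _; rewrite mulrCA mulrA.
have M0 : 0 <= M.
  have := psum_bound (n := 1) isT us1 tauM.
  by move=> /(le_trans (cabs_ge0 _)); rewrite mulr1 pmulr_rge0.
exists (fun m => (T`_0)^-1 * (rho%:C^-1 ^+ m * hsym us m)).
  move=> m; have rC : rho%:C != 0 :> R[i] by rewrite -cabs_gt0 cabs_real normr_gt0 gt_eqF.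
  transitivity (rho%:C^-1 ^+ m * \sum_(l < m.+1) (taup us)`_l * hsym us (m - l)).
    rewrite mulr_sumr; apply: eq_bigr => l _.
    rewrite {1}Tvs coefZ taup_scale mulrACA mulfV// mul1r.
    have -> : rho%:C^-1 ^+ m = rho%:C^-1 ^+ (m - l) * rho%:C^-1 ^+ l :> R[i].
      by rewrite -exprD subnK// -ltnS.
    have rl : rho%:C^-1 ^+ l * rho%:C ^+ l = 1 :> R[i] by rewrite -exprMn mulVf// expr1n.
    set e := _ ^+ (m - l); set hm := hsym _ _; set t := (taup _)`_l.
    by rewrite -[LHS]mul1r -rl; ring.
  by rewrite taup_hsym; case: m => [|m]; rewrite ?mulr0// expr0 mulr1.
move=> m; rewrite !cabsM cabsV -[leRHS]mulrA ler_wpM2l ?invr_ge0 ?cabs_ge0//.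
rewrite cabsX cabsV cabs_real ger0_norm ?(ltW rho0)// exprMn mulrCA mulrC.
rewrite [leRHS]mulrA; apply: ler_wpM2r; first by rewrite exprn_ge0 ?invr_ge0 ?(ltW rho0).
rewrite mulrC -ler_pdivrMr ?exprn_gt0// -exprVn invf_div.
apply: (@newton_gronwall (fun m => cabs (hsym us m))) => //.
- by move=> k; rewrite cabs_ge0.
- have := taup_hsym us 0; rewrite big_ord1 subnn.
  by rewrite -horner_coef0 taupE /tau big1 ?mul1r => [->|u _];
    rewrite ?cabs1// mulr0 subr0.
- move=> k; rewrite -(cabs_nat R) -cabsM hsym_newton.
  apply: le_trans (cabs_sum _ _ _) _; apply: ler_sum => i _.
  by rewrite cabsM ler_wpM2r ?cabs_ge0// psum_bound.
Qed.

(** T times a partial sum of the formal inverse agrees with 1 below degree J, and its later terms at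
    x are O(2^-k). So the partial sums, whose increments are geometric, can only tend to 1 /
    T(x). *)
Lemma poly_inverse_series (T : {poly R[i]}) (b : nat -> R[i]) x B n :
  (forall m, \sum_(l < m.+1) T`_l * b (m - l)%N = (m == 0)%:R) ->
  0 <= B -> T.[x] != 0 ->
  (forall m, cabs (b m) * cabs x ^+ m <= B * 2^-1 ^+ m) ->
  cabs (T.[x]^-1 - \sum_(m < n) b m * x ^+ m) <= 2 * B * 2^-1 ^+ n.
Proof.
move=> Tb B0 Tx0 bB; set s := size T.
pose C := B * \sum_(l < s) cabs T`_l * cabs x ^+ l * 2 ^+ l.
pose S J := \sum_(m < J) b m * x ^+ m.
have TS J : (0 < J)%N -> cabs (T.[x] * S J - 1) <= 2 * C * 2^-1 ^+ J.
  move=> J0; pose P := \poly_(m < J) b m.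
  have sz : (size (T * P)%R <= s + J)%N.
    apply: leq_trans (size_polyMleq _ _) _; apply: leq_trans (leq_pred _) _.
    by rewrite leq_add2l size_poly.
  have -> : T.[x] * S J = (T * P).[x] by rewrite hornerM horner_poly.
  rewrite (horner_coef_wide _ sz) -(big_mkord xpredT (fun i => (T * P)`_i * x ^+ i)).
  rewrite (big_cat_nat (n := J)) ?leq_addl//=.
  have -> : \sum_(0 <= i < J) (T * P)`_i * x ^+ i = 1.
    rewrite big_mkord -(prednK J0) big_ord_recl /= big1 => [|i _].
      have := Tb 0%N; rewrite big_ord1 => h.
      by rewrite coefM big_ord1 coef_poly J0 h !mulr1 addr0.
    have iJ : (i.+1 < J)%N by have := ltn_ord i; rewrite -ltnS prednK.
    rewrite /bump /= add1n coefM.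
    under eq_bigr => l _ do rewrite /P coef_poly (leq_ltn_trans (leq_subr _ _) iJ).
    by rewrite Tb mul0r.
  rewrite addrAC subrr add0r; apply: le_trans (cabs_sum _ _ _) _.
  apply: le_trans (_ : \sum_(J <= k < s + J) C * 2^-1 ^+ k <= _); last first.
    rewrite -mulr_sumr -mulrA mulrCA; apply: ler_wpM2l; last exact: sum_half.
    rewrite mulr_ge0// sumr_ge0// => l _.
    by rewrite !mulr_ge0 ?exprn_ge0 ?cabs_ge0.
  apply: ler_sum => k _; rewrite cabsM coefM cabsX.
  apply: le_trans (ler_wpM2r _ (cabs_sum _ _ _)) _.
    by rewrite exprn_ge0 ?cabs_ge0.
  rewrite /C mulr_sumr !mulr_suml.
  pose g l := B * (cabs T`_l * cabs x ^+ l * 2 ^+ l) * 2^-1 ^+ k.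
  have g0 l : 0 <= g l by rewrite /g !mulr_ge0 ?exprn_ge0 ?cabs_ge0.
  apply: le_trans (_ : \sum_(l < k.+1) g l <= _).
    apply: ler_sum => l _; rewrite cabsM coef_poly.
    have -> : cabs x ^+ k = cabs x ^+ (k - l) * cabs x ^+ l.
      by rewrite -exprD subnK// -ltnS.
    have -> : g l = cabs T`_l * cabs x ^+ l * (B * 2^-1 ^+ (k - l)).
      rewrite /g (_ : 2^-1 ^+ k = 2^-1 ^+ (k - l) * 2^-1 ^+ l); last first.
        by rewrite -exprD subnK// -ltnS.
      by rewrite [2^-1 ^+ l]exprVn; field; rewrite expf_neq0.
    case: ifP => _; last by rewrite cabs0 mulr0 mul0r !mulr_ge0 ?exprn_ge0 ?cabs_ge0.
    rewrite mulrACA; rewrite [X in X <= _](_ : _ = cabs T`_l * cabs x ^+ l * (cabs (b (k - l)%N) * cabs x ^+ (k - l))); last by ring.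
    by apply: ler_wpM2l; rewrite ?mulr_ge0 ?exprn_ge0 ?cabs_ge0.
  rewrite -(big_mkord xpredT g) -(big_mkord xpredT (fun l => g l)).
  have [ks|sk] := leqP k.+1 s.
    by rewrite [leRHS](big_cat_nat (n := k.+1))//= lerDl sumr_ge0.
  rewrite (big_cat_nat (n := s) _ (ltnW sk))//= gerDl big_nat big1// => l /andP[sl _].
  by rewrite /g nth_default// cabs0 !mul0r mulr0 mul0r.
have SS J : (n <= J)%N -> cabs (S J - S n) <= 2 * B * 2^-1 ^+ n.
  move=> nJ; rewrite /S -!(big_mkord xpredT (fun m => b m * x ^+ m)).
  rewrite (big_cat_nat (n := n) _ nJ)//= addrAC subrr add0r.
  apply: le_trans (cabs_sum _ _ _) _.
  apply: le_trans (_ : \sum_(n <= k < J) B * 2^-1 ^+ k <= _).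
    by apply: ler_sum => k _; rewrite cabsM cabsX.
  by rewrite -mulr_sumr -mulrA mulrCA; apply: ler_wpM2l => //; exact: sum_half.
apply: (@ler_add_cvg0 _ (fun J => (cabs T.[x])^-1 * (2 * C) * 2^-1 ^+ J) _ _ n.+1).
  by apply: cvg0_Ml; exact: cvg_half.
move=> J nJ.
have -> : T.[x]^-1 - \sum_(m < n) b m * x ^+ m =
    (S J - S n) - T.[x]^-1 * (T.[x] * S J - 1) by rewrite /S; field.
apply: le_trans (cabsB _ _) _; apply: lerD; first by rewrite SS// ltnW.
rewrite cabsM cabsV -mulrA ler_wpM2l ?invr_ge0 ?cabs_ge0//.
by rewrite TS// (leq_ltn_trans _ nJ).
Qed.

End InverseBound.

(** * Dirichlet series of nonprincipal characters *)

Section AbelSummation.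
Variable R : realType.
Implicit Types (a g : nat -> R[i]) (B : R) (m n N : nat).

Lemma abel_sum a g m N : (m <= N)%N ->
  \sum_(m <= n < N) a n * g n =
  (\sum_(0 <= n < N) a n) * g N - (\sum_(0 <= n < m) a n) * g m +
  \sum_(m <= n < N) (\sum_(0 <= i < n.+1) a i) * (g n - g n.+1).
Proof.
move=> mN; rewrite -(subnKC mN); elim: (N - m)%N => [|k IH].
  by rewrite addn0 !(big_geq (leqnn m)) subrr addr0.
rewrite addnS big_nat_recr ?leq_addr//= IH.
rewrite [in RHS]big_nat_recr//= [X in _ = _ + X]big_nat_recr ?leq_addr//=.
by rewrite big_nat_recr//=; ring.
Qed.

Lemma abel_bound a g B m N : (m <= N)%N -> 0 <= B ->
  (forall n, cabs (\sum_(0 <= i < n) a i) <= B) ->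
  cabs (\sum_(m <= n < N) a n * g n) <=
  B * (cabs (g m) + cabs (g N) + \sum_(m <= n < N) cabs (g n - g n.+1)).
Proof.
move=> mN B0 aB; rewrite abel_sum//; apply: le_trans (cabsD _ _) _.
rewrite mulrDr; apply: lerD.
  apply: le_trans (cabsB _ _) _; rewrite !cabsM addrC mulrDr.
  by apply: lerD; apply: ler_wpM2r; rewrite ?cabs_ge0.
apply: le_trans (cabs_sum _ _ _) _; rewrite mulr_sumr; apply: ler_sum => n _.
by rewrite cabsM; apply: ler_wpM2r; rewrite ?cabs_ge0.
Qed.

End AbelSummation.

(** * Basic properties of characters and convergence of L(s, chi) *)

Section Characters.
Variable R : realType.
Variables (q : nat) (chi : int -> R[i]).
Hypothesis q0 : (0 < q)%N.
Hypothesis chiP : dirichlet_character q chi.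
Implicit Types (a b : int) (n m N : nat) (s : R[i]).

Lemma dc_per a : chi (a + q%:Z) = chi a. Proof. by case: chiP. Qed.
Lemma dcM a b : chi (a * b) = chi a * chi b. Proof. by case: chiP. Qed.
Lemma dc_neq0 a : (chi a != 0) = coprimez a q%:Z. Proof. by case: chiP. Qed.
Lemma dc_eq0 a : ~~ coprimez a q%:Z -> chi a = 0.
Proof. by rewrite -dc_neq0 negbK => /eqP. Qed.

Lemma dc1 : chi 1 = 1.
Proof.
have h : chi 1 != 0 by rewrite dc_neq0 /coprimez gcd1z.
by apply: (mulfI h); rewrite -dcM mulr1 mulr1.
Qed.

Lemma dc_perM a (k : int) : chi (a + k * q%:Z) = chi a.
Proof.
have hn (n : nat) b : chi (b + n%:Z * q%:Z) = chi b.
  elim: n b => [|n IH] b; first by rewrite mul0r addr0.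
  by rewrite intS mulrDl mul1r addrA IH dc_per.
case: k => n; first exact: hn.
by rewrite NegzE mulNr -(hn n.+1 (a - _)) subrK.
Qed.

Lemma dc_mod a : chi a = chi (a %% q%:Z)%Z.
Proof. by rewrite {1}(divz_eq a q%:Z) addrC dc_perM. Qed.

Lemma dc_modn n : chi n%:Z = chi (n %% q)%N%:Z.
Proof. by rewrite dc_mod modz_nat. Qed.

Lemma dc_natmod a : exists2 n, (n < q)%N & chi a = chi n%:Z /\ (a = n%:Z %[mod q%:Z])%Z.
Proof.
have h := modz_ge0 a (_ : q%:Z != 0); rewrite -lt0n in h.
have {}h := h q0; exists `|(a %% q%:Z)%Z|%N.
  by rewrite -ltz_nat gez0_abs// ltz_pmod.
by rewrite gez0_abs// -dc_mod modz_mod.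
Qed.

Lemma dcX a n : chi (a ^+ n) = chi a ^+ n.
Proof. by elim: n => [|n IH]; rewrite ?expr0 ?dc1// !exprS dcM IH. Qed.

Lemma dc_cabs1 a : coprimez a q%:Z -> cabs (chi a) = 1.
Proof.
have [n _ [-> an]] := dc_natmod a.
rewrite /coprimez -gcdz_modl an gcdz_modl -/(coprimez _ _) coprimezE /= => cn.
have : cabs (chi n%:Z) ^+ totient q = 1.
  rewrite -cabsX -dcX -rmorphXn /= dc_modn.
  by rewrite (Euler_exp_totient cn) -dc_modn dc1 cabs1.
by move/eqP; rewrite pexpr_eq1 ?totient_gt0 ?cabs_ge0// => /eqP.
Qed.

Lemma dc_cabs_le1 a : cabs (chi a) <= 1.
Proof.
have [h|h] := boolP (coprimez a q%:Z); first by rewrite dc_cabs1.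
by rewrite dc_eq0// cabs0.
Qed.

Hypothesis chi_np : chi <> principal_character R q.

Lemma dc_sum0 : \sum_(0 <= n < q) chi n%:Z = 0.
Proof.
have [a ac achi] : exists2 a, coprimez a q%:Z & chi a != 1.
  apply: contrapT => h; apply: chi_np; apply/funext => a.
  rewrite /principal_character; case: (boolP (coprimez a q%:Z)) => ca.
    by apply/eqP; apply: contrapT => /negP ?; apply: h; exists a.
  by rewrite dc_eq0.
have [n nq [an amn]] := dc_natmod a.
have cn : coprime n q.
  by move: ac; rewrite /coprimez -gcdz_modl amn gcdz_modl -/(coprimez _ _) coprimezE.
rewrite an in achi; rewrite big_mkord.
set S := \sum_(_ < _) _.
have : chi n%:Z * S = S.
  rewrite mulr_sumr /S; pose f (i : 'I_q) : 'I_q := Ordinal (ltn_pmod (n * i) q0).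
  have finj : injective f.
    suff fle (i j : 'I_q) : (i <= j)%N -> f i = f j -> i = j.
      by move=> i j fij; case/orP: (leq_total i j) => h;
        [exact: fle|apply/esym; exact: fle].
    move=> ij /(congr1 val) /= /eqP; rewrite eq_sym eqn_mod_dvd ?leq_mul2l ?ij ?orbT//.
    rewrite -mulnBr Gauss_dvdr 1?coprime_sym// => h; apply/val_inj/eqP.
    rewrite eqn_leq ij -subn_eq0 -leqn0 leqNgt; apply/negP => /dvdn_leq/(_ h).
    by move=> /leq_trans/(_ (leq_subr _ _)); rewrite leqNgt ltn_ord.
  rewrite [RHS](reindex_inj finj)/=; apply: eq_bigr => i _.
  by rewrite -dc_modn PoszM dcM.
move/eqP; rewrite -subr_eq0 -{2}[S]mul1r -mulrBl mulf_eq0 subr_eq0 (negPf achi).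
by move/eqP.
Qed.

(** Whole periods cancel. The trivial bound q suffices: in [Lfun_upper] the series is cut at n = q,
    where q is compensated by a factor of size about 1 / q. *)
Lemma dc_sum_bound N : cabs (\sum_(0 <= n < N) chi n%:Z) <= q%:R.
Proof.
have hk k : \sum_(0 <= n < k * q) chi n%:Z = 0.
  elim: k => [|k IH]; first by rewrite big_geq.
  rewrite (big_cat_nat (n := k * q)) ?leq_mul2r ?leqnSn ?orbT//= IH add0r.
  rewrite -{1}[(k * q)%N]add0n mulSn big_addn addnK -[RHS]dc_sum0.
  by apply: eq_bigr => i _; rewrite dc_modn addnC modnMDl -dc_modn.
rewrite {1}(divn_eq N q) (big_cat_nat (n := N %/ q * q)) ?leq_addr//= hk add0r.
apply: le_trans (cabs_sum _ _ _) _.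
apply: le_trans (ler_sum _ (fun i _ => dc_cabs_le1 i%:Z)) _.
rewrite big_const_nat iter_addr addr0 addKn ler_nat.
by rewrite ltnW// ltn_pmod.
Qed.

Definition Lpart N s : R[i] := \sum_(1 <= n < N.+1) chi n%:Z * npow n (- s).

(** Abel summation against the bounded character sums; the variation of n^-s beyond m is at most 2
    |s| / Re s times m^(-Re s). *)
Lemma Lpart_tail m N s : 0 < complex.Re s -> (0 < m)%N -> (m <= N)%N ->
  cabs (Lpart N s - Lpart m s) <=
  2 * q%:R * (1 + cabs s / complex.Re s) * rpw (complex.Re s) m.
Proof.
move=> s0 m0 mN; set x := complex.Re s.
have -> : Lpart N s - Lpart m s = \sum_(m.+1 <= n < N.+1) chi n%:Z * npow n (- s).
  by rewrite /Lpart (big_cat_nat (n := m.+1) (p := N.+1))//= addrAC subrr add0r.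
apply: le_trans (abel_bound (fun n => npow n (- s)) _ _ dc_sum_bound) _ => //.
rewrite [2 * _]mulrC -!mulrA ler_wpM2l//.
have h1 n : (m <= n)%N -> cabs (npow n (- s)) <= rpw x m.
  by move=> mn; rewrite cabs_npowN rpw_le// ltW.
have h2 : \sum_(m.+1 <= n < N.+1) cabs (npow n (- s) - npow n.+1 (- s)) <=
    2 * cabs s / x * rpw x m.
  apply: le_trans (_ : \sum_(m.+1 <= n < N.+1) 2 * cabs s * rpw (1 + x) n <= _).
    rewrite !big_nat; apply: ler_sum => n /andP[mn _].
    by apply: npow_step; [exact: leq_trans mn|exact: ltW].
  rewrite -mulr_sumr -!mulrA ler_wpM2l// ler_wpM2l ?cabs_ge0//.
  by rewrite mulrC ler_pdivlMr// mulrC sum_rpw_tail// ltW.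
apply: le_trans (lerD (lerD (h1 _ _) (h1 _ _)) h2) _; rewrite ?leqnSn//.
  by rewrite leqW.
by rewrite le_eqVlt; apply/orP; left; apply/eqP; ring.
Qed.

Lemma Lfun_cvg s : 0 < complex.Re s -> cconv (Lpart^~ s) (Defs.Lfun q chi s).
Proof.
(* The factor 3 instead of the 2 of [Lpart_tail] pays for the term n = 1 when m = 0. *)
move=> s0; pose e m := 3 * q%:R * (1 + cabs s / complex.Re s) * rpw (complex.Re s) m.
have c1 : 1 <= 1 + cabs s / complex.Re s by rewrite lerDl divr_ge0 ?cabs_ge0// ltW.
have q1 : 1 <= q%:R :> R by rewrite ler1n.
have [||l ul le] := @cconv_complete _ (Lpart^~ s) e.
- move=> m n; case: m => [_|m mn].
    case: n => [|n]; first by rewrite subrr cabs0 /e !mulr_ge0 ?rpw_ge0// (le_trans ler01).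
    have -> : Lpart n.+1 s - Lpart 0 s = (Lpart n.+1 s - Lpart 1 s) + 1.
      by rewrite /Lpart (big_geq (leqnn 1)) big_nat1 dc1 npow1; ring.
    apply: le_trans (cabsD _ _) _; rewrite cabs1.
    apply: le_trans (lerD (Lpart_tail s0 _ _) (lexx _)) _ => //.
    rewrite /e rpw_one /rpw ln0// mulr0 oppr0 expR0; nra.
  apply: le_trans (Lpart_tail s0 _ mn) _ => //.
  by rewrite /e ler_wpM2r ?rpw_ge0// ler_wpM2r ?(le_trans ler01)// ler_wpM2r// ler_nat.
- by apply: cvg0_Ml; exact: rpw_cvg0.
- rewrite /Defs.Lfun; case: asboolP => // _.
  by have -> := cconv_limn ul.
Qed.

Lemma Lfun_tail m s : 0 < complex.Re s -> (0 < m)%N ->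
  cabs (Defs.Lfun q chi s - Lpart m s) <=
  2 * q%:R * (1 + cabs s / complex.Re s) * rpw (complex.Re s) m.
Proof.
move=> s0 m0; apply: (ler_add_cvg0 (n0 := m) (Lfun_cvg s0)) => N mN.
have -> : Defs.Lfun q chi s - Lpart m s =
  (Lpart N s - Lpart m s) - (Lpart N s - Defs.Lfun q chi s) by ring.
by apply: le_trans (cabsB _ _) _; rewrite lerD2r Lpart_tail.
Qed.

End Characters.

(** * Nonvanishing at 1 *)

Section Divisors.
Variable V : nmodType.

Lemma sum_multiples (l K : nat) (F : nat -> V) : (0 < l)%N ->
  \sum_(1 <= n < (l * K).+1 | (l %| n)%N) F n = \sum_(1 <= n < K.+1) F (l * n)%N.
Proof.
move=> l0; elim: K => [|K IH]; first by rewrite muln0 !big_geq.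
rewrite [RHS]big_nat_recr//= -IH mulnS addnC.
rewrite (big_cat_nat (n := (l * K).+1)) ?ltnS ?leq_addr//=; congr (_ + _).
have hl : ((l * K).+1 <= l * K + l)%N by rewrite -addn1 leq_add2l.
rewrite big_mkcond big_nat_recr//= dvdn_addr ?dvdn_mulr// dvdnn.
rewrite big_nat big1 ?add0r// => i /andP[i1 i2]; case: ifP => // /dvdnP[c ic].
move: i1 i2; rewrite ic [(c * l)%N]mulnC -mulnSr !ltn_pmul2l// ltnS => h1 h2.
by move: (leq_trans h1 h2); rewrite ltnn.
Qed.

Lemma sum_multiples_cond (l K : nat) (P : pred nat) (F : nat -> V) : (0 < l)%N ->
  \sum_(1 <= n < (l * K).+1 | P n && (l %| n)%N) F n =
  \sum_(1 <= n < K.+1 | P (l * n)%N) F (l * n)%N.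
Proof. by move=> l0; rewrite big_mkcondl sum_multiples// -big_mkcond. Qed.

Lemma big_divisors_pfactor (p e m : nat) (F : nat -> V) :
  prime p -> ~~ (p %| m)%N -> (0 < m)%N ->
  \sum_(d <- divisors (p ^ e * m)) F d =
  \sum_(i < e.+1) \sum_(d <- divisors m) F (p ^ i * d)%N.
Proof.
move=> pp pm m0; rewrite -(big_mkord xpredT (fun i => \sum_(d <- divisors m) F (p ^ i * d)%N)).
have -> : \sum_(0 <= i < e.+1) \sum_(d <- divisors m) F (p ^ i * d)%N =
  \sum_(d <- [seq (p ^ i * d)%N | i <- index_iota 0 e.+1, d <- divisors m]) F d.
  by rewrite big_allpairs_dep.
apply: perm_big.
have p0 := prime_gt0 pp.
have cop i d : (d %| m)%N -> coprime (p ^ i) d.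
  move=> dm; rewrite coprimeXl// prime_coprime//; apply: contra pm => /dvdn_trans; exact.
apply: uniq_perm; first exact: divisors_uniq.
  apply: allpairs_uniq; rewrite ?iota_uniq ?divisors_uniq// => -[i d] [j d'].
  move=> hi hj; have [[i1 d1] [/= _ h1 [-> ->]]] := elimT allpairsP hi.
  have [[i2 d2] [/= _ h2 [-> ->]]] := elimT allpairsP hj => E.
  have d1m : (d1 %| m)%N by rewrite dvdn_divisors.
  have d2m : (d2 %| m)%N by rewrite dvdn_divisors.
  have ld t : (t %| m)%N -> logn p t = 0%N.
    by move=> dm; apply: logn_coprime; rewrite -[p]expn1 cop.
  have E1 : i1 = i2.
    move/(congr1 (logn p)): E; rewrite !lognM ?expn_gt0 ?p0// ?(dvdn_gt0 m0)//.
    by rewrite (ld _ d1m) (ld _ d2m) !addn0 !pfactorK.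
  move: E; rewrite E1 => /eqP; rewrite eqn_pmul2l ?expn_gt0 ?p0// => /eqP ->.
  by [].
move=> d; rewrite -dvdn_divisors ?muln_gt0 ?expn_gt0 ?p0//.
apply/idP/allpairsP => [dpm|[[i d'] /= [ie d'm ->]]]; last first.
  rewrite mem_index_iota /= ltnS in ie; rewrite -dvdn_divisors// in d'm.
  by rewrite dvdn_mul// dvdn_exp2l.
have d0 : (0 < d)%N by rewrite (dvdn_gt0 _ dpm)// muln_gt0 expn_gt0 p0.
have [d' pd' dE] := pfactor_coprime pp d0.
exists (logn p d, d') => /=; split; last by rewrite mulnC.
- rewrite mem_index_iota leq0n ltnS -(dvdn_Pexp2l _ _ (prime_gt1 pp)).
  rewrite -(@Gauss_dvdl _ _ m) ?cop ?dvdnn//.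
  by apply: dvdn_trans dpm; rewrite {2}dE dvdn_mull.
- rewrite -dvdn_divisors// -(@Gauss_dvdr _ (p ^ e)).
    by apply: dvdn_trans dpm; rewrite {1}dE dvdn_mulr.
  by rewrite coprime_sym coprimeXl.
Qed.

Lemma sum_multiples_div (l N : nat) (F : nat -> V) : (0 < l)%N ->
  \sum_(1 <= n < N.+1 | (l %| n)%N) F n = \sum_(1 <= n < (N %/ l).+1) F (l * n)%N.
Proof.
move=> l0; rewrite -sum_multiples// (big_cat_nat (n := (l * (N %/ l)).+1))//=; last first.
  by rewrite ltnS mulnC leq_divM.
rewrite [X in _ + X]big_nat_cond [X in _ + X]big_pred0 ?addr0// => n.
apply/negP => /andP[/andP[n1 n2] /dvdnP[c nc]]; move: n1; rewrite nc mulnC.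
rewrite ltn_pmul2r// ltnNge => /negP; apply.
by rewrite leq_divRL// -nc -ltnS.
Qed.

Lemma sum_divisors (m N : nat) (F : nat -> V) : (0 < m <= N)%N ->
  \sum_(d <- divisors m) F d = \sum_(1 <= d < N.+1 | (d %| m)%N) F d.
Proof.
move=> /andP[m0 mN]; rewrite -[RHS]big_filter; apply: perm_big.
apply: uniq_perm; rewrite ?divisors_uniq ?filter_uniq ?iota_uniq// => d.
rewrite mem_filter mem_index_iota -dvdn_divisors//.
have [dm|//] := boolP (d %| m)%N.
by rewrite (dvdn_gt0 m0 dm) ltnS (leq_trans (dvdn_leq m0 dm)).
Qed.

End Divisors.

Section Mertens341.
Variable R : realType.
Implicit Types (x : R) (z : R[i]).

(** Euler factor of the 3-4-1 inequality: the m-th terms of the three logarithms combine to -(x^m /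
    m) (3 + 4 cos t + cos 2 t) with cos t = Re z^m, and the bracket is 2 (1 + cos t)^2. The series
    are cut at K terms and K tends to infinity. *)
Lemma mertens_341 x z : 0 <= x < 1 -> cabs z = 1 ->
  cabs (1 - x%:C) ^+ 3 * cabs (1 - x%:C * z) ^+ 4 * cabs (1 - x%:C * z ^+ 2) <= 1.
Proof.
move=> /andP[x0 x1] z1.
have cx (w : R[i]) : cabs w = 1 -> cabs (x%:C * w) = x.
  by move=> w1; rewrite cabsM w1 mulr1 cabs_real ger0_norm.
have pos (w : R[i]) : cabs w = 1 -> 0 < cabs (1 - x%:C * w).
  move=> w1; rewrite cabs_gt0 subr_eq0; apply/eqP => /esym h.
  by move: (cx w w1); rewrite h cabs1 => e; rewrite -e ltxx in x1.
have z21 : cabs (z ^+ 2) = 1 by rewrite cabsX z1 expr1n.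
pose A := cabs (1 - x%:C); pose B := cabs (1 - x%:C * z).
pose D := cabs (1 - x%:C * z ^+ 2).
have A0 : 0 < A by have := pos 1 (cabs1 R); rewrite mulr1.
have B0 : 0 < B by exact: pos.
have D0 : 0 < D by exact: pos.
rewrite -/A -/B -/D -ler_ln ?posrE ?mulr_gt0 ?exprn_gt0// ln1.
rewrite lnM ?posrE ?mulr_gt0 ?exprn_gt0// lnM ?posrE ?exprn_gt0// !lnXn// -(mulr_natl _ 3) -(mulr_natl _ 4).
apply: (@ler_add_cvg0 _ (fun K => 8 * (x / (1 - x)) * x ^+ K) _ _ 0).
  by apply: cvg0_Ml; apply: cvg_expr; rewrite ger0_norm.
move=> K _; rewrite add0r.
have h (w : R[i]) : cabs w = 1 -> ln (cabs (1 - x%:C * w)) <=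
    x / (1 - x) * x ^+ K - complex.Re (\sum_(i < K) (x%:C * w) ^+ i.+1 / i.+1%:R).
  move=> w1; have := @ln_cabs_1B _ (x%:C * w) K; rewrite cx// => /(_ x1).
  rewrite ler_norml => /andP[_]; rewrite -lerBrDr exprS.
  by rewrite -!mulrA [x ^+ K * _]mulrC.
have h1 := h 1 (cabs1 R); rewrite mulr1 in h1.
have h2 := h z z1; have h3 := h _ z21.
have hpos : 0 <= 3 * complex.Re (\sum_(i < K) x%:C ^+ i.+1 / i.+1%:R) +
   4 * complex.Re (\sum_(i < K) (x%:C * z) ^+ i.+1 / i.+1%:R) +
   complex.Re (\sum_(i < K) (x%:C * z ^+ 2) ^+ i.+1 / i.+1%:R).
  rewrite !Re_sum !mulr_sumr -!big_split; apply: sumr_ge0 => i _ /=.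
  have hc (w : R[i]) : complex.Re ((x%:C * w) ^+ i.+1 / i.+1%:R) =
      complex.Re (w ^+ i.+1) * (x ^+ i.+1 / i.+1%:R).
    rewrite -(rmorph_nat (real_complex R)) -fmorphV exprMn mulrAC mulrC.
    by rewrite -rmorphXn -rmorphM ReMr.
  have := hc 1; rewrite mulr1 expr1n => ->; rewrite !hc mul1r -exprM mulnC exprM.
  have : cabs (z ^+ i.+1) = 1 by rewrite cabsX z1 expr1n.
  case: (z ^+ i.+1) => a b /(congr1 (fun t => t ^+ 2)); rewrite sqr_cabs /= expr1n => ab.
  have hx : 0 <= x ^+ i.+1 / i.+1%:R by rewrite divr_ge0// exprn_ge0.
  have -> : 3 * (x ^+ i.+1 / i.+1%:R) + 4 * (a * (x ^+ i.+1 / i.+1%:R)) +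
    (a * a - b * b) * (x ^+ i.+1 / i.+1%:R) = (3 + 4 * a + (a * a - b * b)) * (x ^+ i.+1 / i.+1%:R) by ring.
  rewrite mulr_ge0//; nra.
rewrite -/A in h1; rewrite -/B in h2; rewrite -/D in h3; lra.
Qed.

End Mertens341.

Definition rough (P n : nat) := all (fun l => (P < l)%N) (primes n).

Lemma rough_step P n : (0 < n)%N ->
  rough P.+1 n = rough P n && ~~ (prime P.+1 && (P.+1 %| n)%N).
Proof.
move=> n0; apply/allP/andP => [h|[/allP h hp] l ln].
  split; first by apply/allP => l /h /ltnW.
  apply/negP => /andP[pp pn]; have := h P.+1.
  by rewrite mem_primes pp pn n0 ltnn => /(_ isT).
have := h l ln; rewrite leq_eqVlt => /predU1P[Pl|//].
by move: hp ln; rewrite Pl mem_primes n0 /= => /negP hp hl; case: hp.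
Qed.

Lemma rough_mul P n : prime P.+1 -> (0 < n)%N -> rough P (P.+1 * n) = rough P n.
Proof.
move=> pp n0; apply/allP/allP => h l.
  by move=> ln; apply: h; rewrite primesM// ln orbT.
rewrite primesM// primes_prime// mem_seq1 => /orP[/eqP->|/h]//.
Qed.

(** * Euler products by sieving a completely multiplicative series *)

Section EulerProduct.
Variable R : realType.
Variables (f : nat -> R[i]) (dl : R).
Hypothesis dl0 : 0 < dl.
Hypothesis f1 : f 1%N = 1.
Hypothesis fM : forall m n, f (m * n)%N = f m * f n.
Hypothesis fle : forall n, cabs (f n) <= rpw (1 + dl) n.

Let S P N := \sum_(1 <= n < N.+1 | rough P n) f n.
Let e m := (1 + dl^-1) * rpw dl m.

Lemma tail_le m N (P : pred nat) : (0 < m)%N ->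
  cabs (\sum_(m.+1 <= n < N | P n) f n) <= dl^-1 * rpw dl m.
Proof.
move=> m0; apply: le_trans (cabs_sum _ _ _) _.
apply: le_trans (_ : \sum_(m.+1 <= n < N) rpw (1 + dl) n <= _).
  rewrite big_mkcond; apply: ler_sum => n _; case: ifP => // _.
  exact: rpw_ge0.
by rewrite mulrC ler_pdivlMr// mulrC sum_rpw_tail// ltW.
Qed.

Lemma e_ge m : dl^-1 * rpw dl m <= e m.
Proof. by rewrite /e ler_wpM2r ?rpw_ge0// lerDr. Qed.

Lemma S_cauchy P m n : (m <= n)%N -> cabs (S P n - S P m) <= e m.
Proof.
case: m => [|m] mn.
  rewrite {2}/S big_geq// subr0 /e /rpw ln0// mulr0 oppr0 expR0 mulr1.
  apply: le_trans (cabs_sum _ _ _) _.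
  apply: le_trans (_ : \sum_(1 <= i < n.+1) rpw (1 + dl) i <= _).
    by rewrite big_mkcond; apply: ler_sum => i _; case: ifP => // _; exact: rpw_ge0.
  exact: sum_rpw.
rewrite /S (big_cat_nat (n := m.+2) (p := n.+1))//= addrAC subrr add0r.
by apply: le_trans (tail_le _ _ _) (e_ge _).
Qed.

Lemma e_cvg : e @ \oo --> (0 : R).
Proof. by apply: cvg0_Ml; exact: rpw_cvg0. Qed.

Lemma S_lim P : exists2 l, cconv (S P) l & forall m, cabs (l - S P m) <= e m.
Proof.
by apply: cconv_complete => [m n|]; [exact: S_cauchy|exact: e_cvg].
Qed.

Let Sl P := limn (S P : nat -> R[i]^o).
Lemma SlP P m : cabs (Sl P - S P m) <= e m.
Proof. by rewrite /Sl; have [l /cconv_limn ->] := S_lim P. Qed.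

(** Among the P-rough integers, the multiples of the prime l = P + 1 are l times the P-rough
    integers, so they contribute f(l) [Sl P]. Cutting at l K makes this exact for partial sums. *)
Lemma Sl_step P : Sl P.+1 = if prime P.+1 then (1 - f P.+1) * Sl P else Sl P.
Proof.
case: ifP => pp; last first.
  rewrite /Sl; have -> // : S P.+1 = S P.
  apply/funext => N; apply: congr_big_nat => // n /andP[n0 _].
  by rewrite rough_step// pp andbT.
set l := P.+1; have l0 : (0 < l)%N by [].
apply/eqP; rewrite -subr_eq0 -cabs_eq0 eq_le cabs_ge0 andbT.
apply: (@ler_add_cvg0 _ (fun K => 3 * e K) _ _ 1); first by apply: cvg0_Ml; exact: e_cvg.
move=> K K0; rewrite add0r.
have fl1 : cabs (f l) <= 1.
  by apply: le_trans (fle _) (rpw_le1 _ _); rewrite addr_ge0// ltW.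
have decomp : S P (l * K) = S l (l * K) + f l * S P K.
  rewrite /S (bigID (fun n => l %| n)%N) /= addrC; congr (_ + _).
    by apply: congr_big_nat => // n /andP[n0 _]; rewrite rough_step// pp.
  rewrite mulr_sumr sum_multiples_cond//; apply: congr_big_nat => // n /andP[n0 _].
  exact: rough_mul.
have eK : e (l * K) <= e K.
  rewrite /e ler_wpM2l ?addr_ge0 ?invr_ge0 ?(ltW dl0)// rpw_le ?(ltW dl0)//.
  by rewrite leq_pmull.
have -> : Sl l - (1 - f l) * Sl P = (Sl l - S l (l * K)) - (Sl P - S P (l * K)) +
    f l * (Sl P - S P K) by rewrite decomp; ring.
apply: le_trans (cabsD _ _) _; apply: le_trans (lerD (cabsB _ _) (lexx _)) _.
rewrite cabsM.
have h3 : cabs (f l) * cabs (Sl P - S P K) <= e K.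
  by apply: le_trans (SlP P K); rewrite ler_piMl ?cabs_ge0.
have := SlP l (l * K); have := SlP P (l * K); lra.
Qed.

(** A P-rough integer other than 1 exceeds P, because its least prime factor does. *)
Lemma Sl_tail P : (0 < P)%N -> cabs (Sl P - 1) <= e P.
Proof.
move=> P0; apply: (@ler_add_cvg0 _ e _ _ P.+1); first exact: e_cvg.
move=> N PN.
have -> : Sl P - 1 = (Sl P - S P N) + (S P N - 1) by ring.
apply: le_trans (cabsD _ _) _; rewrite addrC; apply: lerD; last exact: SlP.
have rP n : (1 < n <= P)%N -> rough P n = false.
  move=> /andP[n1 nP]; apply/negP => /allP /(_ (pdiv n)).
  rewrite mem_primes pdiv_prime// pdiv_dvd ltnW//= => /(_ isT).
  by rewrite ltnNge (leq_trans (pdiv_leq (ltnW n1)) nP).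
have -> : S P N - 1 = \sum_(P.+1 <= n < N.+1 | rough P n) f n.
  rewrite /S (big_cat_nat (n := P.+1)) ?ltnS 1?ltnW//= big_ltn_cond//=.
  rewrite f1 big_nat_cond big_pred0 ?addr0 1?addrAC ?subrr ?add0r// => n.
  by apply/negP => /andP[/andP[n1 nP]]; rewrite rP// n1.
by apply: le_trans (tail_le _ _ P0) (e_ge _).
Qed.

Lemma Sl0 l : cconv (fun N => \sum_(1 <= n < N.+1) f n) l -> Sl 0 = l.
Proof.
move=> /cconv_limn <-; rewrite /Sl; have -> // : S 0 = fun N => \sum_(1 <= n < N.+1) f n.
apply/funext => N; apply: congr_big_nat => // n _; apply/allP => k.
by rewrite mem_primes => /andP[/prime_gt0].
Qed.

(* (partial Euler product) * (Dirichlet series) = rough part of the series -> 1 *)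
Lemma euler_product l P : cconv (fun N => \sum_(1 <= n < N.+1) f n) l -> (0 < P)%N ->
  cabs (l * \prod_(1 <= k < P.+1 | prime k) (1 - f k) - 1) <= (1 + dl^-1) * rpw dl P.
Proof.
move=> /Sl0 <- P0; have -> // : Sl 0 * \prod_(1 <= k < P.+1 | prime k) (1 - f k) = Sl P.
  elim: P {P0} => [|P IH]; first by rewrite big_geq// mulr1.
  rewrite Sl_step big_mkcond big_nat_recr//= -big_mkcond /= mulrA IH.
  by case: ifP; rewrite ?mulr1// mulrC.
exact: Sl_tail.
Qed.

End EulerProduct.

(** * Complex characters: the 3-4-1 inequality *)

Section NonvanishingComplex.
Variable R : realType.
Variables (q : nat) (chi : int -> R[i]).
Hypothesis q0 : (0 < q)%N.
Hypothesis chiP : dirichlet_character q chi.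
Hypothesis chi_np : chi <> principal_character R q.
Implicit Types (dl : R) (n N : nat).

Let chi2 : int -> R[i] := fun a => chi a ^+ 2.

Lemma dc_sqr : dirichlet_character q chi2.
Proof.
split=> [a|a b|a]; rewrite /chi2.
- by rewrite (dc_per chiP).
- by rewrite (dcM chiP) exprMn.
- by rewrite expf_eq0 /= (dc_neq0 chiP).
Qed.

Lemma dc_sqr_principal : chi2 = principal_character R q -> real_character chi.
Proof.
move=> h a; have : chi2 a = principal_character R q a by rewrite h.
rewrite /chi2 /principal_character.
have [ca|/(dc_eq0 chiP) ->] := boolP (coprimez a q%:Z); last by [].
by move=> /eqP; rewrite sqrf_eq1 => /orP[] /eqP ->; rewrite ?ImN /= ?oppr0.
Qed.

Let rC dl n : npow n (- (1 + dl)%:C) = (rpw (1 + dl) n)%:C :> R[i].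
Proof. by rewrite -rmorphN npow_real /rpw mulNr. Qed.

(** If L(1, chi) = 0 this gives L(1 + dl, chi) = O(q dl). Abel summation is applied to g(n) = n^-1 -
    n^(-1-dl), whose differences are O(dl n^(-3/2)) and thus summable. *)
Lemma Lfun_real_lipschitz dl : 0 < dl ->
  cabs (Defs.Lfun q chi (1 + dl)%:C - Defs.Lfun q chi 1) <= 20 * q%:R * dl.
Proof.
move=> dl0; set s := (1 + dl)%:C.
have s0 : 0 < complex.Re s by rewrite /= addr_gt0.
pose e N := cabs (Lpart chi N s - Defs.Lfun q chi s) +
   cabs (Lpart chi N 1 - Defs.Lfun q chi 1).
apply: (@ler_add_cvg0 _ e _ _ 1).
  rewrite -[X in _ --> X](addr0 0); apply: cvgD; exact: Lfun_cvg.
move=> N N1.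
have -> : Defs.Lfun q chi s - Defs.Lfun q chi 1 =
   (Lpart chi N s - Lpart chi N 1) - ((Lpart chi N s - Defs.Lfun q chi s)
     - (Lpart chi N 1 - Defs.Lfun q chi 1)) by ring.
apply: le_trans (cabsB _ _) _; apply: lerD; last exact: cabsB.
pose g n : R := rpw 1 n - rpw (1 + dl) n.
have -> : Lpart chi N s - Lpart chi N 1 = \sum_(1 <= n < N.+1) (- chi n%:Z) * (g n)%:C.
  rewrite /Lpart -sumrB; apply: eq_bigr => n _; rewrite -mulrBr /s rC.
  have -> : npow n (- 1) = (rpw 1 n)%:C :> R[i].
    by rewrite -[1 in LHS](rmorph1 (real_complex R)) -rmorphN npow_real /rpw mulNr.
  by rewrite /g rmorphB /=; ring.
have gB n : (0 < n)%N -> `|g n| <= dl * (ln n%:R * n%:R^-1).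
  move=> n0; rewrite /g rpwD rpw_1// -{1}[n%:R^-1]mulr1 -mulrBr normrM.
  rewrite ger0_norm ?invr_ge0// ger0_norm ?subr_ge0 ?rpw_le1 ?(ltW dl0)//.
  rewrite mulrA [_ * n%:R^-1]mulrC; apply: ler_wpM2l; first by rewrite invr_ge0.
  by have := expR_ge1Dx (- (dl * ln n%:R : R)); rewrite /rpw; lra.
have gD n : (0 < n)%N -> `|g n - g n.+1| <= 3 * dl * rpw (1 + 2^-1) n.
  move=> n0; have n10 : (0 < n.+1)%N by [].
  have -> : g n - g n.+1 = (n%:R^-1 - n.+1%:R^-1) * (1 - rpw dl n) -
     n.+1%:R^-1 * (rpw dl n - rpw dl n.+1).
    by rewrite /g !rpwD !rpw_1//; ring.
  have h1 : 0 <= n%:R^-1 - n.+1%:R^-1 :> R by rewrite subr_ge0 lef_pV2 ?posrE ?ltr0n// ler_nat.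
  have nn : n%:R != 0 :> R by rewrite pnatr_eq0 -lt0n.
  have nn1 : n%:R + 1 != 0 :> R by rewrite natr1 pnatr_eq0.
  have h2 : n%:R^-1 - n.+1%:R^-1 <= n%:R^-1 * n%:R^-1 :> R.
    have -> : n%:R^-1 - n.+1%:R^-1 = n%:R^-1 * n.+1%:R^-1 :> R.
      by rewrite -natr1; field; rewrite ?nn ?nn1.
    by rewrite ler_wpM2l ?invr_ge0// lef_pV2 ?posrE ?ltr0n// ler_nat.
  have h3 : 0 <= 1 - rpw dl n by rewrite subr_ge0 rpw_le1 ?(ltW dl0).
  have h4 : 1 - rpw dl n <= dl * ln n%:R.
    by have := expR_ge1Dx (- (dl * ln n%:R : R)); rewrite /rpw; lra.
  have h5 : 0 <= rpw dl n - rpw dl n.+1 by rewrite subr_ge0 rpw_le ?(ltW dl0).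
  have h6 : rpw dl n - rpw dl n.+1 <= dl * n%:R^-1.
    have -> : rpw dl n.+1 = rpw dl n * expR (- (dl * (ln n.+1%:R - ln n%:R))).
      by rewrite /rpw -expRD; congr expR; ring.
    rewrite -{1}[rpw dl n]mulr1 -mulrBr.
    apply: le_trans (_ : 1 * (dl * (ln n.+1%:R - ln n%:R)) <= _).
      apply: ler_pM; rewrite ?rpw_ge0 ?rpw_le1 ?(ltW dl0)//.
        rewrite subr_ge0 -[leRHS]expR0 ler_expR oppr_le0 mulr_ge0 ?(ltW dl0)//.
        by rewrite subr_ge0 ler_ln ?posrE ?ltr0n// ler_nat.
      by have := expR_ge1Dx (- (dl * (ln n.+1%:R - ln n%:R : R))); lra.
    by rewrite mul1r ler_wpM2l ?(ltW dl0)// ln_succ_le.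
  have i0 : 0 <= n%:R^-1 :> R by rewrite invr_ge0.
  have l0 := ln_nat_ge0 R n.
  have h7 : n.+1%:R^-1 <= n%:R^-1 :> R by rewrite lef_pV2 ?posrE ?ltr0n// ler_nat.
  apply: le_trans (ler_normB _ _) _; rewrite !normrM (ger0_norm h1) (ger0_norm h3)
    (ger0_norm h5) ger0_norm ?invr_ge0//.
  apply: le_trans (_ : n%:R^-1 * n%:R^-1 * (dl * ln n%:R) + n%:R^-1 * (dl * n%:R^-1) <= _).
    by apply: lerD; apply: ler_pM; rewrite // invr_ge0.
  have -> : rpw (1 + 2^-1 : R) n = n%:R^-1 * n%:R^-1 * expR (2^-1 * ln n%:R).
    rewrite -(rpw_1 R n0) /rpw -!expRD; congr expR.
    by field.
  have h8 := ln_le_rpw n (_ : 0 < (2^-1 : R)); rewrite invr_gt0 ltr0n in h8.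
  have {}h8 := h8 isT; rewrite invrK in h8.
  have h9 : 1 <= expR (2^-1 * ln n%:R) :> R by rewrite -[leLHS]expR0 ler_expR mulr_ge0.
  set E := expR _ in h8 h9 *; set w := n%:R^-1 in i0 *; set l := ln _ in l0 h8 *.
  have -> : w * w * (dl * l) + w * (dl * w) = (w * w * dl) * (l + 1) by ring.
  have -> : 3 * dl * (w * w * E) = (w * w * dl) * (3 * E) by ring.
  by apply: ler_wpM2l; [rewrite !mulr_ge0// ltW|lra].
have bnd n : cabs (\sum_(0 <= i < n) - chi i%:Z) <= q%:R.
  by rewrite sumrN cabsN; exact: dc_sum_bound.
apply: le_trans (abel_bound (fun n => (g n)%:C) _ _ bnd) _ => //.
rewrite !cabs_real -mulrA mulrCA ler_wpM2l//.
have g1 : g 1%N = 0 by rewrite /g !rpw_one subrr.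
rewrite g1 normr0 add0r.
have hN : `|g N.+1| <= 2 * dl.
  apply: le_trans (gB _ _) _ => //; rewrite mulrC ler_wpM2r ?(ltW dl0)//.
  rewrite ler_pdivrMr ?ltr0n//.
  have := ln_sublinear (_ : 0 < N.+1%:R :> R); rewrite ltr0n => /(_ isT) h.
  by apply: le_trans (ltW h) _; rewrite ler_peMl// ler1n.
have hs : \sum_(1 <= n < N.+1) cabs ((g n)%:C - (g n.+1)%:C) <= 3 * dl * 3.
  apply: le_trans (_ : \sum_(1 <= n < N.+1) 3 * dl * rpw (1 + 2^-1) n <= _).
    rewrite !big_nat; apply: ler_sum => n /andP[n0 _].
    by rewrite -rmorphB cabs_real gD.
  rewrite -mulr_sumr; apply: ler_wpM2l; first by rewrite mulr_ge0// ltW.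
  have := @sum_rpw R 2^-1 N.+1; rewrite invrK invr_gt0 ltr0n => /(_ isT) h.
  by apply: le_trans h _; lra.
by lra.
Qed.

Lemma Lfun_real_bound (psi : int -> R[i]) dl : dirichlet_character q psi ->
  psi <> principal_character R q -> 0 < dl ->
  cabs (Defs.Lfun q psi (1 + dl)%:C) <= 1 + 4 * q%:R.
Proof.
move=> psiP psi_np dl0.
have s0 : 0 < complex.Re (1 + dl)%:C by rewrite /= addr_gt0.
have := @Lfun_tail _ _ _ q0 psiP psi_np 1 _ s0 isT.
rewrite rpw_one mulr1 cabs_real ger0_norm /= ?divff ?gt_eqF ?addr_gt0 ?(ltW s0)//.
have -> : Lpart psi 1 (1 + dl)%:C = 1 by rewrite /Lpart big_nat1 (dc1 psiP) npow1 mulr1.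
set L := Defs.Lfun _ _ _ => h.
have := cabsD (L - 1) 1; rewrite subrK cabs1; lra.
Qed.

(** The local inequality multiplied over the primes up to P. In place of zeta only the series of
    |chi(n)| n^(-1-dl) occurs, with its upper bound 1 + 1 / dl. As chi is not real, chi^2 is
    nonprincipal. *)
Lemma L1_341 dl : 0 < dl -> ~ real_character chi ->
  1 <= (1 + dl^-1) ^+ 3 * cabs (Defs.Lfun q chi (1 + dl)%:C) ^+ 4 *
    cabs (Defs.Lfun q chi2 (1 + dl)%:C).
Proof.
move=> dl0 chinr.
have chi2_np : chi2 <> principal_character R q by move/dc_sqr_principal.
have s0 : 0 < complex.Re (1 + dl)%:C by rewrite /= addr_gt0.
pose r n : R := rpw (1 + dl) n.
(* The value 0 at n = 0 gives complete multiplicativity there, where [rpw] is 1. *)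
pose f0 n : R[i] := (cabs (chi n%:Z))%:C * (if n is 0 then 0 else (r n)%:C).
pose f1 n : R[i] := chi n%:Z * (if n is 0 then 0 else (r n)%:C).
pose f2 n : R[i] := chi2 n%:Z * (if n is 0 then 0 else (r n)%:C).
have rM m n : (if (m * n)%N is 0 then 0 else (r (m * n))%:C) =
  (if m is 0 then 0 else (r m)%:C) * (if n is 0 then 0 else (r n)%:C) :> R[i].
  case: m n => [|m] [|n]; rewrite ?mul0n ?muln0 ?mul0r ?mulr0//.
  by rewrite -[LHS]/((r (m.+1 * n.+1)%N)%:C) /r rpwM// rmorphM.
have rle n : cabs (if n is 0 then 0 else (r n)%:C : R[i]) <= r n.
  by case: n => [|n]; rewrite ?cabs0 ?rpw_ge0// cabs_real ger0_norm ?rpw_ge0.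
have fle (c : R[i]) n : cabs c <= 1 -> cabs (c * (if n is 0 then 0 else (r n)%:C)) <= r n.
  by move=> c1; rewrite cabsM -[leRHS]mul1r; apply: ler_pM; rewrite ?cabs_ge0.
have c1 n := @dc_cabs_le1 _ _ _ q0 chiP n%:Z.
have f01 : f0 1%N = 1 by rewrite /f0 (dc1 chiP) cabs1 /r rpw_one mul1r.
have f11 : f1 1%N = 1 by rewrite /f1 (dc1 chiP) /r rpw_one mul1r.
have f21 : f2 1%N = 1 by rewrite /f2 /chi2 (dc1 chiP) expr1n /r rpw_one mul1r.
have f0M m n : f0 (m * n)%N = f0 m * f0 n.
  by rewrite /f0 rM PoszM (dcM chiP) cabsM rmorphM mulrACA.
have f1M m n : f1 (m * n)%N = f1 m * f1 n.
  by rewrite /f1 rM PoszM (dcM chiP) mulrACA.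
have f2M m n : f2 (m * n)%N = f2 m * f2 n.
  by rewrite /f2 rM PoszM (dcM dc_sqr) mulrACA.
have f0le n : cabs (f0 n) <= r n.
  by apply: fle; rewrite cabs_real ger0_norm ?cabs_ge0.
have f1le n : cabs (f1 n) <= r n by exact: fle.
have f2le n : cabs (f2 n) <= r n.
  by apply: fle; rewrite /chi2 cabsX exprn_ile1 ?cabs_ge0.
have part (psi : int -> R[i]) N :
    \sum_(1 <= n < N.+1) psi n%:Z * (if n is 0 then 0 else (r n)%:C) =
    Lpart psi N (1 + dl)%:C.
  rewrite /Lpart !big_nat; apply: eq_bigr => n /andP[n0 _].
  by rewrite rC; case: n n0.
have cv1 : cconv (fun N => \sum_(1 <= n < N.+1) f1 n) (Defs.Lfun q chi (1 + dl)%:C).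
  rewrite (_ : (fun N => _) = Lpart chi ^~ (1 + dl)%:C); first exact: Lfun_cvg.
  by apply/funext => N; rewrite -part.
have cv2 : cconv (fun N => \sum_(1 <= n < N.+1) f2 n) (Defs.Lfun q chi2 (1 + dl)%:C).
  rewrite (_ : (fun N => _) = Lpart chi2 ^~ (1 + dl)%:C).
    exact: (Lfun_cvg q0 dc_sqr).
  by apply/funext => N; rewrite -part.
have [l0 cv0 l0le] : exists2 l, cconv (fun N => \sum_(1 <= n < N.+1) f0 n) l &
    cabs l <= 1 + dl^-1.
  have bound m N : (m <= N)%N -> cabs (\sum_(1 <= n < N.+1) f0 n -
      \sum_(1 <= n < m.+1) f0 n) <= (1 + dl^-1) * rpw dl m.
    move=> mN; rewrite (big_cat_nat (n := m.+1) (p := N.+1))//= addrAC subrr add0r.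
    apply: le_trans (cabs_sum _ _ _) _.
    apply: le_trans (_ : \sum_(m.+1 <= n < N.+1) r n <= _); first exact: ler_sum.
    case: m mN => [|m] mN.
      by rewrite /rpw ln0// mulr0 oppr0 expR0 mulr1; exact: sum_rpw.
    apply: le_trans (_ : dl^-1 * rpw dl m.+1 <= _).
      by rewrite mulrC ler_pdivlMr// mulrC sum_rpw_tail// ltW.
    by rewrite ler_wpM2r ?rpw_ge0// lerDr.
  have [|l cl lb] := @cconv_complete _ (fun N => \sum_(1 <= n < N.+1) f0 n) _ bound.
    by apply: cvg0_Ml; exact: rpw_cvg0.
  exists l => //; have := lb 0%N; rewrite big_geq// subr0.
  by rewrite /rpw ln0// mulr0 oppr0 expR0 mulr1.
pose e P := (1 + dl^-1) * rpw dl P.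
have e0 P : 0 <= e P by rewrite mulr_ge0 ?rpw_ge0// addr_ge0// invr_ge0 ltW.
set L1 := Defs.Lfun q chi _ in cv1 *; set L2 := Defs.Lfun q chi2 _ in cv2 *.
have ecvg : e @ \oo --> (0 : R) by apply: cvg0_Ml; exact: rpw_cvg0.
have [P0 hP0] : exists P0, forall P, (P0 <= P)%N -> e P <= 1.
  have /cvgrPdist_le/(_ _ ltr01)[P0 _ h] := ecvg.
  by exists P0 => P /h; rewrite sub0r normrN ger0_norm.
apply: (@ler_add_cvg0 _ (fun P => 8 * e P) _ _ P0.+1); first exact: cvg0_Ml.
move=> P PP.
have P1 : (0 < P)%N by exact: leq_trans PP.
pose E (f : nat -> R[i]) := \prod_(1 <= k < P.+1 | prime k) (1 - f k).
have h0 : 1 - e P <= cabs (l0 * E f0).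
  have := euler_product dl0 f01 f0M f0le cv0 P1; rewrite -/(e P) => h.
  by have := cabsB (l0 * E f0) (l0 * E f0 - 1); rewrite subKr cabs1; rewrite /E in h *; lra.
have h1 : 1 - e P <= cabs (L1 * E f1).
  have := euler_product dl0 f11 f1M f1le cv1 P1; rewrite -/(e P) => h.
  by have := cabsB (L1 * E f1) (L1 * E f1 - 1); rewrite subKr cabs1; rewrite /E in h *; lra.
have h2 : 1 - e P <= cabs (L2 * E f2).
  have := euler_product dl0 f21 f2M f2le cv2 P1; rewrite -/(e P) => h.
  by have := cabsB (L2 * E f2) (L2 * E f2 - 1); rewrite subKr cabs1; rewrite /E in h *; lra.
have hE : cabs (E f0) ^+ 3 * cabs (E f1) ^+ 4 * cabs (E f2) <= 1.
  rewrite /E !cabs_prod -!prodrXl -!big_split /=.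
  set X := (X in X <= 1); suff /andP[_ //] : 0 <= X <= 1; rewrite /X {X}.
  rewrite big_nat_cond; elim/big_ind: _ => [|x y /andP[x0 x1] /andP[y0 y1]|].
  - by rewrite ler01 lexx.
  - by rewrite mulr_ge0// mulr_ile1.
  move=> k /andP[/andP[k1 _] pk].
  rewrite !mulr_ge0 ?exprn_ge0 ?cabs_ge0//= /f0 /f1 /f2 /chi2.
  case: k k1 pk => // k _ pk.
  have [ck|/(dc_eq0 chiP) ->] := boolP (coprimez k.+1%:Z q%:Z); last first.
    have h1' (w : R[i]) : w = 0 -> cabs (1 - w) = 1 by move=> ->; rewrite subr0 cabs1.
    by rewrite cabs0 !h1' ?expr1n ?mulr1// ?expr0n ?mul0r.
  rewrite (dc_cabs1 q0 chiP ck) mul1r ![chi _ * _]mulrC [chi _ ^+ 2 * _]mulrC.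
  apply: mertens_341; last exact: dc_cabs1 ck.
  rewrite rpw_ge0 /= /r /rpw -[ltRHS]expR0 ltr_expR oppr_lt0 mulr_gt0 ?addr_gt0//.
  by rewrite ln_gt0// ltr1n prime_gt1.
have le1 : 0 <= 1 - e P by rewrite subr_ge0 hP0// ltnW.
have : (1 - e P) ^+ 8 <= (1 + dl^-1) ^+ 3 * cabs L1 ^+ 4 * cabs L2.
  apply: le_trans (_ : cabs (l0 * E f0) ^+ 3 * cabs (L1 * E f1) ^+ 4 * cabs (L2 * E f2) <= _).
    rewrite (_ : _ ^+ 8 = (1 - e P) ^+ 3 * (1 - e P) ^+ 4 * (1 - e P)); last by ring.
    by apply: ler_pM; rewrite ?mulr_ge0 ?exprn_ge0//; apply: ler_pM;
       rewrite ?exprn_ge0// lerXn2r ?nnegrE ?cabs_ge0.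
  rewrite !cabsM !exprMn.
  set x0 := cabs l0 ^+ 3; set x1 := cabs L1 ^+ 4; set x2 := cabs L2.
  set y0 := cabs (E f0) ^+ 3; set y1 := cabs _ ^+ 4; set y2 := cabs _.
  rewrite (_ : _ * _ = (x0 * x1 * x2) * (y0 * y1 * y2)); last by ring.
  apply: le_trans (_ : x0 * x1 * x2 * 1 <= _).
    by apply: ler_wpM2l => //; rewrite !mulr_ge0 ?exprn_ge0 ?cabs_ge0.
  rewrite mulr1 ler_wpM2r ?cabs_ge0// ler_wpM2r ?exprn_ge0 ?cabs_ge0//.
  by rewrite lerXn2r ?nnegrE ?cabs_ge0// addr_ge0// invr_ge0 ltW.
(* Bernoulli's inequality, for 8 = 3 + 4 + 1 factors each at least 1 - [e P]. *)
have : 1 - 8 * e P <= (1 - e P) ^+ 8.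
  have b n : 1 - n%:R * e P <= (1 - e P) ^+ n.
    elim: n => [|n IH]; first by rewrite mul0r subr0.
    rewrite exprS; apply: le_trans (ler_wpM2l le1 IH).
    have : 0 <= n%:R * (e P * e P) by rewrite mulr_ge0// mulr_ge0.
    by rewrite -natr1; lra.
  exact: b 8%N.
lra.
Qed.

(** A zero at 1 would make the right side of [L1_341] O(dl^-3 dl^4), which falls below 1 for small
    [dl]. *)
Lemma L1_neq0_complex : ~ real_character chi -> Defs.Lfun q chi 1 != 0.
Proof.
move=> chinr; apply/eqP => L0.
have q1 : 1 <= q%:R :> R by rewrite ler1n.
(* For dl <= 1 the right side is at most [A * dl], which is 1/2 for dl = 1 / (2 A). *)
pose A : R := 8 * (20 * q%:R) ^+ 4 * (1 + 4 * q%:R).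
have A1 : 1 <= A.
  have h1 : 1 <= (20 * q%:R) ^+ 4 :> R by rewrite exprn_ege1//; lra.
  have h2 : 1 <= 1 + 4 * q%:R :> R by lra.
  rewrite /A; have : 1 * 1 <= (20 * q%:R) ^+ 4 * (1 + 4 * q%:R) :> R by apply: ler_pM.
  by rewrite mulr1 -mulrA; lra.
pose dl := (2 * A)^-1.
have dl0 : 0 < dl by rewrite invr_gt0; lra.
have dl1 : dl <= 1 by rewrite invf_le1; lra.
have dlA : A * dl < 1.
  have -> : A * dl = 2^-1 by rewrite /dl; field; rewrite gt_eqF//; lra.
  by lra.
clearbody dl; have := L1_341 dl0 chinr; apply/negP; rewrite -ltNge.
have chi2_np : chi2 <> principal_character R q by move/dc_sqr_principal.
have h1 := Lfun_real_lipschitz dl0; rewrite L0 subr0 in h1.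
have h2 := Lfun_real_bound dc_sqr chi2_np dl0.
apply: le_lt_trans (_ : (2 / dl) ^+ 3 * (20 * q%:R * dl) ^+ 4 * (1 + 4 * q%:R) < 1).
  apply: ler_pM; rewrite ?mulr_ge0 ?exprn_ge0 ?cabs_ge0 ?addr_ge0 ?invr_ge0 ?(ltW dl0)//.
  apply: ler_pM; rewrite ?exprn_ge0 ?cabs_ge0 ?addr_ge0 ?invr_ge0 ?(ltW dl0)//.
    rewrite lerXn2r ?nnegrE ?addr_ge0 ?divr_ge0 ?invr_ge0 ?(ltW dl0)//.
    by rewrite mulrDl mul1r lerD2r invf_ge1.
  by rewrite lerXn2r ?nnegrE ?cabs_ge0// !mulr_ge0// ltW.
have -> : (2 / dl) ^+ 3 * (20 * q%:R * dl) ^+ 4 * (1 + 4 * q%:R) = A * dl.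
  by rewrite /A; field; rewrite gt_eqF.
exact: dlA.
Qed.

End NonvanishingComplex.

(** * Real characters: Monsky's decreasing sequence *)

Section MonskyAux.
Variable R : realType.
Implicit Types (x y : R) (n m N : nat).

Definition geo x n : R := \sum_(i < n) x ^+ i.

Lemma geoE x n : 1 - x ^+ n = (1 - x) * geo x n.
Proof. by rewrite -opprB subrX1 -mulNr opprB. Qed.

(** Pair the exponents i and n - 1 - i: y^(2i) + y^(2(n-1-i)) >= 2 y^(n-1). *)
Lemma geo_ge y n : 0 <= y -> n%:R * y ^+ n.-1 <= geo (y ^+ 2) n.
Proof.
move=> y0; have h : geo (y ^+ 2) n = \sum_(i < n) (y ^+ 2) ^+ (n.-1 - i).
  rewrite /geo (reindex_inj rev_ord_inj) /=; apply: eq_bigr => i _.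
  by rewrite subnS predn_sub.
have : geo (y ^+ 2) n + geo (y ^+ 2) n >= \sum_(i < n) 2 * y ^+ n.-1.
  rewrite {2}h /geo -big_split; apply: ler_sum => i _ /=.
  rewrite -!exprM ![(2 * _)%N]mulnC !exprM.
  have -> : y ^+ n.-1 = y ^+ i * y ^+ (n.-1 - i).
    by rewrite -exprD subnKC// -ltnS prednK// (leq_ltn_trans (leq0n i)).
  by have := sqr_ge0 (y ^+ i - y ^+ (n.-1 - i)); rewrite sqrrB; lra.
by rewrite sumr_const card_ord -mulr_natl; lra.
Qed.

Lemma geo_ge_last x n : 0 <= x <= 1 -> n%:R * x ^+ n <= geo x n.
Proof.
move=> /andP[x0 x1]; rewrite mulr_natl -[X in _ *+ X]card_ord -sumr_const.
by apply: ler_sum => i _; rewrite ler_wiXn2l// ltnW.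
Qed.

Lemma geo_prod_ge x n : 0 <= x <= 1 -> (0 < n)%N ->
  (n * n.+1)%:R * x ^+ n <= geo x n * geo x n.+1.
Proof.
move=> /andP[x0 x1] n0; pose y := Num.sqrt x.
have y0 : 0 <= y by rewrite sqrtr_ge0.
have xy : x = y ^+ 2 by rewrite sqr_sqrtr.
have y1 : y <= 1 by rewrite -sqrtr1 ler_wsqrtr.
apply: le_trans (_ : n%:R * y ^+ n.-1 * (n.+1%:R * y ^+ n) <= _).
  rewrite natrM -[leRHS]mulrA -mulrA ler_wpM2l// [leRHS]mulrCA ler_wpM2l//.
  rewrite xy -exprM -exprD ler_wiXn2l//; case: n n0 => //= n _; lia.
by rewrite xy; apply: ler_pM; rewrite ?mulr_ge0 ?exprn_ge0// ?geo_ge// (geo_ge n.+1).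
Qed.

(** The coefficient 1 / n of L(1, chi), scaled by 1 / (1 - x), minus the Lambert coefficient. Being
    nonnegative and decreasing in n, it can be summed against chi by Abel summation with a bound
    independent of x. *)
Definition monsky x n : R := (n%:R * (1 - x))^-1 - x ^+ n / (1 - x ^+ n).

(** After clearing denominators this is exactly [geo_prod_ge]. *)
Lemma monsky_decr x n : 0 < x < 1 -> (0 < n)%N -> monsky x n.+1 <= monsky x n.
Proof.
move=> /andP[x0 x1] n0.
have u0 : 0 < 1 - x by rewrite subr_gt0.
have g0 m : (0 < m)%N -> 0 < geo x m.
  case: m => // m _; rewrite /geo big_ord_recl expr0 ltr_pwDl// sumr_ge0// => i _.
  by rewrite exprn_ge0// ltW.
have gS : geo x n.+1 = 1 + x * geo x n.
  by rewrite /geo big_ord_recl expr0 mulr_sumr; congr (_ + _); apply: eq_bigr => i _; rewrite exprS.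
have a0 := g0 n n0; have b0 := g0 n.+1 isT.
have hp : (n * n.+1)%:R * x ^+ n <= geo x n * geo x n.+1.
  by apply: geo_prod_ge => //; rewrite !ltW.
rewrite /monsky !geoE; set a := geo x n in a0 gS hp *; set b := geo x n.+1 in b0 gS hp *.
have nR : 0 < n%:R :> R by rewrite ltr0n.
rewrite -subr_ge0 exprS -natr1.
have -> : (n%:R * (1 - x))^-1 - x ^+ n / ((1 - x) * a) -
  (((n%:R + 1) * (1 - x))^-1 - x * x ^+ n / ((1 - x) * b)) =
  (a * b - (n%:R * (n%:R + 1)) * (x ^+ n * (b - x * a))) /
    (n%:R * (n%:R + 1) * (1 - x) * a * b).
  by field; rewrite !gt_eqF.
rewrite divr_ge0//; last by rewrite !mulr_ge0// ltW.
by rewrite gS addrK mulr1 subr_ge0 natr1 -natrM -gS.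
Qed.

Lemma monsky_ge0 x n : 0 < x < 1 -> (0 < n)%N -> 0 <= monsky x n.
Proof.
move=> /andP[x0 x1] n0; have u0 : 0 < 1 - x by rewrite subr_gt0.
have v0 : 0 < 1 - x ^+ n by rewrite subr_gt0 exprn_ilt1// ?ltW// -lt0n.
have nR : 0 < n%:R :> R by rewrite ltr0n.
rewrite /monsky subr_ge0 ler_pdivrMr// mulrC ler_pdivlMr ?mulr_gt0//.
rewrite geoE [leLHS](_ : _ = (1 - x) * (n%:R * x ^+ n)); last by ring.
by rewrite ler_wpM2l ?(ltW u0)// geo_ge_last// !ltW.
Qed.

Lemma exprn_cvg0_nat x : 0 <= x < 1 -> n%:R * x ^+ n @[n --> \oo] --> (0 : R).
Proof.
move=> /andP[x0 x1]; pose y := Num.sqrt x.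
have y0 : 0 <= y by rewrite sqrtr_ge0.
have xy : x = y ^+ 2 by rewrite sqr_sqrtr.
have y1 : y < 1 by rewrite -(@ltr_pXn2r _ 2)// ?nnegrE// expr1n -xy.
apply: (@squeeze_cvgr _ _ _ _ (fun=> 0) (fun n => (1 - y)^-1 * y ^+ n)).
- apply: nearW => n; rewrite mulr_ge0 ?exprn_ge0//= xy -exprM mulnC exprM expr2 mulrA.
  rewrite ler_wpM2r ?exprn_ge0// -[leRHS]mul1r ler_pdivlMr ?subr_gt0//.
  apply: le_trans (_ : (1 - y) * geo y n <= _); last first.
    by rewrite -geoE gerBl exprn_ge0.
  by rewrite mulrC ler_wpM2l ?subr_ge0 ?(ltW y1)// geo_ge_last// y0 ltW.
- exact: cvg_cst.
- by apply: cvg0_Ml; apply: cvg_expr; rewrite ger0_norm.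
Qed.

End MonskyAux.

Section DivisorSum.
Variable R : realType.
Variable c : nat -> R.
Hypothesis c1 : c 1%N = 1.
Hypothesis cM : forall m n, c (m * n)%N = c m * c n.
Hypothesis cv : forall n, [|| c n == 0, c n == 1 | c n == -1].

(** By multiplicativity everything reduces to a prime power p^e, where the sum of c(p)^i over i <= e
    is 1 if c(p) = 0, e + 1 if c(p) = 1, and 1 or 0 according to the parity of e if c(p) = -1. *)
Lemma divsum_ge0 m : (0 < m)%N -> 0 <= \sum_(d <- divisors m) c d /\
  ((forall p, prime p -> ~~ odd (logn p m)) -> 1 <= \sum_(d <- divisors m) c d).
Proof.
have [n] := ubnP m; elim: n m => // n IH m mn m0.
have [m1|m1] := leqP m 1.
  have -> : m = 1%N by apply/eqP; rewrite eqn_leq m1.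
  by rewrite big_seq1 c1 ler01 lexx.
set p := pdiv m; have pp : prime p by exact: pdiv_prime.
have [m' pm' mE] := pfactor_coprime pp m0.
set e := logn p m in mE; have m'0 : (0 < m')%N by move: m0; rewrite mE muln_gt0 => /andP[].
have e0 : (0 < e)%N by rewrite logn_gt0 mem_primes pp m0 pdiv_dvd.
have eE : e = logn p m by [].
clearbody e; clearbody p.
have m'n : (m' < n)%N.
  apply: (@leq_trans m); last by rewrite -ltnS.
  rewrite mE ltn_Pmulr//.
  by rewrite -(exp1n e) ltn_exp2r// prime_gt1.
have [IH1 IH2] := IH m' m'n m'0.
have pm : ~~ (p %| m')%N by rewrite -prime_coprime.
have E : \sum_(d <- divisors m) c d = (\sum_(i < e.+1) c p ^+ i) * \sum_(d <- divisors m') c d.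
  rewrite mE mulnC big_divisors_pfactor// mulr_suml; apply: eq_bigr => i _.
  rewrite mulr_sumr; apply: eq_bigr => d _; rewrite cM; congr (_ * _).
  by elim: (i : nat) => [|j IHj]; rewrite ?c1// expnS cM IHj exprS.
have S0 : 0 <= \sum_(i < e.+1) c p ^+ i /\ (~~ odd e -> 1 <= \sum_(i < e.+1) c p ^+ i).
  have /or3P[] := cv p => /eqP ->.
  - by rewrite big_ord_recl expr0 big1 ?addr0 ?ler01 ?lexx// => i _; rewrite expr0n.
  - under eq_bigr do rewrite expr1n.
    by rewrite sumr_const card_ord ler0n ler1n.
  - have -> : \sum_(i < e.+1) (-1 : R) ^+ i = (~~ odd e)%:R.
      elim: (e) => [|k IHk]; first by rewrite big_ord1.
      by rewrite big_ord_recr /= IHk -signr_odd /=; case: (odd k); rewrite ?expr1 ?subrr ?add0r ?expr0.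
    by case: (odd e); rewrite ?ler01 ?lexx.
rewrite E; split; first by rewrite mulr_ge0//; case: S0.
move=> hs; rewrite -[leLHS]mulr1; apply: ler_pM => //.
  by case: S0 => _; apply; rewrite eE; apply: hs.
apply: IH2 => l lp; have := hs l lp.
have pe0 : (0 < p ^ e)%N by rewrite expn_gt0 prime_gt0.
rewrite mE (lognM _ m'0 pe0) lognX (logn_prime l pp).
have [->|_] := eqVneq l p; last by rewrite muln0 addn0.
by rewrite logn_coprime.
Qed.

End DivisorSum.

Section NonvanishingReal.
Variable R : realType.
Variables (q : nat) (chi : int -> R[i]).
Hypothesis q0 : (0 < q)%N.
Hypothesis chiP : dirichlet_character q chi.
Hypothesis chi_np : chi <> principal_character R q.
Hypothesis chi_real : real_character chi.

Let c n : R := complex.Re (chi n%:Z).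

Lemma real_chiE n : chi n%:Z = (c n)%:C.
Proof. by rewrite /c; move: (chi_real n%:Z); case: (chi _) => a b /= ->. Qed.

Lemma real_c1 : c 1%N = 1. Proof. by rewrite /c (dc1 chiP). Qed.
Lemma real_cM m n : c (m * n)%N = c m * c n.
Proof. by rewrite /c PoszM (dcM chiP) ReM (chi_real m%:Z) mul0r subr0. Qed.
Lemma real_cv n : [|| c n == 0, c n == 1 | c n == -1].
Proof.
have [h|h] := boolP (coprimez n%:Z q%:Z); last by rewrite /c (dc_eq0 chiP h) /= eqxx.
have := dc_cabs1 q0 chiP h; rewrite real_chiE cabs_real => /eqP.
by rewrite eqr_norml ler01 andbT => /orP[] ->; rewrite ?orbT.
Qed.

(* Monsky's argument: if [L(1, chi) = 0] the Lambert series
   [\sum chi(n) x^n / (1 - x^n) = \sum r(n) x^n], with [r(n) = \sum_(d | n) chi(d)],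
   stays bounded as [x -> 1], although [r >= 0] and [r >= 1] on squares. *)
Lemma L1_neq0_real : Defs.Lfun q chi 1 != 0.
Proof.
apply/eqP => L0.
pose r m := \sum_(d <- divisors m) c d.
have r0 m : (0 < m)%N -> 0 <= r m by move=> m0; have [] := divsum_ge0 real_c1 real_cM real_cv m0.
have r1 l : (0 < l)%N -> 1 <= r (l ^ 2)%N.
  move=> l0; have l20 : (0 < l ^ 2)%N by rewrite expn_gt0 l0.
  have [_] := divsum_ge0 real_c1 real_cM real_cv l20; apply.
  by move=> p _; rewrite lognX oddM.
have o0 : 0 < complex.Re (1 : R[i]) by rewrite /= ltr01.
have np1 n : npow n (- 1) = (rpw 1 n)%:C :> R[i].
  by rewrite -[1 in LHS](rmorph1 (real_complex R)) -rmorphN npow_real /rpw mulNr.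
pose A N : R := \sum_(1 <= n < N.+1) c n / n%:R.
have AE N : Lpart chi N 1 = (A N)%:C.
  rewrite /Lpart /A rmorph_sum !big_nat; apply: eq_bigr => n /andP[n0 _].
  by rewrite real_chiE np1 rpw_1// -rmorphM.
have Acvg : (fun N => `|A N|) @ \oo --> (0 : R).
  have := Lfun_cvg q0 chiP chi_np o0; rewrite L0 /cconv.
  rewrite (_ : (fun n => _) = (fun N => `|A N|))//.
  by apply/funext => N; rewrite subr0 AE cabs_real.
(* A bound uniform in x. The terms at squares are dominated by the Lambert series, which is A(N) /
   (1 - x) minus a [monsky] sum, up to a truncation error. The first part vanishes in the limit
   since L(1) = 0, and Abel summation bounds the second by 2 q. *)
have key (x : R) L : 0 < x < 1 -> \sum_(1 <= l < L.+1) x ^+ (l ^ 2) <= 2 * q%:R.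
  move=> x01; have /andP[x0 x1] := x01; have u0 : 0 < 1 - x by rewrite subr_gt0.
  pose e N := (1 - x)^-1 * `|A N| + (1 - x)^-1 * (N%:R * x ^+ N).
  apply: (@ler_add_cvg0 _ e _ _ (L ^ 2)%N).
    rewrite -[X in _ --> X](addr0 0); apply: cvgD; apply: cvg0_Ml => //.
    by apply: exprn_cvg0_nat; rewrite x1 ltW.
  move=> N LN.
  have h1 : \sum_(1 <= l < L.+1) x ^+ (l ^ 2) <= \sum_(1 <= m < N.+1) r m * x ^+ m.
    pose F m := \sum_(1 <= l < L.+1) if m == (l ^ 2)%N then x ^+ m else 0.
    apply: le_trans (_ : \sum_(1 <= m < N.+1) F m <= _).
      rewrite /F exchange_big_nat /= !big_nat; apply: ler_sum => l /andP[l0 lL].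
      rewrite (bigD1_seq (l ^ 2)%N) ?iota_uniq//=; last first.
        rewrite mem_index_iota expn_gt0 l0 /= ltnS (leq_trans _ LN)//.
        by rewrite leq_exp2r.
      rewrite eqxx lerDl sumr_ge0// => m _; case: ifP => // _.
      by rewrite exprn_ge0// ltW.
    rewrite !big_nat; apply: ler_sum => m /andP[m0 _]; rewrite /F.
    have xm0 : 0 <= x ^+ m by rewrite exprn_ge0// ltW.
    have [[l l0 ml]|hm] := pselect (exists2 l, (0 < l)%N & m = (l ^ 2)%N).
      apply: le_trans (_ : x ^+ m <= _); last by rewrite ler_peMl// ml r1.
      rewrite -big_mkcond /= (eq_bigl (fun j => j == l)) => [|j].
        by rewrite big_nat1_eq; case: ifP.
      by rewrite ml eqn_exp2r// eq_sym.
    rewrite big_nat big1 ?mulr_ge0 ?r0// => l /andP[l0 _].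
    by case: eqP => // ml; case: hm; exists l.
  apply: le_trans h1 _.
  have h2 : \sum_(1 <= m < N.+1) r m * x ^+ m =
     \sum_(1 <= d < N.+1) c d * \sum_(1 <= j < (N %/ d).+1) x ^+ (d * j).
    transitivity (\sum_(1 <= m < N.+1) \sum_(1 <= d < N.+1 | (d %| m)%N) c d * x ^+ m).
      rewrite !big_nat; apply: eq_bigr => m /andP[m0 mN].
      by rewrite -mulr_suml /r (@sum_divisors _ m N)// m0.
    under eq_bigr do rewrite big_mkcond.
    rewrite exchange_big_nat /= !big_nat; apply: eq_bigr => d /andP[d0 _].
    by rewrite -big_mkcond /= -mulr_sumr sum_multiples_div.
  have h3 : \sum_(1 <= d < N.+1) c d * (x ^+ d / (1 - x ^+ d)) =
     (1 - x)^-1 * A N - \sum_(1 <= d < N.+1) c d * monsky x d.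
    rewrite /A mulr_sumr -sumrB !big_nat; apply: eq_bigr => d /andP[d0 _].
    rewrite /monsky invfM; ring.
  have h4 : `|\sum_(1 <= d < N.+1) c d * monsky x d| <= 2 * q%:R.
    have -> : `|\sum_(1 <= d < N.+1) c d * monsky x d| =
        cabs (\sum_(1 <= d < N.+1) chi d%:Z * (monsky x d)%:C).
      rewrite -cabs_real rmorph_sum; congr cabs; apply: eq_bigr => d _.
      by rewrite real_chiE -rmorphM.
    apply: le_trans (abel_bound (fun d => (monsky x d)%:C) _ _ (dc_sum_bound q0 chiP chi_np)) _ => //.
    have m1 : monsky x 1 = 1 by rewrite /monsky mul1r expr1; field; rewrite gt_eqF.
    rewrite m1 cabs1 cabs_real ger0_norm ?monsky_ge0//.
    have -> : \sum_(1 <= n < N.+1) cabs ((monsky x n)%:C - (monsky x n.+1)%:C) =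
        \sum_(1 <= n < N.+1) (- monsky x n.+1 - (- monsky x n)).
      rewrite !big_nat; apply: eq_bigr => n /andP[n0 _].
      by rewrite -rmorphB cabs_real ger0_norm ?subr_ge0 ?monsky_decr// opprK addrC.
    by rewrite telescope_sumr// m1 opprK mulrC; lra.
  have h5 : `|\sum_(1 <= d < N.+1) c d * \sum_(1 <= j < (N %/ d).+1) x ^+ (d * j) -
      \sum_(1 <= d < N.+1) c d * (x ^+ d / (1 - x ^+ d))| <= (1 - x)^-1 * (N%:R * x ^+ N).
    rewrite -sumrB; apply: le_trans (ler_norm_sum _ _ _) _.
    apply: le_trans (_ : \sum_(1 <= d < N.+1) (1 - x)^-1 * x ^+ N <= _); last first.
      by rewrite big_const_nat iter_addr addr0 subn1 /= -[_ *+ N]mulr_natl mulrCA.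
    rewrite !big_nat; apply: ler_sum => d /andP[d0 dN].
    rewrite -mulrBr normrM -[leRHS]mul1r; apply: ler_pM => //.
      by case/or3P: (real_cv d) => /eqP ->; rewrite ?normr0 ?normrN ?normr1.
    set y := x ^+ d; have y0 : 0 <= y by rewrite exprn_ge0// ltW.
    have yx : y <= x by rewrite /y -(prednK d0) exprS ler_piMr ?(ltW x0)// exprn_ile1// !ltW.
    have v0 : 0 < 1 - y by lra.
    have gs J : \sum_(1 <= j < J.+1) x ^+ (d * j) = y / (1 - y) - y ^+ J.+1 / (1 - y).
      elim: J => [|J IH]; first by rewrite big_geq// expr1 subrr.
      by rewrite big_nat_recr//= IH exprM -/y !exprS; field; rewrite gt_eqF.
    rewrite gs addrAC subrr sub0r normrN ger0_norm ?divr_ge0 ?(exprn_ge0 _ y0) ?(ltW v0)//.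
    rewrite mulrC; apply: ler_pM; rewrite ?invr_ge0 ?(exprn_ge0 _ y0) ?(ltW v0)//.
      by rewrite lef_pV2 ?posrE//; lra.
    rewrite /y -exprM; apply: ler_wiXn2l; [exact: ltW|exact: ltW|].
    by rewrite mulnC ltnW// ltn_ceil.
  rewrite h2; rewrite h3 in h5; move: h4 h5; rewrite !ler_norml => /andP[h41 h42] /andP[h51 h52].
  have : (1 - x)^-1 * A N <= (1 - x)^-1 * `|A N| by rewrite ler_wpM2l ?invr_ge0 ?(ltW u0)// ler_norm.
  by rewrite /e; lra.
(* For 1 - x = 1 / (2 L^2) the L = 4 q + 1 terms are each at least 1/2, so their sum exceeds 2 q. *)
pose L := (4 * q + 1)%N; have L0' : 0 < (L ^ 2)%N%:R :> R by rewrite ltr0n expn_gt0 /L addn1.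
pose h : R := (2 * (L ^ 2)%N%:R)^-1.
have h0 : 0 < h by rewrite invr_gt0 mulr_gt0.
have h2 : h <= 2^-1.
  rewrite lef_pV2 ?posrE ?mulr_gt0// ler_peMr// ler1n expn_gt0 /L addn1//.
have bern n : 1 - n%:R * h <= (1 - h) ^+ n.
  elim: n => [|n IH]; first by rewrite mul0r subr0.
  rewrite exprS; apply: le_trans (ler_wpM2l _ IH); last by lra.
  have : 0 <= n%:R * (h * h) by rewrite !mulr_ge0 ?(ltW h0).
  by rewrite -natr1; lra.
have h01 : 0 < 1 - h < 1 by lra.
have := key (1 - h) L h01; apply/negP; rewrite -ltNge.
apply: lt_le_trans (_ : \sum_(1 <= l < L.+1) 2^-1 <= _).
  rewrite big_const_nat iter_addr addr0 subn1 /= -[_ *+ L]mulr_natr /L natrD natrM.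
  lra.
rewrite !big_nat; apply: ler_sum => l /andP[l0 lL].
apply: le_trans (bern _).
have : (l ^ 2)%N%:R * h <= 2^-1.
  rewrite /h invfM mulrCA ler_piMr ?invr_ge0// ler_pdivrMr// mul1r ler_nat leq_exp2r//.
lra.
Qed.

End NonvanishingReal.

(** * Approximation of 1/L(1, chi) *)

Section CexpTaylor.
Variable R : realType.
Implicit Types (w u z s : R[i]) (K n N : nat).

(** Differentiating e^(-t w) times the Taylor polynomial of e^(t w) leaves the single term -w (t
    w)^K / K! times e^(-t w). The unit [u] rotates the plane, so that [u = 1] and [u = 'i] give the
    real and the imaginary part. *)
Lemma Re_cexp_taylor w u K : cabs u = 1 ->
  `|complex.Re (u * (cexp (- w) * \sum_(m < K.+1) w ^+ m / m`!%:R - 1))| <=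
  expR (cabs w) * (cabs w ^+ K.+1 / K`!%:R).
Proof.
move=> u1; set a := complex.Re w; set b := complex.Im w.
pose co m : R[i] := u * w ^+ m / m`!%:R.
pose A : {poly R} := \poly_(m < K.+1) complex.Re (co m).
pose B : {poly R} := \poly_(m < K.+1) complex.Im (co m).
pose e t : R := expR (- a *: 'X).[t].
pose c t : R := cos (b *: 'X).[t].
pose s t : R := sin (b *: 'X).[t].
pose f t := e t * (c t * A.[t] + s t * B.[t]).
pose df t := (- a) * e t * (c t * A.[t] + s t * B.[t]) +
  e t * ((- s t * b) * A.[t] + c t * A^`().[t] + (c t * b * B.[t] + s t * B^`().[t])).
have dX (k t : R) : (k *: 'X)^`().[t] = k by rewrite derivZ derivX hornerZ hornerC mulr1.
have fdf t : is_derive t (1 : R) f (df t).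
  have he : is_derive t (1 : R) e (e t * (- a)).
    by have := @is_derive_comp_horner _ expR _ (- a *: 'X) t (is_derive_expR _); rewrite dX.
  have hc : is_derive t (1 : R) c (- s t * b).
    by have := @is_derive_comp_horner _ cos _ (b *: 'X) t (is_derive_cos _); rewrite dX.
  have hs : is_derive t (1 : R) s (c t * b).
    by have := @is_derive_comp_horner _ sin _ (b *: 'X) t (is_derive_sin _); rewrite dX.
  have hA := is_derive_poly A t; have hB := is_derive_poly B t.
  have h := is_deriveM he (is_deriveD (is_deriveM hc hA) (is_deriveM hs hB)).
  apply: (is_derive_eq h); rewrite /df /GRing.scale /=.
  have -> : (c * horner A + s * horner B) t = c t * A.[t] + s t * B.[t] by [].
  by ring.
have ec t : (e t)%:C * (c t +i* - s t) = cexp (- (w * t%:C)).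
  rewrite /cexp ReN ImN ReMr ImMr /e /c /s !hornerE cosN sinN.
  by rewrite mulNr.
have AB t : A.[t] +i* B.[t] = \sum_(m < K.+1) co m * (t%:C) ^+ m.
  apply/eqP; rewrite eq_complex Re_sum Im_sum /A /B !horner_poly /=.
  by apply/andP; split; apply/eqP; apply: eq_bigr => m _; rewrite -rmorphXn ?ReMr ?ImMr.
have fE t : f t = complex.Re (cexp (- (w * t%:C)) * \sum_(m < K.+1) co m * (t%:C) ^+ m).
  by rewrite -ec -AB -mulrA ReM /= mul0r subr0 /f; ring.
have dfE t : df t = - complex.Re (cexp (- (w * t%:C)) * (w * (co K * t%:C ^+ K))).
  have dAB : A^`().[t] +i* B^`().[t] = w * \sum_(m < K) co m * (t%:C) ^+ m.
    rewrite mulr_sumr; apply/eqP; rewrite eq_complex Re_sum Im_sum /=.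
    have dco m : co m.+1 * m.+1%:R = w * co m.
      rewrite /co exprS factS natrM; field.
      by rewrite pnatr_eq0 -lt0n fact_gt0 /= addrC natr1 pnatr_eq0.
    have dP (g : R[i] -> R) (gM : forall z (x : R), g (z * x%:C) = g z * x) :
      (\poly_(m < K.+1) g (co m))^`().[t] = \sum_(m < K) g (w * (co m * (t%:C) ^+ m)).
      rewrite (@horner_coef_wide _ K); last first.
        by apply/leq_sizeP => j Kj; rewrite coef_deriv coef_poly ltnS ltnNge Kj mul0rn.
      apply: eq_bigr => m _; rewrite coef_deriv coef_poly ltnS ltn_ord.
      by rewrite mulrA -dco -rmorphXn gM -[m.+1%:R](rmorph_nat (real_complex R)) gM mulr_natr.
    by apply/andP; split; apply/eqP; apply: dP => z x; rewrite ?ReMr ?ImMr.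
  have -> : df t = complex.Re (cexp (- (w * t%:C)) * (- w * (A.[t] +i* B.[t]) + (A^`().[t] +i* B^`().[t]))).
    rewrite -ec /df; case E : w => [a' b'] /=; rewrite /a /b E /=.
    by rewrite !(mul0r, subr0, addr0); ring.
  rewrite dAB AB big_ord_recr /= -ReN; congr complex.Re; ring.
have f1 : f 1 = complex.Re (u * (cexp (- w) * \sum_(m < K.+1) w ^+ m / m`!%:R)).
  rewrite fE rmorph1 mulr1; congr complex.Re; rewrite mulrCA; congr (_ * _).
  by rewrite mulr_sumr; apply: eq_bigr => m _; rewrite expr1n mulr1 /co mulrA.
have f0 : f 0 = complex.Re u.
  rewrite fE rmorph0 mulr0 oppr0 cexp0 mul1r big_ord_recl big1 => [|m _].
    by rewrite /co !expr0 fact0 divr1 !mulr1 addr0.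
  by rewrite expr0n mulr0.
have -> : complex.Re (u * (cexp (- w) * \sum_(m < K.+1) w ^+ m / m`!%:R - 1)) = f 1 - f 0.
  by rewrite f1 f0 mulrBr mulr1 ReD ReN.
apply: (@mvt_le _ f df) => t /andP[t0 t1].
rewrite dfE normrN; apply: le_trans (Re_le_cabs _) _.
rewrite cabsM cabs_cexp /co !cabsM cabsV cabs_nat u1 mul1r !cabsX cabs_real (ger0_norm t0).
apply: ler_pM; rewrite ?expR_ge0 ?mulr_ge0 ?exprn_ge0 ?cabs_ge0 ?invr_ge0//.
  rewrite ler_expR ReN ReMr; apply: le_trans (_ : `|a| * `|t| <= _).
    by rewrite -normrM; apply: le_trans (ler_norm _) _; rewrite normrN.
  rewrite (ger0_norm t0); apply: le_trans (_ : `|a| * 1 <= _); first exact: ler_wpM2l.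
  by rewrite mulr1 Re_le_cabs.
rewrite exprS -[leRHS]mulrA; apply: ler_wpM2l; first exact: cabs_ge0.
by apply: ler_piMr; rewrite ?exprn_ile1// divr_ge0 ?exprn_ge0 ?cabs_ge0.
Qed.

Lemma cexp_taylor w K :
  cabs (cexp w - \sum_(m < K.+1) w ^+ m / m`!%:R) <=
  2 * expR (2 * cabs w) * (cabs w ^+ K.+1 / K`!%:R).
Proof.
set P := \sum_(m < K.+1) _.
have -> : cexp w - P = - (cexp w * (cexp (- w) * P - 1)).
  by rewrite mulrBr mulrA -cexpD subrr cexp0; ring.
rewrite cabsN cabsM cabs_cexp.
set g := _ - 1.
have hR : `|complex.Re g| <= expR (cabs w) * (cabs w ^+ K.+1 / K`!%:R).
  by have := Re_cexp_taylor w K (cabs1 R); rewrite mul1r.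
have hI : `|complex.Im g| <= expR (cabs w) * (cabs w ^+ K.+1 / K`!%:R).
  have i1 : cabs ('i : R[i]) = 1 by rewrite /cabs /= expr0n expr1n add0r sqrtr1.
  have := Re_cexp_taylor w K i1; rewrite -/P -/g.
  by rewrite ReM /= mul0r mul1r sub0r normrN.
have h := le_trans (cabs_le_ReIm g) (lerD hR hI).
apply: le_trans (ler_wpM2l (expR_ge0 _) h) _.
set y := cabs w ^+ _ / _ in h hR hI *.
have y0 : 0 <= y by rewrite divr_ge0 ?exprn_ge0 ?cabs_ge0.
apply: le_trans (_ : expR (cabs w) * (expR (cabs w) * y + expR (cabs w) * y) <= _).
  have ey := mulr_ge0 (expR_ge0 (cabs w)) y0.
  apply: ler_wpM2r; first exact: addr_ge0.
  rewrite ler_expR.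
  by apply: le_trans (ler_norm _) (Re_le_cabs _).
have -> : 2 * cabs w = cabs w + cabs w by ring.
by rewrite expRD le_eqVlt; apply/orP; left; apply/eqP; ring.
Qed.

Lemma cabs_1Bcexp w : cabs (1 - cexp w) <= 2 * cabs w * expR (cabs w).
Proof.
have [w0|w0] := leP (complex.Re w) 0.
  have := @cabs_1cexpN _ (- w); rewrite opprK ReN oppr_ge0 cabsN => /(_ w0) h.
  apply: le_trans h _; rewrite ler_peMr ?mulr_ge0 ?cabs_ge0//.
  by rewrite -[leLHS]expR0 ler_expR cabs_ge0.
have -> : 1 - cexp w = - (cexp w * (1 - cexp (- w))).
  by rewrite mulrBr -cexpD subrr cexp0; ring.
rewrite cabsN cabsM cabs_cexp mulrC; apply: ler_pM; rewrite ?cabs_ge0 ?expR_ge0//.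
  by rewrite cabs_1cexpN// ltW.
by rewrite ler_expR; apply: le_trans (ler_norm _) (Re_le_cabs _).
Qed.

Lemma npow_lipschitz n s z : 0 <= complex.Re s ->
  cabs (npow n (- s) - npow n (- z)) <=
    2 * (ln n%:R * cabs (s - z)) * expR (ln n%:R * cabs (s - z)).
Proof.
move=> s0; have -> : npow n (- s) - npow n (- z) =
   npow n (- s) * (1 - cexp ((ln n%:R)%:C * (s - z))).
  rewrite mulrBr mulr1 /npow -cexpD; congr (_ - cexp _); ring.
rewrite cabsM cabs_npowN -[leRHS]mul1r; apply: ler_pM; rewrite ?cabs_ge0 ?rpw_ge0 ?rpw_le1//.
by apply: le_trans (cabs_1Bcexp _) _; rewrite cabsM cabs_real ger0_norm ?ln_nat_ge0.
Qed.

(** A square rather than a disc: as a product of two segments it is compact at once, and it contains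
    the disc of radius [rho]. *)
Definition csquare (rho : R) z := `|complex.Re z| <= rho /\ `|complex.Im z| <= rho.

(** Compactness gives no explicit [d]. This is harmless: [d] only decides how far the Dirichlet
    series must be cut, and the cut disappears in the limit. *)
Lemma csquare_inf (F : R[i] -> R[i]) (rho : R) : 0 <= rho ->
  (forall e, 0 < e -> exists2 d, 0 < d & forall z w, csquare rho z -> csquare rho w ->
     cabs (z - w) <= d -> cabs (F z - F w) <= e) ->
  (forall z, csquare rho z -> F z != 0) ->
  exists2 d, 0 < d & forall z, csquare rho z -> d <= cabs (F z).
Proof.
move=> rho0 Fc F0.
pose A : set (R * R) := `[- rho, rho]%classic `*` `[- rho, rho]%classic.
pose f (p : R * R) : R := cabs (F (p.1 +i* p.2)).
have Asq p : A p -> csquare rho (p.1 +i* p.2).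
  by move=> [] /=; rewrite !in_itv /csquare /= !ler_norml.
have cA : compact A by apply: compact_setX; exact: segment_compact.
have A0 : A !=set0.
  by exists (0, 0); split; rewrite /= in_itv /= oppr_le0 rho0.
have cf : {within A, continuous f}.
  apply/subspace_continuousP => p Ap; apply/cvgrPdist_le => e e0.
  have [d d0 hd] := Fc _ e0.
  rewrite near_withinE; apply/nbhs_ballP; exists (d / 2) => /=.
    by rewrite divr_gt0.
  move=> p' [/= h1 h2] Ap'; rewrite /ball /= in h1 h2.
  have hd2 : cabs (p.1 +i* p.2 - (p'.1 +i* p'.2)) <= d.
    by apply: le_trans (cabs_le_ReIm _) _ => /=; lra.
  have := hd _ _ (Asq _ Ap) (Asq _ Ap') hd2.
  set x := F _; set y := F _ => hxy; suff : `|cabs x - cabs y| <= e by [].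
  rewrite ler_norml.
  have := cabsD (x - y) y; have := cabsD (y - x) x; rewrite !subrK (cabs_distC y).
  by lra.
have [c cA' cmin] := compact_EVT_min A0 cA cf.
exists (f c).
  by rewrite /f cabs_gt0 F0//; apply: Asq; rewrite inE in cA'.
move=> [x y] [/= hx hy]; have := cmin (x, y); apply.
by rewrite inE /A /=; split; rewrite /= in_itv /= -ler_norml.
Qed.

End CexpTaylor.

Section Mobius.
Variable R : realType.
Implicit Types (m n d p : nat).

Definition sqfree n := all (fun l => (logn l n <= 1)%N) (primes n).
Definition mobius n : R := if sqfree n then (-1) ^+ size (primes n) else 0.

Lemma mobius1 : mobius 1 = 1. Proof. by rewrite /mobius /= expr0. Qed.

Lemma mobius_sqr n : mobius n ^+ 2 = (sqfree n)%:R.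
Proof. by rewrite /mobius; case: ifP; rewrite ?sqrr_sign ?expr0n. Qed.

Lemma mobius_le1 n : `|mobius n| <= 1.
Proof. by rewrite /mobius; case: ifP; rewrite ?normr0 ?normr_sign. Qed.

Lemma sqfreeP n : (0 < n)%N -> reflect (forall l, (logn l n <= 1)%N) (sqfree n).
Proof.
move=> n0; apply: (iffP allP) => [h l|h l _]; last exact: h.
have [ln|ln] := boolP (l \in primes n); first exact: h.
by move: ln; rewrite -logn_gt0 lt0n negbK => /eqP ->.
Qed.

Lemma mobius_mul_prime p d : prime p -> ~~ (p %| d)%N -> (0 < d)%N ->
  mobius (p * d) = - mobius d.
Proof.
move=> pp pd d0; have p0 := prime_gt0 pp; have pd0 : (0 < p * d)%N by rewrite muln_gt0 p0.
have lp : logn p d = 0%N by apply: logn_coprime; rewrite prime_coprime.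
have -> : mobius (p * d) = if sqfree d then (-1) ^+ (size (primes d)).+1 else 0.
  rewrite /mobius.
  have -> : size (primes (p * d)) = (size (primes d)).+1.
    rewrite -[RHS]/(size (p :: primes d)); apply: perm_size; apply: uniq_perm.
    - exact: primes_uniq.
    - by rewrite /= primes_uniq mem_primes pp d0 pd.
    - by move=> l; rewrite primesM// primes_prime// !inE.
  congr (if _ then _ else _); apply/(sqfreeP pd0)/(sqfreeP d0) => h l.
    by have := h l; rewrite lognM//; apply: leq_trans; rewrite leq_addl.
  rewrite lognM// (logn_prime l pp); case: eqP => [->|_]; first by rewrite lp.
  exact: h.
by rewrite /mobius; case: ifP; rewrite ?oppr0// exprS mulN1r.
Qed.

Lemma mobius_sq_mul p d i : prime p -> (0 < d)%N -> mobius (p ^ i.+2 * d) = 0.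
Proof.
move=> pp d0; have p0 := prime_gt0 pp.
have pd0 : (0 < p ^ i.+2 * d)%N by rewrite muln_gt0 expn_gt0 p0.
rewrite /mobius; case: ifP => // /(sqfreeP pd0)/(_ p).
by rewrite lognM ?expn_gt0 ?p0// pfactorK.
Qed.

Lemma sum_mobius n : (0 < n)%N -> \sum_(d <- divisors n) mobius d = (n == 1)%:R.
Proof.
move=> n0; have [n1|n1] := leqP n 1.
  have -> : n = 1%N by apply/eqP; rewrite eqn_leq n1.
  by rewrite big_seq1 mobius1.
rewrite (gtn_eqF n1).
have pp : prime (pdiv n) by exact: pdiv_prime.
have [m pm nE] := pfactor_coprime pp n0.
have e0 : (0 < logn (pdiv n) n)%N by rewrite logn_gt0 mem_primes pp n0 pdiv_dvd.
move: pp pm nE e0; move: (pdiv n) => p; move: (logn p n) => e pp pm nE e0.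
have m0 : (0 < m)%N by move: n0; rewrite nE muln_gt0 => /andP[].
have pm' : ~~ (p %| m)%N by rewrite -prime_coprime.
rewrite nE mulnC big_divisors_pfactor//; case: e e0 {nE} => // e _.
rewrite !big_ord_recl [X in _ + (_ + X)]big1 ?addr0 => [|i _]; last first.
  rewrite big_seq big1// => d; rewrite -dvdn_divisors// => dm.
  by rewrite mobius_sq_mul// (dvdn_gt0 m0).
rewrite -big_split /= big_seq big1// => d; rewrite -dvdn_divisors// => dm.
rewrite expn0 mul1n expn1 mobius_mul_prime ?subrr// ?(dvdn_gt0 m0)//.
by apply: contra pm' => /dvdn_trans; apply.
Qed.

End Mobius.

Section ConvolutionInverse.
Variable R : realType.
Variables (q : nat) (chi : int -> R[i]) (r : R).
Hypothesis q0 : (0 < q)%N.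
Hypothesis chiP : dirichlet_character q chi.
Hypothesis r0 : 0 < r.
Implicit Types (n m N l : nat).

Let s0 : R[i] := (1 + r)%:C.
Let a n : R[i] := chi n%:Z * (rpw (1 + r) n)%:C.
(** The m-th Taylor coefficients at 1 + r of the partial sums of L and, for [Mcoef], of the series
    of mu(n) chi(n) n^-s. *)
Definition Lcoef N m : R[i] :=
  \sum_(1 <= n < N.+1) a n * ((- ln n%:R)%:C ^+ m / m`!%:R).
Definition Mcoef N m : R[i] :=
  \sum_(1 <= n < N.+1) (mobius R n)%:C * a n * ((- ln n%:R)%:C ^+ m / m`!%:R).

Lemma exp_conv (x y : R[i]) m :
  \sum_(l < m.+1) (x ^+ l / l`!%:R) * (y ^+ (m - l) / (m - l)`!%:R) =
  (x + y) ^+ m / m`!%:R.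
Proof.
rewrite addrC exprDn mulr_suml; apply: eq_bigr => l _.
have lm : (l <= m)%N by rewrite -ltnS.
rewrite -(bin_fact lm) !natrM -[_ *+ _]mulr_natl.
have h k : k`!%:R != 0 :> R[i] by rewrite pnatr_eq0 -lt0n fact_gt0.
field; rewrite !h /= pnatr_eq0 -lt0n bin_gt0 lm //.
Qed.

Lemma ln_expr_le m n : (ln n%:R) ^+ m / m`!%:R <= (2 / r) ^+ m * expR (r / 2 * ln n%:R) :> R.
Proof.
have h := @expr_fact_le_expR R (r / 2 * ln n%:R) m.
rewrite mulr_ge0 ?ln_nat_ge0 ?divr_ge0 ?(ltW r0)// in h; have {}h := h isT.
have -> : ln n%:R ^+ m / m`!%:R = (2 / r) ^+ m * ((r / 2 * ln n%:R) ^+ m / m`!%:R).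
  by rewrite mulrA -exprMn; congr (_ ^+ _ / _); field; rewrite gt_eqF.
by rewrite ler_wpM2l// exprn_ge0// divr_ge0// ltW.
Qed.

(** By Moebius inversion the pairs with n k <= N sum exactly to the coefficient of the constant 1.
    For the others, half of the exponent r absorbs (log)^m / m!; of the remaining r/2, one half
    gives the factor N^(-r/4) and the other keeps the double sum bounded. *)
Lemma LMcoef_conv N m : (0 < N)%N ->
  cabs (\sum_(l < m.+1) Lcoef N l * Mcoef N (m - l) - (m == 0)%:R) <=
  (2 / r) ^+ m * (1 + 4 / r) ^+ 2 * rpw (r / 4) N.
Proof.
move=> N0.
pose G n : R[i] := a n * ((- ln n%:R)%:C ^+ m / m`!%:R).
have aM n k : (0 < n)%N -> (0 < k)%N -> a (n * k)%N = a n * a k.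
  by move=> n0 k0; rewrite /a PoszM (dcM chiP) rpwM// rmorphM mulrACA.
have E1 : \sum_(l < m.+1) Lcoef N l * Mcoef N (m - l) =
   \sum_(1 <= n < N.+1) \sum_(1 <= k < N.+1) (mobius R k)%:C * G (n * k)%N.
  rewrite /Lcoef /Mcoef; under eq_bigr do rewrite mulr_suml.
  rewrite exchange_big /= !big_nat; apply: eq_bigr => n /andP[n0 _].
  under eq_bigr do rewrite mulr_sumr.
  rewrite exchange_big /= !big_nat; apply: eq_bigr => k /andP[k0 _].
  transitivity ((mobius R k)%:C * (a n * a k) *
    \sum_(l < m.+1) ((- ln n%:R)%:C ^+ l / l`!%:R) * ((- ln k%:R)%:C ^+ (m - l) / (m - l)`!%:R)).
    by rewrite mulr_sumr; apply: eq_bigr => l _; ring.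
  rewrite exp_conv /G aM// natrM lnM ?posrE ?ltr0n// opprD rmorphD -mulrA //.
have E2 : \sum_(1 <= n < N.+1) \sum_(1 <= k < N.+1 | (n * k <= N)%N) (mobius R k)%:C * G (n * k)%N
    = (m == 0)%:R.
  transitivity (\sum_(1 <= k < N.+1) (mobius R k)%:C * \sum_(1 <= n < (N %/ k).+1) G (k * n)%N).
    under eq_bigr do rewrite big_mkcond; rewrite exchange_big_nat /= !big_nat.
    apply: eq_bigr => k /andP[k0 kN]; rewrite mulr_sumr -big_mkcond /=.
    rewrite (big_cat_nat (n := (N %/ k).+1)) //=; last by rewrite ltnS leq_div.
    rewrite [X in _ + X]big_nat_cond [X in _ + X]big_pred0 ?addr0; last first.
      by move=> n; rewrite -leq_divRL//; case: leqP; rewrite ?andbF// => h; rewrite ltnS; lia.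
    apply: congr_big_nat => [//|//|n /andP[n0 nN]|n _]; last by rewrite mulnC.
    by rewrite -leq_divRL// -ltnS.
  transitivity (\sum_(1 <= k < N.+1) \sum_(1 <= n < N.+1 | (k %| n)%N) (mobius R k)%:C * G n).
    rewrite !big_nat; apply: eq_bigr => k /andP[k0 kN].
    by rewrite -sum_multiples_div// mulr_sumr.
  under eq_bigr do rewrite big_mkcond; rewrite exchange_big_nat /=.
  transitivity (\sum_(1 <= n < N.+1) ((n == 1)%N%:R : R)%:C * G n).
    rewrite !big_nat; apply: eq_bigr => n /andP[n0 nN].
    rewrite -big_mkcond /= -mulr_suml -sum_mobius// rmorph_sum /=.
    by rewrite (@sum_divisors _ n N)// n0.
  rewrite big_ltn// big_nat big1 ?addr0 => [|n /andP[n1 _]]; last first.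
    by rewrite gtn_eqF// rmorph0 mul0r.
  rewrite rmorph1 mul1r /G /a (dc1 chiP) rpw_one mul1r ln1 oppr0 rmorph0 expr0n mul1r.
  by case: m {E1 G} => [|m]; rewrite ?fact0 ?divr1// mul0r.
have -> : \sum_(l < m.+1) Lcoef N l * Mcoef N (m - l) - (m == 0)%:R =
    \sum_(1 <= n < N.+1) \sum_(1 <= k < N.+1 | ~~ (n * k <= N)%N) (mobius R k)%:C * G (n * k)%N.
  rewrite E1 -E2 -sumrB; apply: eq_bigr => n _.
  by rewrite (bigID (fun k => n * k <= N)%N) /= addrAC subrr add0r.
have Gle n : (0 < n)%N -> cabs (G n) <= (2 / r) ^+ m * rpw (1 + r / 2) n.
  move=> n0; rewrite /G /a !cabsM cabs_real ger0_norm ?rpw_ge0// cabsX cabs_real normrN.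
  rewrite ger0_norm ?ln_nat_ge0// cabsV cabs_nat.
  apply: le_trans (_ : 1 * rpw (1 + r) n * ((2 / r) ^+ m * expR (r / 2 * ln n%:R)) <= _).
    apply: ler_pM; rewrite ?ln_expr_le ?mulr_ge0 ?cabs_ge0 ?rpw_ge0 ?invr_ge0 ?exprn_ge0 ?ln_nat_ge0//.
    by rewrite ler_wpM2r ?rpw_ge0// (dc_cabs_le1 q0 chiP).
  rewrite mul1r mulrCA /rpw -expRD le_eqVlt; apply/orP; left; apply/eqP; congr (_ * expR _).
  by field.
apply: le_trans (cabs_sum _ _ _) _.
apply: le_trans (_ : \sum_(1 <= n < N.+1) \sum_(1 <= k < N.+1)
    (2 / r) ^+ m * rpw (r / 4) N * (rpw (1 + r / 4) n * rpw (1 + r / 4) k) <= _).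
  rewrite !big_nat; apply: ler_sum => n /andP[n0 _].
  apply: le_trans (cabs_sum _ _ _) _; rewrite big_mkcond !big_nat.
  apply: ler_sum => k /andP[k0 _].
  have C0 : 0 <= (2 / r) ^+ m by rewrite exprn_ge0// divr_ge0// ltW.
  case: ifP => [nk|_]; last by rewrite !mulr_ge0 ?rpw_ge0.
  have nk0 : (0 < n * k)%N by rewrite muln_gt0 n0.
  rewrite cabsM cabs_real -[leRHS]mul1r; apply: ler_pM; rewrite ?cabs_ge0 ?mobius_le1//.
  apply: le_trans (Gle _ nk0) _; rewrite -mulrA ler_wpM2l ?exprn_ge0 ?divr_ge0 ?(ltW r0)//.
  rewrite -rpwM// (_ : 1 + r / 2 = r / 4 + (1 + r / 4)); last by field.
  rewrite rpwD ler_wpM2r ?rpw_ge0// rpw_le ?divr_ge0 ?(ltW r0)//.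
  by rewrite ltnW// ltnNge.
under eq_bigr do rewrite -mulr_sumr.
under eq_bigr do rewrite -mulr_sumr.
rewrite -mulr_sumr -mulr_suml -mulrA [leRHS]mulrAC -mulrA ler_wpM2l ?exprn_ge0 ?divr_ge0 ?(ltW r0)//.
rewrite ler_wpM2l ?rpw_ge0// expr2.
have h : \sum_(1 <= i < N.+1) rpw (1 + r / 4) i <= 1 + 4 / r.
  by apply: le_trans (sum_rpw _ _) _; rewrite ?divr_gt0// invf_div.
by apply: ler_pM => //; apply: sumr_ge0 => i _; rewrite rpw_ge0.
Qed.

End ConvolutionInverse.

(** * The expansion of 1/L at 1 + r, evaluated at 1 *)

Section InverseAtOne.
Variable R : realType.
Variables (q : nat) (chi : int -> R[i]) (r : R).
Hypothesis q0 : (0 < q)%N.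
Hypothesis chiP : dirichlet_character q chi.
Hypothesis chi_np : chi <> @principal_character R q.
Hypothesis r0 : 0 < r.
Hypothesis r8 : r <= 1 / 8.
Implicit Types (n m N J : nat) (z w : R[i]).

Lemma cvg0_near_le (e : nat -> R) (x : R) : e n @[n --> \oo] --> (0 : R) -> 0 < x ->
  \forall n \near \oo, e n <= x.
Proof.
move=> /cvgrPdist_le h x0; near=> n.
have : `|0 - e n| <= x by near: n; exact: h.
by rewrite sub0r normrN; apply: le_trans (ler_norm _).
Unshelve. all: by end_near. Qed.

Lemma expr_fact_cvg0 (x : R) : (x ^+ n.+1 / n`!%:R) @[n --> \oo] --> (0 : R).
Proof.
have -> : (fun n : nat => x ^+ n.+1 / n`!%:R) = (fun n => x * exp_coeff x n).
  by apply/funext => n; rewrite /exp_coeff /= exprS mulrA.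
apply: cvg0_Ml; apply: cvg_series_cvg_0; exact: is_cvg_series_exp_coeff.
Qed.

Lemma Lpart_taylor N J z : (0 < N)%N -> cabs z <= 1 ->
  cabs (Lpart chi N ((1 + r)%:C + z) - (\poly_(m < J.+1) Lcoef chi r N m).[z]) <=
  N%:R * (2 * expR (2 * ln N%:R)) * (ln N%:R ^+ J.+1 / J`!%:R).
Proof.
move=> N0 z1; rewrite horner_poly /Lcoef.
under eq_bigr do rewrite mulr_suml.
rewrite exchange_big /= -sumrB; apply: le_trans (cabs_sum _ _ _) _.
apply: le_trans (_ : \sum_(1 <= n < N.+1) (2 * expR (2 * ln N%:R)) * (ln N%:R ^+ J.+1 / J`!%:R) <= _); last first.
  by rewrite big_const_nat iter_addr_0 subSS subn0 -[leLHS]mulr_natl mulrA.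
rewrite !big_nat; apply: ler_sum => n /andP[n0 nN].
have lnn : ln n%:R <= ln N%:R :> R by rewrite ler_ln ?posrE ?ltr0n// ler_nat -ltnS.
pose w : R[i] := (- ln n%:R)%:C * z.
have wle : cabs w <= ln N%:R.
  rewrite /w cabsM cabs_real normrN ger0_norm ?ln_nat_ge0// -[leRHS]mulr1.
  by apply: ler_pM; rewrite ?ln_nat_ge0 ?cabs_ge0.
have -> : chi n * npow n (- ((1 + r)%:C + z)) -
   \sum_(i < J.+1) chi n%:Z * (rpw (1 + r) n)%:C * ((- ln n%:R)%:C ^+ i / i`!%:R) * z ^+ i =
   chi n%:Z * (rpw (1 + r) n)%:C * (cexp w - \sum_(m < J.+1) w ^+ m / m`!%:R).
  have -> : npow n (- ((1 + r)%:C + z)) = (rpw (1 + r) n)%:C * cexp w.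
    rewrite -[(rpw (1 + r) n)%:C]cexp_real /npow -cexpD; congr cexp.
    by rewrite /w !rmorphN rmorphM; ring.
  rewrite mulrA mulrBr; congr (_ - _).
  by rewrite mulr_sumr; apply: eq_bigr => m _; rewrite /w exprMn; ring.
rewrite cabsM -[leRHS]mul1r; apply: ler_pM; rewrite ?cabs_ge0//.
  rewrite cabsM cabs_real ger0_norm ?rpw_ge0// -[leRHS]mulr1.
  apply: ler_pM; rewrite ?cabs_ge0 ?rpw_ge0 ?(dc_cabs_le1 q0 chiP)// rpw_le1//.
  by rewrite addr_ge0 ?(ltW r0).
apply: le_trans (cexp_taylor _ _) _.
apply: ler_pM; rewrite ?mulr_ge0 ?expR_ge0 ?exprn_ge0 ?cabs_ge0 ?invr_ge0//.
  by rewrite ler_wpM2l// ler_expR ler_wpM2l.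
rewrite ler_wpM2r ?invr_ge0//; apply: lerXn2r => //; rewrite nnegrE ?cabs_ge0 ?ln_nat_ge0//.
Qed.

Lemma csquare_shift z : csquare (3 * r) z ->
  3 / 4 <= complex.Re ((1 + r)%:C + z) /\ cabs ((1 + r)%:C + z) <= 2.
Proof.
move=> [h1 h2]; have b := cabs_le_ReIm ((1 + r)%:C + z).
move: h1 h2 b; rewrite ReD ImD /= add0r !ler_norml => /andP[h1 h1'] /andP[h2 h2'] b.
move: (complex.Re z) (complex.Im z) (cabs _) h1 h1' h2 h2' b => x y c h1 h1' h2 h2' b.
have r8' := r8; have hp : 0 <= 1 + r + x by lra.
rewrite ger0_norm// in b; split; first lra.
have : `|y| <= 3 * r by rewrite ler_norml h2.
by move: b; lra.
Qed.

Lemma cabs_csquare (x : R) z : cabs z <= x -> csquare x z.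
Proof. by move=> h; split; apply: le_trans h; rewrite ?Re_le_cabs ?Im_le_cabs. Qed.

Lemma Lfun_tail_csquare N z : (0 < N)%N -> csquare (3 * r) z ->
  cabs (Defs.Lfun q chi ((1 + r)%:C + z) - Lpart chi N ((1 + r)%:C + z)) <=
  8 * q%:R * rpw (1 / 2) N.
Proof.
move=> N0 /csquare_shift[h1 h2].
have hs : 0 < complex.Re ((1 + r)%:C + z) by lra.
apply: le_trans (Lfun_tail q0 chiP chi_np hs N0) _.
apply: ler_pM; rewrite ?rpw_ge0 ?mulr_ge0 ?addr_ge0 ?divr_ge0 ?cabs_ge0 ?(ltW hs)//.
  rewrite mulrAC ler_wpM2r//.
  have : cabs ((1 + r)%:C + z) / complex.Re ((1 + r)%:C + z) <= 3.
    by rewrite ler_pdivrMr//; lra.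
  by lra.
by rewrite rpw_ler//; lra.
Qed.

Lemma Lpart_lipschitz N z w : (0 < N)%N ->
  0 <= complex.Re z ->
  cabs (Lpart chi N z - Lpart chi N w) <=
  N%:R * (2 * (ln N%:R * cabs (z - w)) * expR (ln N%:R * cabs (z - w))).
Proof.
move=> N0 z0; rewrite /Lpart -sumrB; apply: le_trans (cabs_sum _ _ _) _.
apply: le_trans (_ : \sum_(1 <= n < N.+1) (2 * (ln N%:R * cabs (z - w)) * expR (ln N%:R * cabs (z - w))) <= _); last first.
  by rewrite big_const_nat iter_addr_0 subSS subn0 -[leLHS]mulr_natl.
rewrite !big_nat; apply: ler_sum => n /andP[n0 nN].
have lnn : ln n%:R <= ln N%:R :> R by rewrite ler_ln ?posrE ?ltr0n// ler_nat -ltnS.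
rewrite -mulrBr cabsM -[leRHS]mul1r; apply: ler_pM; rewrite ?cabs_ge0 ?(dc_cabs_le1 q0 chiP)//.
apply: le_trans (npow_lipschitz _ _ z0) _.
apply: ler_pM; rewrite ?mulr_ge0 ?ln_nat_ge0 ?cabs_ge0 ?expR_ge0//.
  by rewrite ler_wpM2l//; apply: ler_wpM2r; rewrite ?cabs_ge0.
by rewrite ler_expR; apply: ler_wpM2r; rewrite ?cabs_ge0.
Qed.

Lemma Lfun_csquare_uc (e : R) : 0 < e -> exists2 d, 0 < d &
  forall z w, csquare (3 * r) z -> csquare (3 * r) w -> cabs (z - w) <= d ->
  cabs (Defs.Lfun q chi ((1 + r)%:C + z) - Defs.Lfun q chi ((1 + r)%:C + w)) <= e.
Proof.
move=> e0.
have [N [N0 hN]] : exists N, (0 < N)%N /\ 8 * q%:R * rpw (1 / 2) N <= e / 4.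
  have h := cvg0_near_le (cvg0_Ml (8 * q%:R) (@rpw_cvg0 R (1 / 2) ltac:(lra))) (divr_gt0 e0 (ltr0n R 4)).
  have [N0 _ hN0] := h.
  by exists N0.+1; split => //; apply: hN0 => /=.
pose l : R := ln N%:R; have l0 : 0 <= l by exact: ln_nat_ge0.
have N0' : 0 < N%:R :> R by rewrite ltr0n.
pose d1 := (1 + l)^-1; pose d2 := e / (8 * N%:R * (1 + l) * expR 1).
exists (Num.min d1 d2).
  rewrite lt_min; apply/andP; split; rewrite /d1 /d2 ?invr_gt0 ?divr_gt0 ?mulr_gt0 ?expR_gt0//; lra.
move=> z w hz hw; rewrite le_min => /andP[zd1 zd2].
have tz := le_trans (Lfun_tail_csquare N0 hz) hN.
have tw := le_trans (Lfun_tail_csquare N0 hw) hN.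
have [Rz _] := csquare_shift hz.
set a := (1 + r)%:C + z in tz Rz *; set b := (1 + r)%:C + w in tw *.
have ab : a - b = z - w by rewrite /a /b; ring.
have Ra : 0 <= complex.Re a by lra.
have hp := Lpart_lipschitz b N0 Ra; rewrite ab -/l in hp.
have x1 : l * cabs (z - w) <= 1.
  apply: le_trans (_ : l * d1 <= _); first by rewrite ler_wpM2l.
  by rewrite /d1 ler_pdivrMr; lra.
have hp2 : cabs (Lpart chi N a - Lpart chi N b) <= e / 4.
  apply: le_trans hp _.
  apply: le_trans (_ : N%:R * (2 * ((1 + l) * d2) * expR 1) <= _).
    rewrite ler_wpM2l ?ler0n//; apply: ler_pM; rewrite ?expR_ge0 ?mulr_ge0 ?cabs_ge0 ?ler_expR//.
    by rewrite ler_wpM2l//; apply: ler_pM; rewrite ?cabs_ge0//; lra.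
  rewrite /d2 le_eqVlt; apply/orP; left; apply/eqP; field.
  by rewrite !gt_eqF ?expR_gt0//; lra.
have -> : Defs.Lfun q chi a - Defs.Lfun q chi b = (Defs.Lfun q chi a - Lpart chi N a) +
   (Lpart chi N a - Lpart chi N b) - (Defs.Lfun q chi b - Lpart chi N b) by ring.
apply: le_trans (cabsB _ _) _; apply: le_trans (lerD (cabsD _ _) (lexx _)) _.
by lra.
Qed.

Lemma Mcoef0_le N : cabs (Mcoef chi r N 0) <= 1 + r^-1.
Proof.
rewrite /Mcoef; apply: le_trans (cabs_sum _ _ _) _.
apply: le_trans (sum_rpw N.+1 r0); apply: ler_sum => n _.
rewrite expr0 fact0 divr1 mulr1 !cabsM !cabs_real (ger0_norm (rpw_ge0 _ _)) mulrA.
apply: ler_piMl; rewrite ?rpw_ge0//.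
apply: mulr_ile1; rewrite ?cabs_ge0 ?normr_ge0 ?mobius_le1 ?(dc_cabs_le1 q0 chiP)//.
Qed.

(** What [poly_inverse_bound] yields: 1 / |T_0| <= 2 (1 + 1 / r), times e^(4 M) with e^M = 4 B (1 +
    1 / r). *)
Definition inv_const (B : R) := 2 * (1 + r^-1) * (4 * B * (1 + r^-1)) ^+ 4.

(** [T] approximates L on the disc, hence is bounded and zero-free there, and [poly_inverse_bound]
    applies with radius 3 r. The three error terms come from cutting the series of 1 / T at -r, from
    replacing 1 / L by 1 / T there, and from replacing the coefficients of 1 / T by [Mcoef]. *)
Lemma Mcoef_series n N J (e d B : R) : (0 < N)%N -> (n <= J.+1)%N -> 1 <= B ->
  (1 + 4 / r) ^+ 2 * rpw (r / 4) N <= 1 / 2 -> 0 < d -> e <= d / 2 -> e <= B ->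
  let T := \poly_(m < J.+1) Lcoef chi r N m in
  let Lf z := Defs.Lfun q chi ((1 + r)%:C + z) in
  (forall z, cabs z <= 3 * r -> cabs (Lf z - T.[z]) <= e) ->
  (forall z, cabs z <= 3 * r -> d <= cabs (Lf z) <= B) ->
  cabs ((Defs.Lfun q chi 1)^-1 - \sum_(m < n) Mcoef chi r N m * (- r)%:C ^+ m) <=
  2 * inv_const B * 2^-1 ^+ n + e * (2 / d ^+ 2) +
  inv_const B * (1 + 4 / r) ^+ 2 *
    (\sum_(m < n) \sum_(l < m.+1) r ^+ m * (2 * r)^-1 ^+ l * (2 / r) ^+ (m - l)) * rpw (r / 4) N.
Proof.
move=> N0 nJ B1 hN d0 ed eB T Lf hT hL.
have b0_gt0 : 0 < 1 + r^-1 by rewrite addr_gt0// invr_gt0.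
have B0 : 0 < B by lra.
have TE m : T`_m = if (m < J.+1)%N then Lcoef chi r N m else 0 by rewrite coef_poly.
(* The coefficients of index 0 multiply to nearly 1, and [Mcoef] is at most 1 + 1 / r, so T cannot
   be small at the centre. *)
have T0 : (2 * (1 + r^-1))^-1 <= cabs T`_0.
  rewrite TE /=.
  have := LMcoef_conv q0 chiP r0 0 N0; rewrite expr0 mul1r big_ord1 subnn eqxx => h.
  have {}h := le_trans h hN.
  have h2 := cabsB (Lcoef chi r N 0 * Mcoef chi r N 0) (Lcoef chi r N 0 * Mcoef chi r N 0 - 1).
  have E1 : Lcoef chi r N 0 * Mcoef chi r N 0 - (Lcoef chi r N 0 * Mcoef chi r N 0 - 1) = 1 by ring.
  rewrite E1 cabs1 cabsM in h2.
  have h3 : 1 / 2 <= cabs (Lcoef chi r N 0) * cabs (Mcoef chi r N 0) by lra.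
  have h4 : cabs (Lcoef chi r N 0) * cabs (Mcoef chi r N 0) <= cabs (Lcoef chi r N 0) * (1 + r^-1).
    by rewrite ler_wpM2l ?cabs_ge0 ?Mcoef0_le.
  have h5 := le_trans h3 h4.
  by rewrite -[leLHS]div1r ler_pdivrMr ?mulr_gt0//; lra.
have Tle z : cabs z <= 3 * r -> cabs T.[z] <= 2 * B.
  move=> hz; have h1 := hT _ hz; have /andP[_ h2] := hL _ hz.
  have := cabsB (Lf z) (Lf z - T.[z]); rewrite opprB addrC subrK => h3.
  by lra.
have Tge z : cabs z <= 3 * r -> d / 2 <= cabs T.[z].
  move=> hz; have h1 := hT _ hz; have /andP[h2 _] := hL _ hz.
  have := cabsD (Lf z - T.[z]) T.[z]; rewrite subrK => h3.
  by lra.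
have Tn0 z : cabs z <= 3 * r -> T.[z] != 0.
  move=> hz; rewrite -cabs_gt0; apply: lt_le_trans (Tge _ hz); lra.
pose M := ln (4 * B * (1 + r^-1)).
have eM : expR M = 4 * B * (1 + r^-1) by rewrite lnK// posrE !mulr_gt0.
have rho0 : 0 < 3 * r by rewrite mulr_gt0.
have Tup z : cabs z = 3 * r -> cabs T.[z] <= expR M * cabs T`_0.
  move=> hz; apply: le_trans (Tle _ _) _; first by rewrite hz.
  rewrite eM; apply: le_trans (_ : 4 * B * (1 + r^-1) * (2 * (1 + r^-1))^-1 <= _).
    by rewrite le_eqVlt; apply/orP; left; apply/eqP; field; rewrite gt_eqF//= gt_eqF//; lra.
  by rewrite ler_wpM2l// !mulr_ge0// ltW.
have [b bT bb] := poly_inverse_bound rho0 Tn0 Tup.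
pose K := inv_const B.
have K0 : 0 <= K.
  by rewrite /K /inv_const !mulr_ge0 ?exprn_ge0 ?mulr_ge0 ?(ltW b0_gt0)// ltW.
have bK m : cabs (b m) <= K * (2 * r)^-1 ^+ m.
  apply: le_trans (bb m) _.
  (* The reason for the radius 3 r: multiplied by r^m, these bounds decay like 2^-m. *)
  have -> : 3 / 2 / (3 * r) = (2 * r)^-1 by field; rewrite gt_eqF.
  have r20 : 0 <= (2 * r)^-1 by rewrite invr_ge0 mulr_ge0// ltW.
  apply: ler_wpM2r; first by rewrite exprn_ge0.
  have -> : 4 * M = M * 4%:R by rewrite mulrC.
  rewrite expRM_natr eM /K /inv_const; apply: ler_wpM2r.
    by rewrite exprn_ge0// !mulr_ge0// ltW.
  have b00 : 0 < 2 * (1 + r^-1) by rewrite mulr_gt0.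
  rewrite -[leRHS]invrK lef_pV2// posrE ?invr_gt0//.
  by apply: lt_le_trans T0; rewrite invr_gt0.
have xr : cabs (- r)%:C = r by rewrite cabs_real normrN gtr0_norm.
have x3 : cabs (- r)%:C <= 3 * r by rewrite xr; lra.
have hser m : cabs (b m) * cabs (- r)%:C ^+ m <= K * 2^-1 ^+ m.
  rewrite xr; apply: le_trans (_ : K * (2 * r)^-1 ^+ m * r ^+ m <= _).
    by apply: ler_wpM2r => //; rewrite exprn_ge0// ltW.
  rewrite -mulrA -exprMn ler_wpM2l// (_ : (2 * r)^-1 * r = 2^-1) //.
  by field; rewrite gt_eqF.
have S1 := poly_inverse_series n bT K0 (Tn0 _ x3) hser.
have L1E : Lf (- r)%:C = Defs.Lfun q chi 1.
  by rewrite /Lf -rmorphD (_ : 1 + r + - r = 1) ?rmorph1//; ring.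
have S2 : cabs ((Defs.Lfun q chi 1)^-1 - T.[(- r)%:C]^-1) <= e * (2 / d ^+ 2).
  have h1 := hT _ x3; have /andP[h2 _] := hL _ x3; have h3 := Tge _ x3; have h4 := Tn0 _ x3.
  rewrite L1E in h1 h2; set t := T.[_] in h1 h3 h4 *; set L := Defs.Lfun q chi 1 in h1 h2 *.
  have Ln0 : L != 0 by rewrite -cabs_gt0; lra.
  have -> : L^-1 - t^-1 = - (L - t) * (L^-1 * t^-1) by field; rewrite h4.
  rewrite cabsM cabsN; apply: ler_pM; rewrite ?cabs_ge0//.
  rewrite cabsM !cabsV (_ : 2 / d ^+ 2 = d^-1 * (d / 2)^-1); last by field; rewrite gt_eqF.
  have d20 : 0 < d / 2 by lra.
  by apply: ler_pM; rewrite ?invr_ge0 ?cabs_ge0// lef_pV2// posrE; lra.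
pose E m := \sum_(l < m.+1) Lcoef chi r N l * Mcoef chi r N (m - l) - (m == 0)%:R.
(* Uniqueness of formal inverses, with an error: the coefficient of degree m of the product of [Mp],
   [T] and [bp] is computed in two ways. *)
have MbE m : (m < n)%N -> Mcoef chi r N m - b m = \sum_(l < m.+1) b l * E (m - l)%N.
  move=> mn; pose bp := \poly_(m < n) b m; pose Mp := \poly_(m < n) Mcoef chi r N m.
  have c1 j : (j < n)%N -> (T * bp)`_j = (j == 0)%:R.
    move=> jn; rewrite coefM -bT; apply: eq_bigr => l _.
    by rewrite [bp`__]coef_poly (leq_ltn_trans (leq_subr _ _)).
  have c2 j : (j < n)%N -> (T * Mp)`_j = (j == 0)%:R + E j.
    move=> jn; rewrite coefM /E addrC subrK; apply: eq_bigr => l _.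
    rewrite [Mp`__]coef_poly (leq_ltn_trans (leq_subr _ _))// TE (_ : (l < J.+1)%N)//.
    by apply: leq_trans nJ; apply: leq_trans jn; rewrite ltnS -ltnS.
  have : (Mp * (T * bp))`_m = (bp * (T * Mp))`_m by rewrite mulrCA [in RHS]mulrCA [bp * _]mulrC.
  rewrite [LHS]coefM [RHS]coefM.
  rewrite [X in X = _](_ : _ = Mcoef chi r N m); last first.
    rewrite big_ord_recr /= subnn c1 ?(leq_ltn_trans _ mn)// eqxx mulr1 coef_poly mn.
    rewrite big1 ?add0r// => l _; rewrite c1 ?(leq_ltn_trans (leq_subr _ _))//.
    by rewrite subn_eq0 leqNgt ltn_ord mulr0.
  move=> ->.
  rewrite [X in X - _](_ : _ = \sum_(l < m.+1) (b l * ((m - l)%N == 0)%:R + b l * E (m - l)%N)); last first.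
    apply: eq_bigr => l _; rewrite c2 ?(leq_ltn_trans (leq_subr _ _))// coef_poly mulrDr.
    by rewrite (leq_trans (ltn_ord l)).
  rewrite big_split /= addrAC (_ : \sum_(l < m.+1) b l * _ = b m) ?subrr ?add0r//.
  rewrite big_ord_recr /= subnn eqxx mulr1 big1 ?add0r// => l _.
  by rewrite subn_eq0 leqNgt ltn_ord mulr0.
have S3 : cabs (\sum_(m < n) b m * (- r)%:C ^+ m - \sum_(m < n) Mcoef chi r N m * (- r)%:C ^+ m) <=
   K * (1 + 4 / r) ^+ 2 *
    (\sum_(m < n) \sum_(l < m.+1) r ^+ m * (2 * r)^-1 ^+ l * (2 / r) ^+ (m - l)) * rpw (r / 4) N.
  rewrite cabs_distC -sumrB; apply: le_trans (cabs_sum _ _ _) _.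
  rewrite -mulrA mulr_suml mulr_sumr; apply: ler_sum => m _.
  rewrite -mulrBl cabsM cabsX xr MbE//.
  apply: le_trans (ler_wpM2r _ (cabs_sum _ _ _)) _; first by rewrite exprn_ge0// ltW.
  rewrite !mulr_suml mulr_sumr; apply: ler_sum => l _; rewrite cabsM.
  have h1 := bK l; have h2 := LMcoef_conv q0 chiP r0 (m - l)%N N0.
  have rm : 0 <= r ^+ m by rewrite exprn_ge0// ltW.
  apply: le_trans (ler_wpM2r rm (ler_pM (cabs_ge0 _) (cabs_ge0 _) h1 h2)) _.
  by rewrite le_eqVlt; apply/orP; left; apply/eqP; ring.
set Y := \sum_(m < n) Mcoef _ _ _ _ * _ in S3 *.
set Z := \sum_(m < n) b m * _ in S1 S3.
have -> : (Defs.Lfun q chi 1)^-1 - Y = ((Defs.Lfun q chi 1)^-1 - T.[(- r)%:C]^-1) +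
   (T.[(- r)%:C]^-1 - Z) + (Z - Y) by ring.
apply: le_trans (cabsD _ _) _; apply: lerD S3; apply: le_trans (cabsD _ _) _.
by rewrite addrC; apply: lerD.
Qed.

(** Order of the choices: [d] by compactness, then the tolerance [e1], then the cut N, and last the
    degree, which depends on N. *)
Lemma inv_L1_approx n (B e : R) : 1 <= B -> 0 < e ->
  (forall z, csquare (3 * r) z -> Defs.Lfun q chi ((1 + r)%:C + z) != 0) ->
  (forall z, cabs z <= 3 * r -> cabs (Defs.Lfun q chi ((1 + r)%:C + z)) <= B) ->
  \forall N \near \oo,
    cabs ((Defs.Lfun q chi 1)^-1 - \sum_(m < n) Mcoef chi r N m * (- r)%:C ^+ m) <=
    2 * inv_const B * 2^-1 ^+ n + e.
Proof.
move=> B1 e0 Ln0 LB.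
have rho0 : 0 <= 3 * r by rewrite mulr_ge0// ltW.
have [d d0 dL] := csquare_inf rho0 Lfun_csquare_uc Ln0.
pose e1 := Num.min (Num.min (d / 2) 1) (e / 2 / (2 / d ^+ 2)).
have e10 : 0 < e1.
  by rewrite !lt_min ltr01 ?andbT !divr_gt0// exprn_gt0.
have [e1a e1b e1c] : [/\ e1 <= d / 2, e1 <= 1 & e1 <= e / 2 / (2 / d ^+ 2)].
  by split; rewrite /e1 !ge_min lexx ?orbT.
pose D := inv_const B * (1 + 4 / r) ^+ 2 *
    (\sum_(m < n) \sum_(l < m.+1) r ^+ m * (2 * r)^-1 ^+ l * (2 / r) ^+ (m - l)).
have r40 : 0 < r / 4 by rewrite divr_gt0.
near=> N.
have N0 : (0 < N)%N by near: N; exists 1%N.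
have h1 : (1 + 4 / r) ^+ 2 * rpw (r / 4) N <= 1 / 2.
  by near: N; apply: cvg0_near_le; [exact: (cvg0_Ml _ (rpw_cvg0 r40))|lra].
have h2 : D * rpw (r / 4) N <= e / 2.
  by near: N; apply: cvg0_near_le; [exact: (cvg0_Ml _ (rpw_cvg0 r40))|lra].
have h3 : 8 * q%:R * rpw (1 / 2) N <= e1 / 2.
  near: N; apply: cvg0_near_le; last by lra.
  by apply: (cvg0_Ml _ (rpw_cvg0 _)); lra.
have e12 : 0 < e1 / 2 by lra.
have [J0 _ hJ] := cvg0_near_le (cvg0_Ml (N%:R * (2 * expR (2 * ln N%:R))) (expr_fact_cvg0 (ln N%:R))) e12.
have {}hJ := hJ (maxn J0 n) (leq_maxl _ _).
have hT z : cabs z <= 3 * r -> cabs (Defs.Lfun q chi ((1 + r)%:C + z) -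
   (\poly_(m < (maxn J0 n).+1) Lcoef chi r N m).[z]) <= e1.
  move=> hz; have t1 := Lfun_tail_csquare N0 (cabs_csquare hz).
  have r8' := r8; have z1 : cabs z <= 1 by lra.
  have t2 := Lpart_taylor (maxn J0 n) N0 z1.
  set L := Defs.Lfun _ _ _ in t1 *; set P := Lpart _ _ _ in t1 t2 *; set t := _.[_] in t2 *.
  have -> : L - t = (L - P) + (P - t) by ring.
  by apply: le_trans (cabsD _ _) _; lra.
have hL z : cabs z <= 3 * r -> d <= cabs (Defs.Lfun q chi ((1 + r)%:C + z)) <= B.
  by move=> hz; rewrite LB// dL//; exact: cabs_csquare.
have nJ : (n <= (maxn J0 n).+1)%N by rewrite leqW// leq_maxr.
apply: le_trans (Mcoef_series N0 nJ B1 h1 d0 e1a (le_trans e1b B1) hT hL) _.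
rewrite -/D -addrA lerD2l.
have : e1 * (2 / d ^+ 2) <= e / 2 by rewrite -ler_pdivlMr// divr_gt0// exprn_gt0.
by lra.
Unshelve. all: by end_near. Qed.

End InverseAtOne.

(** * Orthogonality of characters and conductors *)

Section DirichletGroup.
Variable R : realType.
Implicit Types (Q : nat) (a b : int) (chi : int -> R[i]).

Lemma euler_int Q a : (0 < Q)%N -> coprimez a Q%:Z -> (Q%:Z %| a ^+ totient Q - 1)%Z.
Proof.
move=> Q0 ca; rewrite -eqz_mod_dvd -modzXm.
have [n [nE]] : exists n : nat, (a %% Q%:Z)%Z = n%:Z /\ (0 <= n)%N.
  have := modz_ge0 a (_ : Q%:Z != 0); rewrite -lt0n => /(_ Q0).
  by case: (a %% Q)%Z => // n _; exists n.
move: ca; rewrite /coprimez -gcdz_modl nE -/(coprimez _ _) coprimezE /= => cn _.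
by rewrite -rmorphXn /= !modz_nat eqz_nat Euler_exp_totient.
Qed.

Definition dchars Q : seq (int -> R[i]) :=
  finmap.enum_fset (fset_set (@dirichlet_character R Q)).

(** A character is determined by its values on residues, each 0 or a power of a fixed primitive root
    of unity of order [totient Q]; the index [ord_max] encodes the value 0. *)
Lemma dchars_finite Q : (0 < Q)%N -> finite_set (@dirichlet_character R Q).
Proof.
move=> Q0; have n0 : (0 < totient Q)%N by rewrite totient_gt0.
set n := totient Q in n0; have [w wP] := @prim_root_exists R n n0.
have [Q' QE] : exists Q', Q = Q'.+1 by case: Q Q0 {n n0 wP} => // Q' _; exists Q'.
pose g (f : {ffun 'I_Q'.+1 -> 'I_n.+1}) (a : int) : R[i] :=
  if f (inord `|(a %% Q%:Z)%Z|%N) == ord_max then 0 else w ^+ f (inord `|(a %% Q%:Z)%Z|%N).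
apply: (@sub_finite_set _ _ (g @` setT)); last by apply: finite_image; exact: finite_finset.
move=> chi chiP.
have h (i : 'I_Q'.+1) : exists j : 'I_n.+1, chi i%:Z = if j == ord_max then 0 else w ^+ j.
  have [ci|ci] := boolP (coprimez i%:Z Q%:Z); last first.
    by exists ord_max; rewrite eqxx (dc_eq0 chiP).
  have : chi i%:Z ^+ n = 1.
    rewrite -(dcX chiP); have := euler_int Q0 ci; rewrite -/n => /dvdzP[k kE].
    by rewrite -[_ ^+ n](subrK 1) kE addrC (dc_perM chiP) (dc1 chiP).
  move=> /(prim_rootP wP)[j jE]; exists (widen_ord (leqnSn _) j).
  by rewrite -val_eqE /= ltn_eqF.
have [f fE] := choice h; exists (finfun f) => //.
apply/funext => a; have [m mQ [-> am]] := dc_natmod Q0 chiP a.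
rewrite /g am modz_nat absz_nat (modn_small mQ) !ffunE -fE inordK//.
by rewrite -QE.
Qed.

Lemma mem_dchars Q chi : (0 < Q)%N -> chi \in dchars Q <-> dirichlet_character Q chi.
Proof.
move=> Q0; rewrite /dchars in_fset_set; last exact: dchars_finite.
by rewrite inE.
Qed.

Lemma dchars_uniq Q : uniq (dchars Q). Proof. exact: finmap.fset_uniq. Qed.

(** Multiplication by units on the residues modulo Q gives commuting matrices of finite order, hence
    simultaneously diagonalizable, and each diagonal entry is a character. If all of them were 1 at
    [a], the matrix of [a] would be the identity and [a] congruent to 1. *)
Lemma dchars_sep Q a : (0 < Q)%N -> coprimez a Q%:Z -> ~~ (Q%:Z %| a - 1)%Z ->
  exists2 chi : int -> R[i], dirichlet_character Q chi & chi a != 1.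
Proof.
move=> Q0 ca a1; have [n QE] : exists n, Q = n.+1 by case: Q Q0 {ca a1} => // n _; exists n.
pose ok (x y : int) := (Q%:Z %| x - y)%Z.
have okE x y : ok x y = (x == y %[mod Q%:Z])%Z by rewrite /ok -eqz_mod_dvd.
pose M b : 'M[R[i]]_n.+1 := \matrix_(i, j) (ok (b * i%:Z) j%:Z)%:R.
have res x : exists j : 'I_n.+1, ok x j%:Z.
  have h := modz_ge0 x (_ : Q%:Z != 0); rewrite -lt0n in h; have {}h := h Q0.
  have h2 : (`|(x %% Q%:Z)%Z| < n.+1)%N.
    by rewrite -ltz_nat gez0_abs// -QE ltz_pmod// ltz_nat.
  by exists (Ordinal h2); rewrite okE /= gez0_abs// modz_mod.
have resu (i j : 'I_n.+1) : ok i%:Z j%:Z -> i = j.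
  by rewrite okE !modz_nat eqz_nat !modn_small ?QE// => /eqP h; apply: val_inj.
have okS x y : ok x y = ok y x by rewrite !okE eq_sym.
have okT x y z : ok x y -> ok y z = ok x z by rewrite !okE => /eqP ->.
have okM b x y : ok x y -> ok (b * x) (b * y).
  by rewrite !okE => /eqP h; rewrite -modzMmr h modzMmr.
have MM b c : M b *m M c = M (b * c).
  apply/matrixP => i k; rewrite !mxE; have [j0 hj0] := res (b * i%:Z).
  rewrite (bigD1 j0)//= !mxE hj0 mul1r big1 ?addr0 => [|j jj0]; last first.
    rewrite !mxE; case: (boolP (ok _ _)) => [h|_]; last by rewrite mul0r.
    by case/eqP: jj0; apply: resu; rewrite (okT _ _ _ h).
  congr (_%:R); congr nat_of_bool; rewrite [b * c]mulrC -mulrA.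
  by rewrite (okT _ _ k%:Z (okM c _ _ hj0)) //; rewrite okS.
have M1 : M 1 = 1%:M.
  apply/matrixP => i j; rewrite !mxE mul1r; congr (_%:R); congr nat_of_bool.
  apply/idP/eqP => [/resu//|->]; by rewrite okE.
have Mok b c : ok b c -> M b = M c.
  move=> h; apply/matrixP => i j; rewrite !mxE; congr (_%:R); congr nat_of_bool.
  by apply: okT; rewrite okS ![_ * i%:Z]mulrC; apply: okM.
have MX b k : (M b) ^+ k = M (b ^+ k).
  by elim: k => [|k IH]; rewrite ?expr0 ?M1// !exprS IH -MM.
have Mphi b : coprimez b Q%:Z -> M (b ^+ totient Q) = 1%:M.
  by move=> cb; rewrite -M1; apply: Mok; exact: euler_int.
pose As := [seq M i%:Z | i <- iota 0 Q & coprimez i%:Z Q%:Z].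
have AsP b : coprimez b Q%:Z -> M b \in As.
  move=> cb; have [j hj] := res b; rewrite (Mok _ _ hj); apply/mapP; exists (j : nat) => //.
  rewrite mem_filter mem_iota /= add0n [X in (_ < X)%N]QE ltn_ord andbT.
  by move: cb; rewrite /coprimez -gcdz_modl; move: hj; rewrite okE => /eqP ->; rewrite gcdz_modl.
have n0 : (0 < totient Q)%N by rewrite totient_gt0.
have [w wP] := @prim_root_exists R _ n0.
(* Each matrix is annihilated by X^n - 1 with n = [totient Q], which has distinct roots. *)
have [P Pu Pd] : codiagonalizable As.
  apply/codiagonalizableP; split.
    by move=> _ _ /mapP[b _ ->] /mapP[c _ ->]; rewrite /comm_mx !MM mulrC.
  move=> _ /mapP[b hb ->]; apply/diagonalizableP.
  exists [seq w ^+ i | i <- index_iota 0 (totient Q)].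
    rewrite map_inj_in_uniq ?iota_uniq// => i j; rewrite !mem_index_iota /= => ib jb /eqP.
    by rewrite (eq_prim_root_expr wP) !modn_small// => /eqP.
  rewrite big_map (factor_Xn_sub_1 wP); apply: mxminpoly_min.
  rewrite rmorphB rmorphXn /= horner_mx_X rmorph1 MX Mphi ?subrr//.
  by move: hb; rewrite mem_filter => /andP[].
pose e b i := (P *m M b *m invmx P) i i.
have eD b : coprimez b Q%:Z -> P *m M b *m invmx P = diag_mx (\row_i e b i).
  move=> cb; have /allP/(_ _ (AsP _ cb))/= := Pd.
  move=> /(diagonalizable_forPex)[D] /(simmxP Pu) h.
  have E : P *m M b *m invmx P = diag_mx D by rewrite h mulmxK.
  rewrite /e E; apply/matrixP => i j; rewrite !mxE; case: eqP => [->|]; rewrite ?mulr0n//.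
  by rewrite mulr1n eqxx.
have eM b c i : coprimez b Q%:Z -> coprimez c Q%:Z -> e (b * c) i = e b i * e c i.
  move=> cb cc; rewrite /e -MM.
  have -> : P *m (M b *m M c) *m invmx P = (P *m M b *m invmx P) *m (P *m M c *m invmx P).
    by rewrite !mulmxA mulmxKV.
  rewrite (eD _ cb) (eD _ cc) mulmx_diag; move: (e b) (e c) => f g.
  by rewrite !mxE eqxx !mulr1n.
have e1 i : e 1 i = 1.
  have h : P *m M 1 *m invmx P = 1%:M by rewrite M1 mulmx1 mulmxV.
  by rewrite /e h mxE eqxx.
have [i hi] : exists i, e a i != 1.
  apply: contrapT => h; have e1a i : e a i = 1.
    by apply/eqP; apply: contrapT => /negP hi; apply: h; exists i.
  have Ma : M a = 1%:M.
    have : P *m M a *m invmx P = 1%:M.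
      by rewrite eD//; apply/matrixP => i j; rewrite !mxE e1a.
    move=> /(congr1 (fun X => invmx P *m X *m P)).
    by rewrite mulmx1 mulVmx// !mulmxA mulVmx// mul1mx mulmxKV.
  have [j hj] := res 1; case/negP: a1; rewrite -/(ok a 1).
  have : M a j j = 1 by rewrite Ma mxE eqxx.
  rewrite mxE; case: (boolP (ok _ _)) => [h2 _|_ /eqP]; last by rewrite eq_sym oner_eq0.
  have h3 := okM a _ _ hj; rewrite mulr1 in h3.
  by rewrite (okT _ _ _ h3) in h2; rewrite okS -(okT _ _ _ hj) okS.
have coM b c : coprimez (b * c) Q%:Z = coprimez b Q%:Z && coprimez c Q%:Z by rewrite coprimezMl.
have cX b k : coprimez b Q%:Z -> coprimez (b ^+ k) Q%:Z.
  by move=> cb; elim: k => [|k IH]; rewrite ?expr0 /coprimez ?gcd1z// exprS -/(coprimez _ _) coM cb.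
exists (fun b => if coprimez b Q%:Z then e b i else 0); last by rewrite ca.
split => [b|b c|b].
- have -> : coprimez (b + Q%:Z) Q%:Z = coprimez b Q%:Z by rewrite /coprimez -gcdz_modl modzDr gcdz_modl.
  by rewrite /e (Mok (b + Q%:Z) b)// /ok addrAC subrr add0r.
- rewrite coM; case: (boolP (coprimez b _)) => cb; rewrite ?mul0r//=.
  by case: (boolP (coprimez c _)) => cc; rewrite ?mulr0// eM.
case: ifP => [cb|_]; last by rewrite eqxx.
apply/eqP => e0; have /eqP : e (b ^+ totient Q) i = 1 by rewrite /e (Mphi _ cb) -M1; exact: e1.
by rewrite -(prednK n0) exprS eM ?cX// e0 mul0r eq_sym oner_eq0.
Qed.

Lemma dc_closedM Q chi psi : dirichlet_character Q chi -> dirichlet_character Q psi ->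
  dirichlet_character Q (fun a => chi a * psi a).
Proof.
move=> [p1 m1 z1] [p2 m2 z2]; split => [a|a b|a]; first by rewrite p1 p2.
- by rewrite m1 m2 mulrACA.
by rewrite mulf_eq0 negb_or z1 z2 andbb.
Qed.

Lemma sum_dchars_eq0 Q a : (0 < Q)%N -> coprimez a Q%:Z -> ~~ (Q%:Z %| a - 1)%Z ->
  \sum_(chi <- dchars Q) chi a = 0.
Proof.
move=> Q0 ca a1; have [psi psiP psia] := dchars_sep Q0 ca a1.
pose f chi : int -> R[i] := fun b => psi b * chi b.
have finj : {in dchars Q &, injective f}.
  move=> c1 c2 /(mem_dchars _ Q0) h1 /(mem_dchars _ Q0) h2 E; apply/funext => b.
  have [cb|cb] := boolP (coprimez b Q%:Z); last by rewrite (dc_eq0 h1)// (dc_eq0 h2).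
  have := congr1 (fun g => g b) E; rewrite /f; apply: mulfI.
  by rewrite (dc_neq0 psiP).
have sub : {subset map f (dchars Q) <= dchars Q}.
  move=> _ /mapP[c /(mem_dchars _ Q0) h ->]; apply/(mem_dchars _ Q0).
  exact: dc_closedM.
have um : uniq (map f (dchars Q)) by rewrite map_inj_in_uniq ?dchars_uniq.
have pe : perm_eq (map f (dchars Q)) (dchars Q).
  apply: uniq_perm; rewrite ?dchars_uniq//.
  by apply: (uniq_min_size um sub _).2; rewrite size_map.
have E : psi a * \sum_(chi <- dchars Q) chi a = \sum_(chi <- dchars Q) chi a.
  by rewrite -[RHS](perm_big _ pe) /= big_map mulr_sumr.
have : (psi a - 1) * \sum_(chi <- dchars Q) chi a = 0 by rewrite mulrBl mul1r E subrr.
by move=> /eqP; rewrite mulf_eq0 subr_eq0 (negbTE psia) => /eqP.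
Qed.

Lemma dc_congr Q chi a b : dirichlet_character Q chi -> (Q%:Z %| a - b)%Z -> chi a = chi b.
Proof. by move=> chiP /dvdzP[k kE]; rewrite -[a](subrK b) kE addrC (dc_perM chiP). Qed.

Lemma principal_dc Q : dirichlet_character Q (@principal_character R Q).
Proof.
split => [a|a b|a]; rewrite /principal_character.
- by rewrite /coprimez -gcdz_modl modzDr gcdz_modl.
- by rewrite coprimezMl; case: coprimez; case: coprimez; rewrite ?mul0r ?mul1r ?mulr0.
by case: coprimez; rewrite ?oner_eq0 ?eqxx.
Qed.

(** The double sum of chi(n) is counted in two ways: summing over chi only the class of 1 survives,
    summing over n only the principal character. *)
Lemma size_dchars Q : (0 < Q)%N -> size (dchars Q) = totient Q.
Proof.
move=> Q0; pose S : R[i] := \sum_(0 <= n < Q) \sum_(chi <- dchars Q) chi n%:Z.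
have S1 : S = (size (dchars Q))%:R.
  rewrite /S big_mkord.
  (* The residue of 1 is taken modulo Q in order to include Q = 1. *)
  pose i0 : 'I_Q := Ordinal (ltn_pmod 1 Q0).
  have ii (i : 'I_Q) : (Q%:Z %| i%:Z - 1)%Z -> i = i0.
    rewrite -eqz_mod_dvd (_ : 1 = 1%N%:Z)// !modz_nat eqz_nat => /eqP h.
    by apply: val_inj => /=; rewrite -h modn_small.
  rewrite (bigD1 i0)//= [X in _ + X]big1 ?addr0 => [|i ii0]; last first.
    have [ci|ci] := boolP (coprimez i%:Z Q%:Z).
      by apply: sum_dchars_eq0 => //; apply: contra ii0 => /ii ->.
    by rewrite big_seq big1// => chi /(mem_dchars _ Q0) h; rewrite (dc_eq0 h).
  rewrite -sum1_size natr_sum big_seq [RHS]big_seq; apply: eq_bigr => chi /(mem_dchars _ Q0) h.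
  by rewrite -(dc_modn h 1) (dc1 h).
have S2 : S = (totient Q)%:R.
  rewrite /S exchange_big /=.
  rewrite (bigD1_seq (@principal_character R Q)) ?dchars_uniq//=; last first.
    by apply/(mem_dchars _ Q0); exact: principal_dc.
  rewrite [X in _ + X]big1_seq ?addr0 => [|chi /andP[/eqP hn /(mem_dchars _ Q0) h]]; last first.
    exact: (dc_sum0 Q0 h hn).
  rewrite totient_count_coprime natr_sum big_mkord [RHS]big_mkord; apply: eq_bigr => i _.
  by rewrite /principal_character coprimezE /= coprime_sym.
have /eqP : (size (dchars Q))%:R = (totient Q)%:R :> R[i] by rewrite -S1 S2.
by rewrite eqr_nat => /eqP.
Qed.

Lemma sum_dchars Q a : (0 < Q)%N -> coprimez a Q%:Z ->
  \sum_(chi <- dchars Q) chi a = (Q%:Z %| a - 1)%Z%:R * (totient Q)%:R.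
Proof.
move=> Q0 ca; case: (boolP (Q%:Z %| a - 1)%Z) => h; last by rewrite mul0r sum_dchars_eq0.
rewrite mul1r -(size_dchars Q0) -sum1_size natr_sum big_seq [RHS]big_seq.
by apply: eq_bigr => chi /(mem_dchars _ Q0) hc; rewrite (dc_congr hc h) (dc1 hc).
Qed.

Lemma sum_dchars_conj Q a b : (0 < Q)%N ->
  \sum_(chi <- dchars Q) chi a * conjc (chi b) =
  [&& coprimez a Q%:Z, coprimez b Q%:Z & (Q%:Z %| a - b)%Z]%:R * (totient Q)%:R.
Proof.
move=> Q0; have [ca|ca] /= := boolP (coprimez a Q%:Z); last first.
  by rewrite mul0r big_seq big1// => chi /(mem_dchars _ Q0) h; rewrite (dc_eq0 h)// mul0r.
have [cb|cb] /= := boolP (coprimez b Q%:Z); last first.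
  rewrite mul0r big_seq big1// => chi /(mem_dchars _ Q0) h.
  by rewrite (dc_eq0 h cb) conjc0 mulr0.
pose b' := b ^+ (totient Q).-1.
have bb : (Q%:Z %| b * b' - 1)%Z.
  by rewrite /b' -exprS prednK ?totient_gt0//; exact: euler_int.
have cb' : coprimez b' Q%:Z.
  rewrite /b'; elim: _.-1 => [|k IH]; first by rewrite expr0 /coprimez gcd1z.
  by rewrite exprS coprimezMl cb IH.
have E chi : dirichlet_character Q chi -> chi a * conjc (chi b) = chi (a * b').
  move=> h; rewrite (dcM h); congr (_ * _).
  have b0 : chi b != 0 by rewrite (dc_neq0 h).
  apply: (mulfI b0); rewrite -(dcM h) (dc_congr h bb) (dc1 h) -sqr_cabsC.
  by rewrite (dc_cabs1 Q0 h cb) expr1n.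
rewrite big_seq (eq_bigr (fun chi => chi (a * b'))) => [|chi /(mem_dchars _ Q0)]; last exact: E.
rewrite -big_seq sum_dchars//; last by rewrite coprimezMl ca.
congr (_%:R * _); congr nat_of_bool; rewrite -!eqz_mod_dvd.
rewrite -eqz_mod_dvd in bb.
apply/eqP/eqP => h.
  rewrite -[a]mulr1 -modzMmr -(eqP bb) modzMmr mulrA [a * b]mulrC -mulrA -modzMmr h modzMmr.
  by rewrite mulr1.
by rewrite -modzMml h modzMml; exact/eqP.
Qed.

Lemma dc_m1 Q chi : dirichlet_character Q chi -> chi (-1) = 1 \/ chi (-1) = -1.
Proof.
move=> h; have : chi (-1) ^+ 2 == 1 by rewrite -(dcX h) sqrrN expr1n (dc1 h).
by rewrite sqrf_eq1 => /orP[/eqP|/eqP]; [left|right].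
Qed.

(** The factor (1 + chi(-1)) / 2 selects the even characters; it adds to the congruence of a and b
    that of -a and b. *)
Lemma sum_even_conj Q a b : (0 < Q)%N -> coprimez a Q%:Z -> coprimez b Q%:Z ->
  \sum_(chi <- dchars Q | chi (-1) == 1) chi a * conjc (chi b) =
  ((Q%:Z %| a - b)%Z%:R + (Q%:Z %| a + b)%Z%:R) * (totient Q)%:R / 2.
Proof.
move=> Q0 ca cb.
have cNa : coprimez (- a) Q%:Z by rewrite /coprimez gcdNz.
transitivity (\sum_(chi <- dchars Q) (chi a * conjc (chi b) + chi (- a) * conjc (chi b)) / 2).
  rewrite big_mkcond big_seq [RHS]big_seq; apply: eq_bigr => chi /(mem_dchars _ Q0) h.
  rewrite -[- a]mulN1r (dcM h); case: (dc_m1 h) => ->.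
    by rewrite eqxx mul1r; field.
  have -> : (-1 == 1 :> R[i]) = false.
    by apply/negbTE; rewrite eq_sym -subr_eq0 opprK -(natrD _ 1 1) pnatr_eq0.
  by rewrite mulN1r mulNr subrr mul0r.
rewrite -mulr_suml big_split /= !sum_dchars_conj// ca cb cNa /= -mulrDl.
by congr (_ * _ * _); congr (_ + _%:R); congr nat_of_bool; rewrite -opprD !dvdzE abszN.
Qed.

Lemma mean_square_even Q N (c : nat -> R) : (0 < Q)%N ->
  \sum_(chi <- dchars Q | chi (-1) == 1)
     cabs (\sum_(1 <= k < N.+1) (c k)%:C * chi k%:Z) ^+ 2 =
  (totient Q)%:R / 2 * \sum_(1 <= m < N.+1 | coprime m Q) \sum_(1 <= n < N.+1 | coprime n Q)
     c m * c n * ((Q%:Z %| m%:Z - n%:Z)%Z%:R + (Q %| m + n)%N%:R).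
Proof.
move=> Q0; apply: (fmorph_inj (real_complex R)); rewrite /= [LHS]rmorph_sum /=.
under eq_bigr do rewrite sqr_cabsC rmorph_sum /= mulr_suml.
rewrite exchange_big /= rmorphM /= rmorph_sum mulr_sumr [RHS]big_mkcond /=.
apply: eq_bigr => m _.
have cz k : coprimez k%:Z Q%:Z = coprime k Q by rewrite coprimezE.
case: ifP => cm; last first.
  rewrite big_seq_cond big1// => chi /andP[/(mem_dchars _ Q0) h _].
  by rewrite (dc_eq0 h) ?cz ?cm// mulr0 mul0r.
under eq_bigr do rewrite mulr_sumr.
rewrite exchange_big /= rmorph_sum mulr_sumr [RHS]big_mkcond /=.
apply: eq_bigr => n _; case: ifP => cn; last first.
  rewrite big_seq_cond big1// => chi /andP[/(mem_dchars _ Q0) h _].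
  by rewrite rmorphM /= [X in conjc X](dc_eq0 h) ?cz ?cn// conjc0 !mulr0.
transitivity ((c m * c n)%:C * \sum_(chi <- dchars Q | chi (-1) == 1) chi m%:Z * conjc (chi n%:Z)).
  rewrite mulr_sumr; apply: eq_bigr => chi _.
  have cr (x : R) : conjc x%:C = x%:C by rewrite /conjc /= oppr0.
  have cM (z w : R[i]) : conjc (z * w) = conjc z * conjc w by exact: rmorphM.
  by rewrite cM cr [(c m * c n)%:C]rmorphM; ring.
rewrite sum_even_conj ?cz// !rmorphM rmorphD !rmorph_nat fmorphV rmorph_nat.
by rewrite -PoszD; ring.
Qed.

End DirichletGroup.

(** * Conductors of characters modulo a prime power *)

Section ConductorWeights.
Variable R : realType.
Variables (p : nat).
Hypothesis pp : prime p.
Implicit Types (i j k d : nat) (a : int) (chi : int -> R[i]).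

Let p_gt0 : (0 < p)%N := prime_gt0 pp.

Lemma coprimez_pfactor j a : (0 < j)%N -> coprimez a (p ^ j)%:Z = coprimez a p%:Z.
Proof. by move=> j0; rewrite !coprimezE /= coprime_pexpr. Qed.

Lemma dc_pfactor_leq i j chi : (0 < i)%N -> (i <= j)%N ->
  dirichlet_character (p ^ i) chi -> dirichlet_character (p ^ j) chi.
Proof.
move=> i0 ij h; split => [a|a b|a].
- by rewrite -(subnK ij) expnD PoszM (dc_perM h).
- exact: (dcM h).
by rewrite (dc_neq0 h) !coprimez_pfactor// (leq_trans i0).
Qed.

Lemma principal_pfactor i j : (0 < i)%N -> (0 < j)%N ->
  @principal_character R (p ^ i) = principal_character R (p ^ j).
Proof.
by move=> i0 j0; apply/funext => a; rewrite /principal_character !coprimez_pfactor.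
Qed.

(** Coprimality to p^i does not depend on i >= 1, so the inducing character is [chi] itself; i = 0
    would make [chi] principal. *)
Lemma factors_through_pfactor k chi d : (0 < k)%N -> dirichlet_character (p ^ k) chi ->
  chi <> @principal_character R (p ^ k) ->
  factors_through (p ^ k) chi d ->
  exists i, [/\ (0 < i)%N, (i <= k)%N, d = (p ^ i)%N & dirichlet_character (p ^ i) chi].
Proof.
move=> k0 chiP np [/(dvdn_pfactor d k pp)[i ik ->] [psi psiP chipsi]].
exists i; case: i ik psiP => [|i] ik psiP.
  case: np; apply/funext => a; rewrite /principal_character.
  have [ca|ca] := boolP (coprimez a (p ^ k)%:Z); last by rewrite (dc_eq0 chiP).
  by rewrite chipsi// (dc_mod psiP) modz1 -(modz1 1) -(dc_mod psiP) (dc1 psiP).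
split => //; rewrite (_ : chi = psi)//; apply/funext => a.
have [ca|ca] := boolP (coprimez a (p ^ k)%:Z); first exact: chipsi.
rewrite (dc_eq0 chiP)// (dc_eq0 psiP)//.
by rewrite coprimez_pfactor// in ca; rewrite coprimez_pfactor.
Qed.

Definition cond_weight k j : R :=
  if j == k then (p%:R ^+ k)^-1 else (p%:R ^+ j)^-1 * (1 - p%:R^-1).

Lemma sum_cond_weight k i : (i <= k)%N ->
  \sum_(i <= j < k.+1) cond_weight k j = (p%:R ^+ i)^-1.
Proof.
move=> ik; rewrite big_nat_recr//= {2}/cond_weight eqxx.
rewrite [X in X + _](_ : _ = \sum_(i <= j < k) ((p%:R ^+ j)^-1 - (p%:R ^+ j.+1)^-1)); last first.
  rewrite !big_nat; apply: eq_bigr => j /andP[_ jk]; rewrite /cond_weight ltn_eqF//.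
  by rewrite mulrBr mulr1 -invfM -exprSr.
rewrite -(opprK (\sum_(_ <= _ < _) _)) -sumrN.
under eq_bigr do rewrite opprB.
by rewrite telescope_sumr// opprB subrK.
Qed.

Lemma cond_weight_ge0 k j : 0 <= cond_weight k j.
Proof.
have p1 : (p%:R^-1 : R) <= 1 by rewrite invf_le1 ?ler1n ?ltr0n.
by rewrite /cond_weight; case: eqP => _; rewrite ?mulr_ge0 ?invr_ge0 ?exprn_ge0 ?subr_ge0.
Qed.

(* The weights telescope: [v_k + \sum_(i <= j < k) v_j = p^-i]. *)
Lemma conductor_weight k chi : (0 < k)%N -> dirichlet_character (p ^ k) chi ->
  chi <> @principal_character R (p ^ k) ->
  ((conductor (p ^ k) chi)%:R)^-1 =
  \sum_(1 <= j < k.+1 | chi \in dchars R (p ^ j)) cond_weight k j.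
Proof.
move=> k0 chiP np.
have pj j : (0 < p ^ j)%N by rewrite expn_gt0 p_gt0.
have full i : (0 < i)%N -> (i <= k)%N -> dirichlet_character (p ^ i) chi ->
    factors_through (p ^ k) chi (p ^ i).
  by move=> i0 ik h; split; [exact: dvdn_exp2l|exists chi].
rewrite /conductor; case: arg_minnP => [|d /asboolP dft dmin].
  by apply/asboolP; exact: full.
have [i [i0 ik dE chii]] := factors_through_pfactor k0 chiP np dft.
rewrite dE natrX -(sum_cond_weight ik) [RHS](big_cat_nat (n := i)) //=; last exact: leqW.
rewrite [X in X + _]big_nat_cond [X in X + _]big_pred0 ?add0r => [|j]; last first.
  apply/negbTE/negP => /andP[/andP[j0 ji] /mem_dchars hj].
  have jk : (j <= k)%N by rewrite (leq_trans (ltnW ji)).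
  have h := full j j0 jk (hj (pj j)).
  have pjk : (p ^ j < (p ^ k).+1)%N by rewrite ltnS leq_pexp2l.
  have := dmin (Ordinal pjk); rewrite asboolT// => /(_ isT) /=.
  by rewrite dE leq_exp2l ?prime_gt1// leqNgt ji.
rewrite big_nat_cond [RHS]big_nat_cond; apply: eq_bigl => j.
have [/andP[ij jk]|//] := boolP (i <= j < k.+1)%N.
by rewrite /=; apply/esym/mem_dchars => //; exact: dc_pfactor_leq chii.
Qed.

(** Excluding the principal character modulo p^k is right at every level j >= 1, by
    [principal_pfactor]. *)
Definition inv_mean_square k j : R :=
  \sum_(chi <- dchars R (p ^ j) | (chi (-1) == 1) && (chi != principal_character R (p ^ k)))
    (cabs (Defs.Lfun (p ^ k) chi 1) ^+ 2)^-1.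

Lemma Lsum_weights k : (0 < k)%N ->
  Lsum R (p ^ k) = \sum_(1 <= j < k.+1) cond_weight k j * inv_mean_square k j.
Proof.
move=> k0; have pj j : (0 < p ^ j)%N by rewrite expn_gt0 p_gt0.
pose P chi := (chi (-1) == 1) && (chi != @principal_character R (p ^ k)).
have -> : Lsum R (p ^ k) = \sum_(chi <- dchars R (p ^ k) | P chi)
    ((conductor (p ^ k) chi)%:R * cabs (Defs.Lfun (p ^ k) chi 1) ^+ 2)^-1.
  rewrite -big_filter fsbig_seq ?filter_uniq ?dchars_uniq// /Lsum.
  congr (\big[_/_]_(_ \in _) _); apply/seteqP; split => chi /=.
    move=> [h /eqP np /eqP ev]; rewrite mem_filter /P ev np /=.
    by apply/mem_dchars.
  by rewrite mem_filter => /andP[/andP[/eqP ev /eqP np] /mem_dchars h]; split => //; exact: h.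
transitivity (\sum_(chi <- dchars R (p ^ k) | P chi) \sum_(1 <= j < k.+1)
    cond_weight k j * ((chi \in dchars R (p ^ j))%:R * (cabs (Defs.Lfun (p ^ k) chi 1) ^+ 2)^-1)).
  rewrite big_seq_cond [RHS]big_seq_cond; apply: eq_bigr => chi /andP[/mem_dchars h /andP[_ /eqP np]].
  rewrite invfM (conductor_weight k0 (h (pj k)) np) big_mkcond mulr_suml; apply: eq_bigr => j _.
  by case: ifP => _; rewrite ?mul0r ?mulr0// mul1r.
rewrite exchange_big /= !big_nat; apply: eq_bigr => j /andP[j0 jk].
rewrite -mulr_sumr; congr (_ * _); rewrite /inv_mean_square.
have pe : perm_eq [seq chi <- dchars R (p ^ k) | chi \in dchars R (p ^ j)] (dchars R (p ^ j)).
  apply: uniq_perm; rewrite ?filter_uniq ?dchars_uniq// => chi.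
  rewrite mem_filter; case: (boolP (chi \in dchars R (p ^ j))) => //= /mem_dchars h.
  apply/mem_dchars => //; apply: (dc_pfactor_leq j0 _ (h (pj j))).
  by rewrite -ltnS.
rewrite -(perm_big _ pe) /= big_filter_cond /= big_mkcond [RHS]big_mkcond.
apply: eq_bigr => chi _; rewrite -/(P chi).
by case: (P chi); case: (_ \in _); rewrite ?mul0r ?mul1r.
Qed.

End ConductorWeights.

(** * The smoothed sums *)

Section SmoothWeight.
Variable R : realType.
Implicit Types (k m n N q : nat) (r d : R).

(* The factor [k^-r \sum_(m < n) (r ln k)^m / m!] left by [n] Taylor terms of
   [k^-(1 + z)] about [z = r], evaluated at [z = 0]: unlike its limit [1], it makes
   [\sum_k smooth n r k / k] converge. *)
Definition smooth n r k : R := rpw r k * \sum_(m < n) (r * ln k%:R) ^+ m / m`!%:R.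

Lemma psum_exp_le (y : R) n : 0 <= y -> \sum_(m < n) y ^+ m / m`!%:R <= expR y.
Proof.
move=> y0; rewrite /expR; have h : cvgn (series (exp_coeff y)) by exact: is_cvg_series_exp_coeff.
have -> : \sum_(m < n) y ^+ m / m`!%:R = series (exp_coeff y) n.
  by rewrite /series /= big_mkord; apply: eq_bigr.
apply: nondecreasing_cvgn_le => //; apply/nondecreasing_seqP => j.
by rewrite /series /= big_nat_recr//= lerDl divr_ge0 ?exprn_ge0.
Qed.

Lemma smooth_ge0 n r k : 0 <= r -> 0 <= smooth n r k.
Proof.
move=> r0; rewrite mulr_ge0 ?rpw_ge0//; apply: sumr_ge0 => m _.
by rewrite divr_ge0 ?exprn_ge0 ?mulr_ge0 ?ln_nat_ge0.
Qed.

Lemma smooth_ge n r k : 0 <= r -> (0 < n)%N -> rpw r k <= smooth n r k.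
Proof.
move=> r0; case: n => // n _; rewrite /smooth ler_peMr ?rpw_ge0// big_ord_recl expr0 fact0 divr1.
rewrite lerDl; apply: sumr_ge0 => m _.
by rewrite divr_ge0 ?exprn_ge0 ?mulr_ge0 ?ln_nat_ge0.
Qed.

Lemma smooth_le1 n r k : 0 <= r -> smooth n r k <= 1.
Proof.
move=> r0; have y0 : 0 <= r * ln k%:R by rewrite mulr_ge0 ?ln_nat_ge0.
apply: le_trans (ler_wpM2l (rpw_ge0 _ _) (psum_exp_le n y0)) _.
by rewrite /rpw -expRD addNr expR0.
Qed.

(* Replacing [y^m] by [t^-n (t y)^m] with [t = 1 - 1/(2n)], so that [t^n >= 1/2]. *)
Lemma smooth_decay n r k : 0 <= r -> (0 < n)%N ->
  smooth n r k <= 2 * rpw (r / (2 * n%:R)) k.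
Proof.
move=> r0 n0; set y := r * ln k%:R; have y0 : 0 <= y by rewrite mulr_ge0 ?ln_nat_ge0.
have n0' : 0 < n%:R :> R by rewrite ltr0n.
pose u : R := (2 * n%:R)^-1; pose t : R := 1 - u.
have u0 : 0 < u by rewrite invr_gt0 mulr_gt0.
have u12 : u <= 1 / 2.
  by rewrite /u mul1r lef_pV2 ?posrE ?mulr_gt0// ler_peMr// ler1n.
have tn : 1 / 2 <= t ^+ n.
  have bern j : 1 - j%:R * u <= t ^+ j.
    elim: j => [|j IH]; first by rewrite mul0r subr0 expr0.
    rewrite exprS; apply: le_trans (_ : t * (1 - j%:R * u) <= _).
      rewrite /t -natr1; have : 0 <= j%:R * u * u by rewrite !mulr_ge0// ltW.
      by lra.
    by rewrite ler_wpM2l// /t; lra.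
  apply: le_trans (bern n); rewrite le_eqVlt; apply/orP; left; apply/eqP.
  by rewrite /u; field; rewrite gt_eqF.
have t0 : 0 < t by rewrite /t; lra.
have t1 : t <= 1 by rewrite /t; lra.
have key : \sum_(m < n) y ^+ m / m`!%:R <= 2 * expR (t * y).
  apply: le_trans (_ : 2 * \sum_(m < n) (t * y) ^+ m / m`!%:R <= _); last first.
    by rewrite ler_wpM2l// psum_exp_le// mulr_ge0// ltW.
  rewrite mulr_sumr; apply: ler_sum => m _; rewrite mulrA; apply: ler_wpM2r; rewrite ?invr_ge0//.
  rewrite [(t * y) ^+ m]exprMn mulrA; apply: ler_peMl; first by rewrite exprn_ge0.
  have : t ^+ n <= t ^+ m by apply: ler_wiXn2l; rewrite ?(ltW t0)// ltnW.
  by lra.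
apply: le_trans (ler_wpM2l (rpw_ge0 _ _) key) _.
rewrite mulrCA ler_wpM2l// /rpw -expRD le_eqVlt; apply/orP; left; apply/eqP; congr expR.
by rewrite /t /u /y; field; rewrite gt_eqF.
Qed.

Definition mob_weight n r k : R := mobius R k * (smooth n r k * k%:R^-1).

Lemma mob_weight_le n r k : 0 <= r -> (0 < n)%N -> (0 < k)%N ->
  `|mob_weight n r k| <= 2 * rpw (1 + r / (2 * n%:R)) k.
Proof.
move=> r0 n0 k0; rewrite normrM -[leRHS]mul1r; apply: ler_pM; rewrite ?normr_ge0 ?mobius_le1//.
have s0 : 0 <= smooth n r k * k%:R^-1 by rewrite mulr_ge0 ?smooth_ge0 ?invr_ge0.
rewrite (ger0_norm s0) [1 + _]addrC rpwD rpw_1// mulrA.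
by apply: ler_wpM2r; rewrite ?invr_ge0 ?smooth_decay.
Qed.

(** The Taylor terms are collected by k: (-r)^m (-log k)^m = (r log k)^m, while k^(-1-r) supplies 1
    / k and the power inside [smooth]. *)
Lemma Mcoef_sum_smooth (chi : int -> R[i]) n r N :
  \sum_(m < n) Mcoef chi r N m * (- r)%:C ^+ m =
  \sum_(1 <= k < N.+1) (mob_weight n r k)%:C * chi k%:Z.
Proof.
rewrite /Mcoef; under eq_bigr do rewrite mulr_suml.
rewrite exchange_big /= !big_nat; apply: eq_bigr => k /andP[k0 _].
transitivity ((mobius R k)%:C * chi k%:Z * (rpw (1 + r) k)%:C *
    \sum_(m < n) ((r * ln k%:R) ^+ m / m`!%:R)%:C); last first.
  rewrite /mob_weight /smooth rpwD rpw_1// -rmorph_sum /= !rmorphM; ring.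
rewrite mulr_sumr; apply: eq_bigr => m _.
have -> : ((r * ln k%:R) ^+ m / m`!%:R)%:C = (- ln k%:R)%:C ^+ m * (- r)%:C ^+ m / m`!%:R :> R[i].
  have -> : m`!%:R = (m`!%:R : R)%:C :> R[i] by rewrite rmorph_nat.
  by rewrite -exprMn -rmorphM mulrNN [ln _ * _]mulrC -rmorphXn -fmorphV -rmorphM.
ring.
Qed.

End SmoothWeight.

(** * Zeros and size of L near 1 without an exceptional zero *)

Section ZeroFree.
Variable R : realType.
Variables (c0 : R) (q : nat).
Hypothesis c0_gt0 : 0 < c0.
Hypothesis q2 : (2 <= q)%N.
Hypothesis noexc : ~ exceptional_zero_exists c0 q.
Implicit Types (s z : R[i]) (chi : int -> R[i]).

Let q0 : (0 < q)%N. Proof. exact: leq_trans q2. Qed.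

Lemma Lprod_eq0 chi s : dirichlet_character q chi -> Defs.Lfun q chi s = 0 -> Lprod q s = 0.
Proof.
move=> chiP L0; rewrite /Lprod fsbig_finite; last exact: dchars_finite.
by rewrite (bigD1_seq chi) ?dchars_uniq//= ?L0 ?mul0r//; apply/mem_dchars.
Qed.

Lemma L1_neq0 chi : dirichlet_character q chi -> chi <> @principal_character R q ->
  Defs.Lfun q chi 1 != 0.
Proof.
move=> chiP np; have [h|h] := pselect (real_character chi); first exact: L1_neq0_real.
exact: L1_neq0_complex.
Qed.

(** The left edge 1 - 2 r lies in the region because 8 r <= c0 / (log q + 2); the summand 2
    dominates log(|t| + 1) on the square. The point 1, which the region excludes, is covered by
    [L1_neq0]. *)
Lemma zero_free_square chi (a : R) z : dirichlet_character q chi ->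
  chi <> @principal_character R q -> 0 < a -> a <= 1 / 8 -> a <= c0 / 8 ->
  csquare (3 * (a / (ln q%:R + 2))) z ->
  Defs.Lfun q chi ((1 + a / (ln q%:R + 2))%:C + z) != 0.
Proof.
move=> chiP np a0 a8 ac; set l := ln q%:R + 2 => hz.
have lnq : 0 <= ln q%:R :> R by exact: ln_nat_ge0.
have l2 : 2 <= l by rewrite /l; lra.
have l0 : 0 < l by lra.
set r := a / l in hz *.
have ra : r <= 1 / 8.
  by rewrite /r ler_pdivrMr//; nra.
have rl : r * l = a by rewrite /r divfK// gt_eqF.
have [Rs _] := csquare_shift ra hz.
set s := _ + z in Rs *; have sE : s = (1 + r)%:C + z by [].
apply/eqP => L0; have [s1|s1] := eqVneq s 1.
  by move: (L1_neq0 chiP np); rewrite -s1 L0 eqxx.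
apply: noexc; exists s; split => //; [lra| |exact: (Lprod_eq0 chiP)].
have [h1 h2] := hz.
have -> : complex.Im s = complex.Im z by rewrite sE ImD /= add0r.
have -> : complex.Re s = 1 + r + complex.Re z by rewrite sE ReD.
set t := complex.Im z in h2 *; set x := complex.Re z in h1 *.
have q0' : 0 < q%:R :> R by rewrite ltr0n.
have t0 : 0 <= `|t| by rewrite normr_ge0.
have lnX : ln (q%:R * (`|t| + 1)) <= l.
  have t2 : 0 < `|t| + 1 by lra.
  rewrite lnM ?posrE//.
  have := ln_sublinear t2; rewrite /l; lra.
have lnX0 : 0 < ln (q%:R * (`|t| + 1)).
  rewrite ln_gt0//; have : 2 <= q%:R :> R by rewrite ler_nat.
  by nra.
have : c0 / l <= c0 / ln (q%:R * (`|t| + 1)).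
  by rewrite ler_wpM2l ?(ltW c0_gt0)// lef_pV2.
have : 8 * r <= c0 / l by rewrite ler_pdivlMr// -mulrA rl; lra.
move: h1; rewrite ler_norml => /andP[]; lra.
Qed.

(** Cut the series at n = q. Up to there n^(2 r) <= 2, so a harmonic sum bounds the terms; beyond,
    Abel summation leaves a constant. *)
Lemma Lfun_upper chi (a : R) z : dirichlet_character q chi ->
  chi <> @principal_character R q -> 0 < a -> a <= 1 / 8 ->
  cabs z <= 3 * (a / (ln q%:R + 2)) ->
  cabs (Defs.Lfun q chi ((1 + a / (ln q%:R + 2))%:C + z)) <= 10 * (ln q%:R + 2).
Proof.
move=> chiP np a0 a8; set l := ln q%:R + 2 => hz.
have lnq : 0 <= ln q%:R :> R by exact: ln_nat_ge0.
have l2 : 2 <= l by rewrite /l; lra.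
have l0 : 0 < l by lra.
set r := a / l in hz *.
have r0 : 0 < r by rewrite divr_gt0.
have ra : r <= 1 / 8.
  by rewrite /r ler_pdivrMr//; nra.
have rl : r * l = a by rewrite /r divfK// gt_eqF.
have [Rs cs] := csquare_shift ra (cabs_csquare hz).
have Rz : 1 - 2 * r <= complex.Re ((1 + r)%:C + z).
  rewrite ReD /=; have := le_trans (Re_le_cabs z) hz.
  by rewrite ler_norml => /andP[]; lra.
set s := _ + z in Rs cs Rz *.
have s0 : 0 < complex.Re s by lra.
have q0' : 0 < q%:R :> R by rewrite ltr0n.
have e2 n : (0 < n <= q)%N -> rpw (- (2 * r)) n <= 2.
  move=> /andP[n0 nq]; rewrite /rpw mulNr opprK.
  have lnn : ln n%:R <= ln q%:R :> R by rewrite ler_ln ?posrE ?ltr0n// ler_nat.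
  have h : 2 * r * ln n%:R <= 1 / 4.
    have : r * ln n%:R <= r * l by rewrite ler_wpM2l ?(ltW r0)// /l; lra.
    by lra.
  apply: le_trans (_ : expR (1 / 4) <= _); first by rewrite ler_expR.
  have := expR_ge1Dx (- (1 / 4) : R); rewrite expRN => h2.
  by rewrite -[leLHS]invrK -[leRHS]invrK lef_pV2 ?posrE ?invr_gt0 ?expR_gt0//; lra.
have bn n : (0 < n <= q)%N -> rpw (complex.Re s) n <= 2 * n%:R^-1.
  move=> nq; have /andP[n0 _] := nq.
  apply: le_trans (rpw_ler n Rz) _; rewrite addrC rpwD rpw_1//.
  by apply: ler_wpM2r; rewrite ?invr_ge0 ?e2.
have hP : cabs (Lpart chi q s) <= 2 * (1 + ln q%:R).
  rewrite /Lpart; apply: le_trans (cabs_sum _ _ _) _.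
  apply: le_trans (_ : \sum_(1 <= n < q.+1) 2 * n%:R^-1 <= _); last first.
    by rewrite -mulr_sumr ler_wpM2l// sum_harmonic.
  rewrite !big_nat; apply: ler_sum => n nq.
  rewrite cabsM cabs_npowN -[leRHS]mul1r; apply: ler_pM; rewrite ?cabs_ge0 ?rpw_ge0 ?bn//.
  exact: (dc_cabs_le1 q0 chiP).
have hT := Lfun_tail q0 chiP np s0 q0.
have hT2 : cabs (Defs.Lfun q chi s - Lpart chi q s) <= 16.
  apply: le_trans hT _; apply: le_trans (_ : 2 * q%:R * 4 * (2 * q%:R^-1) <= _); last first.
    by rewrite le_eqVlt; apply/orP; left; apply/eqP; field; rewrite gt_eqF.
  apply: ler_pM; rewrite ?mulr_ge0 ?rpw_ge0 ?addr_ge0 ?divr_ge0 ?cabs_ge0 ?(ltW s0)//.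
    rewrite ler_wpM2l ?mulr_ge0//.
    have : cabs s / complex.Re s <= 3 by rewrite ler_pdivrMr//; lra.
    by lra.
  by rewrite bn// q0 leqnn.
have := cabsD (Defs.Lfun q chi s - Lpart chi q s) (Lpart chi q s); rewrite subrK /l; lra.
Qed.

End ZeroFree.

Section InverseApproximation.
Variable R : realType.
Variables (c0 : R) (q : nat).
Hypothesis c0_gt0 : 0 < c0.
Hypothesis q2 : (2 <= q)%N.
Hypothesis noexc : ~ exceptional_zero_exists c0 q.

Definition radius : R := Num.min c0 1 / 8.
Definition logq : R := ln q%:R + 2.
Definition approx_const : R := 8 * 80 ^+ 4 / radius ^+ 5.

Lemma radius_gt0 : 0 < radius.
Proof. by rewrite /radius divr_gt0// lt_min c0_gt0 ltr01. Qed.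

Lemma radius_le : radius <= 1 / 8 /\ radius <= c0 / 8.
Proof. by rewrite /radius; split; apply: ler_wpM2r => //; rewrite ge_min lexx ?orbT. Qed.

Lemma logq_ge2 : 2 <= logq.
Proof. by rewrite /logq; have := ln_nat_ge0 R q; lra. Qed.

Lemma ln2_ge : 1 / 2 <= ln 2 :> R.
Proof.
have := ln_succ_ge R (isT : (0 < 1)%N); rewrite ln1; lra.
Qed.

Lemma approx_const_gt0 : 0 < approx_const.
Proof.
apply: divr_gt0; last exact/exprn_gt0/radius_gt0.
by apply: mulr_gt0; [rewrite ltr0n|apply: exprn_gt0; rewrite ltr0n].
Qed.

(** [n] comes before [chi]: one weight serves all characters modulo q, as orthogonality requires. *)
Lemma inv_L1_mob : exists n, [/\ (0 < n)%N, n%:R <= 48 * ln logq &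
  forall chi, dirichlet_character q chi -> chi <> @principal_character R q ->
  forall e, 0 < e -> \forall N \near \oo,
    cabs ((Defs.Lfun q chi 1)^-1 -
      \sum_(1 <= k < N.+1) (mob_weight n (radius / logq) k)%:C * chi k%:Z) <=
    approx_const / logq ^+ 3 + e].
Proof.
set l := logq; set a := radius; set r := a / l.
have l2 : 2 <= l := logq_ge2; have l0 : 0 < l by lra.
have a0 : 0 < a := radius_gt0; have [a8 ac] := radius_le; rewrite -/a in a8 ac.
have r0 : 0 < r by rewrite divr_gt0.
have r8 : r <= 1 / 8 by rewrite /r ler_pdivrMr//; nra.
have ln20 := ln2_ge.
have lnl : 1 / 2 <= ln l.
  by apply: le_trans ln20 _; rewrite ler_ln// posrE.
pose m0 := (Num.truncn (ln l / ln 2)).+1.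
have lt0 : 0 <= ln l / ln 2 by rewrite divr_ge0//; lra.
have /andP[m1 m2] := truncn_itv lt0; rewrite -/m0 in m2.
have hm0 : m0%:R <= 4 * ln l.
  rewrite /m0 -natr1.
  have : ln l / ln 2 <= 2 * ln l by rewrite ler_pdivrMr; [nra|lra].
  by lra.
have h2 : l <= 2 ^+ m0.
  rewrite -ler_ln ?posrE ?exprn_gt0// lnXn// -[leRHS]mulr_natl.
  have ln20' : 0 < ln 2 :> R by lra.
  by rewrite -ler_pdivrMr// ltW.
have m0_gt0 : (0 < m0)%N by [].
clearbody m0.
(* Since 2^[m0] >= l, the series tail is at most l^-12 times [inv_const], which is O(l^9); this
   leaves l^-3. *)
exists (12 * m0)%N; split=> [|| chi chiP np e e0].
- by rewrite muln_gt0.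
- by rewrite natrM; move: (m0%:R : R) hm0 => y hm0; lra.
have B1 : 1 <= 10 * l by lra.
have Ln0 z : csquare (3 * r) z -> Defs.Lfun q chi ((1 + r)%:C + z) != 0.
  by move=> hz; exact: (zero_free_square c0_gt0 q2 noexc chiP np a0 a8 ac hz).
have LB z : cabs z <= 3 * r -> cabs (Defs.Lfun q chi ((1 + r)%:C + z)) <= 10 * l.
  by move=> hz; exact: (Lfun_upper q2 chiP np a0 a8 hz).
have q0 : (0 < q)%N by exact: leq_trans q2.
have near1 := inv_L1_approx q0 chiP np r0 r8 (12 * m0) B1 e0 Ln0 LB.
apply: filterS near1 => N; rewrite Mcoef_sum_smooth => h; apply: le_trans h _.
rewrite lerD2r.
have K1 : inv_const r (10 * l) <= 2 * (2 * l / a) * (80 * l ^+ 2 / a) ^+ 4.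
  have al : a <= l by lra.
  have h1 : 1 + r^-1 <= 2 * l / a.
    rewrite /r invf_div; have : 1 <= l / a by rewrite ler_pdivlMr// mul1r.
    by lra.
  have b0 : 0 <= 1 + r^-1 by rewrite addr_ge0// invr_ge0 ltW.
  rewrite /inv_const; apply: ler_pM; rewrite ?mulr_ge0 ?exprn_ge0 ?mulr_ge0//; try lra.
  apply: lerXn2r; rewrite ?nnegrE ?mulr_ge0 ?invr_ge0 ?exprn_ge0//; try lra.
  apply: le_trans (_ : 4 * (10 * l) * (2 * l / a) <= _); first by rewrite ler_wpM2l//; lra.
  by rewrite le_eqVlt; apply/orP; left; apply/eqP; field; rewrite gt_eqF.
have P1 : (2^-1 : R) ^+ (12 * m0) <= (l^-1) ^+ 12.
  rewrite mulnC exprM; apply: lerXn2r; rewrite ?nnegrE ?exprn_ge0 ?invr_ge0//; try lra.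
  by rewrite exprVn lef_pV2// posrE exprn_gt0.
apply: le_trans (_ : 2 * (2 * (2 * l / a) * (80 * l ^+ 2 / a) ^+ 4) * (l^-1) ^+ 12 <= _).
  have b0 : 0 <= 1 + r^-1 by rewrite addr_ge0// invr_ge0 ltW.
  have i0 : 0 <= inv_const r (10 * l).
    apply: mulr_ge0; first exact: mulr_ge0.
    apply: exprn_ge0; apply: mulr_ge0 => //; lra.
  apply: ler_pM; [exact: mulr_ge0|by rewrite exprn_ge0 ?invr_ge0|by rewrite ler_wpM2l|exact: P1].
rewrite /approx_const -/a; move: (80 : R) => x.
rewrite le_eqVlt; apply/orP; left; apply/eqP; field.
by rewrite !gt_eqF.
Qed.

End InverseApproximation.

(** * The mean square *)

Section Correlations.
Variable R : realType.
Variables (Q : nat) (x : R).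
Hypothesis Q0 : (0 < Q)%N.
Hypothesis x0 : 0 < x.
Implicit Types (m n N t : nat).

Definition majorant m : R := 2 * rpw (1 + x) m.
Definition majorant_sum : R := 2 * (1 + x^-1).

Lemma majorant_ge0 m : 0 <= majorant m. Proof. by rewrite mulr_ge0 ?rpw_ge0. Qed.

Lemma majorant_sum_gt0 : 0 < majorant_sum.
Proof. by rewrite mulr_gt0 ?addr_gt0 ?invr_gt0. Qed.

Lemma sum_majorant N : \sum_(1 <= m < N) majorant m <= majorant_sum.
Proof. by rewrite -mulr_sumr ler_wpM2l// sum_rpw. Qed.

Lemma sum_at_most_one n (P : pred 'I_n) (F : 'I_n -> R) (M : R) :
  (forall i j, P i -> P j -> i = j) -> 0 <= M -> (forall i, P i -> F i <= M) ->
  \sum_(i | P i) F i <= M.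
Proof.
move=> Pu M0 FM; case: (pickP P) => [i Pi|P0]; last by rewrite big_pred0.
rewrite (big_pred1 i) ?FM// => j; apply/idP/eqP => [Pj|-> //].
exact: Pu.
Qed.

Lemma sum_blocks T (F : nat -> R) :
  \sum_(0 <= m < T * Q) F m = \sum_(0 <= t < T) \sum_(i < Q) F (t * Q + i)%N.
Proof.
elim: T => [|T IH]; first by rewrite mul0n !big_geq.
rewrite mulSn addnC (big_cat_nat (n := (T * Q)%N)) ?leq_addr//= IH big_nat_recr//=.
congr (_ + _); rewrite -{1}[(T * Q)%N]add0n big_addn addnC addnK big_mkord.
by apply: eq_bigr => i _; rewrite addnC.
Qed.

(** Each block of Q consecutive integers meets the class at most once. In the first block m >= Q/2
    gives at most 4 / Q; in block t >= 1 the majorant at t Q is at most the majorant at t, divided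
    by Q. *)
Lemma class_sum (P : pred nat) N :
  (forall m m', P m -> P m' -> m = m' %[mod Q]) ->
  \sum_(1 <= m < N.+1 | P m && (Q <= 2 * m)%N) majorant m <= (4 + majorant_sum) / Q%:R.
Proof.
move=> Pc; pose G m := if P m && (Q <= 2 * m)%N then majorant m else 0.
have G0 m : 0 <= G m by rewrite /G; case: ifP => // _; rewrite majorant_ge0.
have Q0' : 0 < Q%:R :> R by rewrite ltr0n.
rewrite big_mkcond.
apply: le_trans (_ : \sum_(0 <= m < N.+1 * Q) G m <= _).
  rewrite [leRHS](big_cat_nat (n := 1)) //=; last by rewrite muln_gt0.
  rewrite [X in _ + X](big_cat_nat (n := N.+1)) //=; last by rewrite leq_pmulr.
  by rewrite addrCA lerDl addr_ge0// sumr_ge0.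
have blk t (M : R) : 0 <= M -> (forall i : 'I_Q, P (t * Q + i)%N -> (Q <= 2 * (t * Q + i))%N ->
    majorant (t * Q + i) <= M) -> \sum_(i < Q) G (t * Q + i)%N <= M.
  move=> M0 h; rewrite -big_mkcond /=; apply: sum_at_most_one => //.
    move=> i j /andP[Pi _] /andP[Pj _]; apply: val_inj.
    by have := Pc _ _ Pi Pj; rewrite !modnMDl !modn_small.
  by move=> i /andP[Pi Qi]; exact: h.
rewrite sum_blocks big_ltn// mulrDl; apply: lerD.
  apply: blk => [|i _]; first by rewrite divr_ge0.
  rewrite mul0n add0n => Qi; have i0 : (0 < i)%N by move: Qi; case: (nat_of_ord i); lia.
  apply: le_trans (_ : 2 * i%:R^-1 <= _).
    by rewrite ler_wpM2l// -rpw_1// rpw_ler// lerDl ltW.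
  have i0' : 0 < i%:R :> R by rewrite ltr0n.
  rewrite ler_pdivrMr// mulrAC ler_pdivlMr//.
  by have : Q%:R <= 2 * i%:R :> R; [rewrite -natrM ler_nat|lra].
apply: le_trans (_ : \sum_(1 <= t < N.+1) majorant t / Q%:R <= _); last first.
  by rewrite -mulr_suml; apply: ler_wpM2r; rewrite ?invr_ge0 ?sum_majorant.
rewrite !big_nat; apply: ler_sum => t /andP[t0 _].
apply: blk => [|i _ _]; first by rewrite divr_ge0 ?majorant_ge0.
apply: le_trans (_ : majorant (t * Q)%N <= _).
  rewrite ler_wpM2l// rpw_le ?leq_addr ?muln_gt0 ?t0//.
  by rewrite addr_ge0// ltW.
rewrite /majorant rpwM// mulrA ler_wpM2l ?mulr_ge0 ?rpw_ge0//.
by rewrite -rpw_1// rpw_ler// lerDl ltW.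
Qed.

(** One of the two variables is at least Q/2; it is summed first, inside the residue class fixed by
    the other one. *)
Lemma pair_sum (E : rel nat) N : symmetric E ->
  (forall n m m', E m n -> E m' n -> m = m' %[mod Q]) ->
  (forall m n, E m n -> (Q <= 2 * m)%N || (Q <= 2 * n)%N) ->
  \sum_(1 <= m < N.+1) \sum_(1 <= n < N.+1 | E m n) majorant m * majorant n <=
  2 * (majorant_sum * ((4 + majorant_sum) / Q%:R)).
Proof.
move=> Es Ec EQ.
pose S (P : rel nat) := \sum_(1 <= m < N.+1) \sum_(1 <= n < N.+1 | P m n) majorant m * majorant n.
have VV m n : 0 <= majorant m * majorant n by rewrite mulr_ge0 ?majorant_ge0.
have bound : S (fun m n => E n m && (Q <= 2 * n)%N) <= majorant_sum * ((4 + majorant_sum) / Q%:R).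
  rewrite /S; under eq_bigr do rewrite -mulr_sumr.
  apply: le_trans (_ : \sum_(1 <= m < N.+1) majorant m * ((4 + majorant_sum) / Q%:R) <= _).
    apply: ler_sum => m _; rewrite ler_wpM2l ?majorant_ge0//.
    exact: (class_sum _ (Ec m)).
  rewrite -mulr_suml ler_wpM2r ?sum_majorant// divr_ge0// addr_ge0//.
  exact/ltW/majorant_sum_gt0.
have sym : S (fun m n => E m n && (Q <= 2 * m)%N) = S (fun m n => E n m && (Q <= 2 * n)%N).
  rewrite /S; under eq_bigr do rewrite big_mkcond; rewrite exchange_big /=.
  apply: eq_bigr => m _; rewrite [RHS]big_mkcond; apply: eq_bigr => n _.
  by rewrite mulrC.
have split : S E <= S (fun m n => E m n && (Q <= 2 * m)%N) + S (fun m n => E n m && (Q <= 2 * n)%N).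
  rewrite /S -big_split; apply: ler_sum => m _.
  rewrite big_mkcond [X in _ <= X + _]big_mkcond [X in _ <= _ + X]big_mkcond -big_split.
  apply: ler_sum => n _; rewrite (Es n m).
  case: ifP => [/[dup] h /EQ/orP[->|->]|_] /=; rewrite ?h /=.
  - by case: ifP => _; rewrite ?addr0// lerDl.
  - by case: ifP => _; rewrite ?add0r// lerDl.
  - by rewrite addr0.
apply: le_trans split _; rewrite sym; lra.
Qed.

End Correlations.

Section DiagonalTerm.
Variable R : realType.
Implicit Types (m n N Q p : nat) (r : R).

Definition sqfree_sum (P : pred nat) N : R :=
  \sum_(1 <= n < N.+1 | P n && sqfree n) (n%:R ^+ 2)^-1.

Definition correlation n r (P : pred nat) Q N : R :=
  \sum_(1 <= a < N.+1 | P a) \sum_(1 <= b < N.+1 | P b)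
    mob_weight n r a * mob_weight n r b *
    ((Q%:Z %| a%:Z - b%:Z)%Z%:R + (Q %| a + b)%N%:R).

(** Here log n <= 2 n^(1/2), and the sum of n^(-3/2) is at most 3. *)
Lemma sum_ln_sq N : \sum_(1 <= n < N) ln n%:R * (n%:R ^+ 2)^-1 <= 6 :> R.
Proof.
apply: le_trans (_ : \sum_(1 <= n < N) 2 * rpw (1 + 1 / 2) n <= _).
  rewrite !big_nat; apply: ler_sum => n /andP[n0 _].
  have half : 1 / 2 + 1 / 2 = 1 :> R by lra.
  have h := @ln_le_rpw R (1 / 2) n ltac:(lra).
  have -> : (n%:R ^+ 2)^-1 = rpw 1 n * rpw 1 n :> R by rewrite rpw_1// -invfM expr2.
  have -> : rpw (1 + 1 / 2) n = rpw 1 n * rpw (1 / 2) n :> R by rewrite rpwD.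
  have -> : rpw 1 n = rpw (1 / 2) n * rpw (1 / 2) n :> R by rewrite -rpwD half.
  set u := rpw (1 / 2) n; have u0 : 0 < u by exact: rpw_gt0.
  have uE : expR (1 / 2 * ln n%:R) * u = 1.
    by rewrite /u /rpw -expRD subrr expR0.
  have h2 : ln n%:R * u <= 2.
    apply: le_trans (ler_wpM2r (ltW u0) h) _; rewrite -mulrA uE; lra.
  have -> : ln n%:R * (u * u * (u * u)) = ln n%:R * u * (u * u * u) by ring.
  by apply: ler_wpM2r; rewrite ?mulr_ge0 ?(ltW u0).
rewrite -mulr_sumr; have := @sum_rpw R (1 / 2) N ltac:(lra).
by rewrite div1r invrK => h; apply: le_trans (ler_wpM2l _ h) _ => //; lra.
Qed.

(** Since a^-r <= [smooth n r a] <= 1, dropping the squared weight costs at most 2 r log a per term,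
    in total 12 r by [sum_ln_sq]. *)
Lemma diag_le n r P N : 0 <= r -> (0 < n)%N ->
  sqfree_sum P N - 12 * r <= \sum_(1 <= a < N.+1 | P a) mob_weight n r a ^+ 2 <= sqfree_sum P N.
Proof.
move=> r0 n0.
have E : \sum_(1 <= a < N.+1 | P a) mob_weight n r a ^+ 2 =
    \sum_(1 <= a < N.+1 | P a && sqfree a) smooth n r a ^+ 2 * (a%:R ^+ 2)^-1.
  rewrite big_mkcond [RHS]big_mkcond; apply: eq_bigr => a _.
  case: (P a) => //=; rewrite /mob_weight !exprMn mobius_sqr.
  by case: sqfree; rewrite ?mul0r// mul1r exprVn.
have s1 a : smooth n r a ^+ 2 <= 1.
  by rewrite expr2 mulr_ile1 ?smooth_ge0 ?smooth_le1.
have sge a : 1 - 2 * (r * ln a%:R) <= smooth n r a ^+ 2.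
  have h := smooth_ge a r0 n0.
  have h2 : rpw r a ^+ 2 <= smooth n r a ^+ 2.
    by apply: lerXn2r; rewrite ?nnegrE ?rpw_ge0 ?smooth_ge0.
  apply: le_trans h2; rewrite /rpw -expRM_natr; apply: le_trans (expR_ge1Dx _).
  lra.
rewrite E; apply/andP; split; last first.
  by apply: ler_sum => a _; rewrite ler_piMl.
rewrite lerBlDr -lerBlDl /sqfree_sum -sumrB.
apply: le_trans (_ : \sum_(1 <= a < N.+1) 2 * r * (ln a%:R * (a%:R ^+ 2)^-1) <= _); last first.
  rewrite -mulr_sumr; apply: le_trans (ler_wpM2l _ (sum_ln_sq N.+1)) _; first by rewrite mulr_ge0.
  by lra.
rewrite big_mkcond; apply: ler_sum => a _; case: ifP => _.
  rewrite -{1}[(a%:R ^+ 2)^-1]mul1r -mulrBl mulrA; apply: ler_wpM2r => //.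
  by have := sge a; lra.
by rewrite !mulr_ge0 ?ln_nat_ge0.
Qed.

(** Off the diagonal either a and b are distinct and congruent modulo Q, or Q divides a + b. Both
    force max(a, b) >= Q/2, so [pair_sum] applies to each kind. *)
Lemma correlation_bound n r P Q N : 0 < r -> (0 < n)%N -> (0 < Q)%N ->
  forall W, W = majorant_sum (r / (2 * n%:R)) ->
  `|correlation n r P Q N - sqfree_sum P N| <= 12 * r + 4 * (W * ((4 + W) / Q%:R)).
Proof.
move=> r0 n0 Q0 W; set x := r / (2 * n%:R); move=> WE.
have x0 : 0 < x by rewrite divr_gt0// mulr_gt0// ltr0n.
pose c := mob_weight n r.
pose E1 : rel nat := fun a b => (a == b %[mod Q]) && (a != b).
pose E2 : rel nat := fun a b => (Q %| a + b)%N.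
have cE a b : ((Q%:Z %| a%:Z - b%:Z)%Z%:R : R) = (a == b)%:R + (E1 a b)%:R.
  rewrite -eqz_mod_dvd !modz_nat eqz_nat /E1.
  by have [->|ab] := eqVneq a b; rewrite ?eqxx ?addr0//= andbT add0r.
pose O (E : rel nat) := \sum_(1 <= a < N.+1 | P a) \sum_(1 <= b < N.+1 | P b) c a * c b * (E a b)%:R.
have split : correlation n r P Q N = \sum_(1 <= a < N.+1 | P a) c a ^+ 2 + O E1 + O E2.
  rewrite /correlation /O -!big_split /=.
  rewrite big_nat_cond [RHS]big_nat_cond; apply: eq_bigr => a /andP[aN Pa].
  transitivity (\sum_(1 <= b < N.+1 | P b) (c a * c b * (a == b)%:R + c a * c b * (E1 a b)%:R
    + c a * c b * (E2 a b)%:R)).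
    by apply: eq_bigr => b _; rewrite cE -!mulrDr.
  rewrite !big_split /=; congr (_ + _ + _).
  rewrite -big_filter (bigD1_seq a) ?filter_uniq ?iota_uniq//=; last first.
    by rewrite mem_filter Pa mem_index_iota.
  rewrite eqxx mulr1 big1 ?addr0// => b ba.
  by rewrite eq_sym (negbTE ba) mulr0.
have Ob (E : rel nat) : `|O E| <= \sum_(1 <= a < N.+1) \sum_(1 <= b < N.+1 | E a b) majorant x a * majorant x b.
  apply: le_trans (ler_norm_sum _ _ _) _; rewrite big_mkcond !big_nat; apply: ler_sum => a /andP[a0 _].
  have s0 : 0 <= \sum_(1 <= b < N.+1 | E a b) majorant x a * majorant x b.
    by apply: sumr_ge0 => b _; apply: mulr_ge0; exact: majorant_ge0.
  case: ifP => // _; apply: le_trans (ler_norm_sum _ _ _) _.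
  rewrite big_mkcond [leRHS]big_mkcond !big_nat; apply: ler_sum => b /andP[b0 _].
  have m0 : 0 <= majorant x a * majorant x b by apply: mulr_ge0; exact: majorant_ge0.
  case: (P b) => /=; case: (E a b); rewrite ?mulr1 ?mulr0 ?normr0//.
  by rewrite normrM; apply: ler_pM; rewrite ?normr_ge0 ?mob_weight_le// ltW.
have B1 : `|O E1| <= 2 * (W * ((4 + W) / Q%:R)).
  rewrite WE; apply: le_trans (Ob _) _; apply: pair_sum => //.
  - by move=> a b; rewrite /E1 eq_sym [b == a]eq_sym.
  - by move=> b a a' /andP[/eqP h _] /andP[/eqP h' _]; rewrite h h'.
  move=> a b /andP[]; wlog ab : a b / (a <= b)%N.
    move=> h hab nab; case: (leqP a b) => ab; first exact: h.
    by rewrite orbC; apply: h; rewrite ?(ltnW ab)// eq_sym.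
  rewrite eq_sym eqn_mod_dvd// => /dvdnP[k kE] nab.
  have k0 : (0 < k)%N.
    by case: k kE => // /eqP; rewrite mul0n subn_eq0 => ba; rewrite eqn_leq ab ba in nab.
  have : (Q <= k * Q)%N by rewrite leq_pmull.
  rewrite -kE => h; apply/orP; right; lia.
have B2 : `|O E2| <= 2 * (W * ((4 + W) / Q%:R)).
  rewrite WE; apply: le_trans (Ob E2) _.
  (* The condition 0 < a + b, automatic in this range, is recorded because divisibility then gives a
     + b >= Q. *)
  apply: le_trans (_ : \sum_(1 <= a < N.+1) \sum_(1 <= b < N.+1 | E2 a b && (0 < a + b)%N) majorant x a * majorant x b <= _).
    rewrite !big_nat; apply: ler_sum => a /andP[a0 _].
    by rewrite le_eqVlt; apply/orP; left; apply/eqP; apply: eq_bigl => b; rewrite addn_gt0 a0 andbT.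
  apply: (@pair_sum _ _ _ Q0 x0 (fun a b => E2 a b && (0 < a + b)%N)).
  - by move=> a b; rewrite /E2 addnC.
  - move=> b a a' /andP[h _] /andP[h' _]; rewrite /E2 in h h'.
    apply/eqP; rewrite -(eqn_modDr b).
    by move: h h'; rewrite /dvdn => /eqP -> /eqP ->.
  move=> a b /andP[/dvdn_leq h ab0]; have {}h := h ab0.
  apply/orP; case: (leqP a b) => ab; [right|left]; lia.
have /andP[d1 d2] := diag_le P N (ltW r0) n0.
rewrite split -/c in d1 d2 *; rewrite ler_norml; move: B1 B2; rewrite !ler_norml => /andP[u1 u2] /andP[v1 v2].
by apply/andP; split; lra.
Qed.

End DiagonalTerm.

(** * The mean square of 1/L(1, chi) at each level p^j *)

Section MeanSquare.
Variable R : realType.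
Variables (c0 : R) (p k : nat).
Hypothesis c0_gt0 : 0 < c0.
Hypothesis pp : prime p.
Hypothesis k0 : (0 < k)%N.
Hypothesis noexc : ~ exceptional_zero_exists c0 (p ^ k).
Implicit Types (chi : int -> R[i]) (n N j : nat).

Lemma near_all_seq (T : eqType) (s : seq T) (P : T -> nat -> Prop) :
  (forall x, x \in s -> \forall N \near \oo, P x N) ->
  \forall N \near \oo, forall x, x \in s -> P x N.
Proof.
elim: s => [_|x s IH h]; first by apply: nearW.
have h1 : \forall N \near \oo, P x N by apply: h; rewrite mem_head.
have h2 : \forall N \near \oo, forall y, y \in s -> P y N.
  by apply: IH => y ys; apply: h; rewrite inE ys orbT.
near=> N => y; rewrite inE => /orP[/eqP ->|ys]; first by near: N.
by move: y ys; near: N.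
Unshelve. all: by end_near. Qed.

Lemma sqr_close (u v e W : R) : 0 <= u -> 0 <= v -> v <= W -> `|u - v| <= e ->
  `|u ^+ 2 - v ^+ 2| <= e * (2 * W + e).
Proof.
move=> u0 v0 vW uv; have e0 : 0 <= e by apply: le_trans uv.
rewrite subr_sqr normrM; apply: ler_pM => //.
rewrite ger0_norm ?addr_ge0//; move: uv; rewrite ler_norml => /andP[]; lra.
Qed.

Lemma totient_pfactor_le j : (0 < j)%N -> (totient (p ^ j) <= p ^ j)%N.
Proof.
by move=> j0; rewrite totient_pfactor// -[X in (_ <= p ^ X)%N](prednK j0) expnS leq_mul// leq_pred.
Qed.

Let l : R := logq R (p ^ k).
Let r : R := radius c0 / l.
Let eps : R := 2 * (approx_const c0 / l ^+ 3).

(** First 1 / L is replaced by its approximation; then the principal character is added, at a cost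
    of at most W^2, to make orthogonality available; then the correlation is evaluated. All this
    happens at one N, large enough for the finitely many characters. *)
Lemma inv_mean_square_bound : exists n, [/\ (0 < n)%N, n%:R <= 48 * ln l &
  forall (W D : R) j, W = majorant_sum (r / (2 * n%:R)) ->
  (\forall N \near \oo, `|sqfree_sum R (fun a => coprime a p) N - D| <= r) ->
  (0 < j)%N -> (j <= k)%N ->
  `|inv_mean_square R p k j - (totient (p ^ j))%:R / 2 * D| <=
  (totient (p ^ j))%:R * (7 * r + eps * (2 * W + eps)) + 5 * W ^+ 2].
Proof.
have p1 := prime_gt1 pp; have p0 := prime_gt0 pp.
have q2 : (2 <= p ^ k)%N by rewrite -(prednK k0) expnS; apply: (leq_trans p1); rewrite leq_pmulr ?expn_gt0 ?p0.
have l2 : 2 <= l := logq_ge2 R (p ^ k); have l0 : 0 < l by lra.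
have a0 := radius_gt0 c0_gt0; have r0 : 0 < r by rewrite divr_gt0.
have A0 := approx_const_gt0 c0_gt0.
have [a8 _] := radius_le c0.
have r1 : r <= 1 by rewrite /r ler_pdivrMr//; lra.
have [n [n0 n48 hn]] := inv_L1_mob c0_gt0 q2 noexc.
exists n; split => // W D j WE hD j0 jk.
set Q := (p ^ j)%N; have Q0 : (0 < Q)%N by rewrite expn_gt0 p0.
have eh : 0 < approx_const c0 / l ^+ 3 by rewrite divr_gt0// exprn_gt0.
have e0 : 0 < eps by rewrite /eps mulr_gt0.
set x := r / (2 * n%:R) in WE.
have n0' : 1 <= n%:R :> R by rewrite ler1n.
have x0 : 0 < x by rewrite divr_gt0// mulr_gt0// ltr0n.
have W4 : 4 <= W.
  have : 1 <= x^-1 by rewrite invf_ge1// /x ler_pdivrMr; lra.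
  rewrite WE /majorant_sum; lra.
pose A N chi := \sum_(1 <= b < N.+1) (mob_weight n r b)%:C * chi b%:Z.
pose Lc := @Defs.Lfun R (p ^ k)%N.
pose chi0 := @principal_character R (p ^ k).
have dcQ chi : chi \in dchars R Q -> dirichlet_character Q chi by move=> /mem_dchars; apply.
have near1 : \forall N \near \oo, forall chi, chi \in [seq chi <- dchars R Q | chi != chi0] ->
    cabs ((Lc chi 1)^-1 - A N chi) <= eps.
  apply: near_all_seq => chi; rewrite mem_filter => /andP[/eqP np /dcQ hc].
  have hk := dc_pfactor_leq j0 jk hc.
  have := hn chi hk np _ eh; rewrite -/l -/r /eps.
  by apply: filterS => N; rewrite mulr2n mulrDl mul1r.
near \oo => N.
have hN : forall chi, chi \in [seq chi <- dchars R Q | chi != chi0] ->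
    cabs ((Lc chi 1)^-1 - A N chi) <= eps by near: N.
have hDN : `|sqfree_sum R (fun a => coprime a p) N - D| <= r by near: N.
have AW chi : dirichlet_character Q chi -> cabs (A N chi) <= W.
  move=> hc; rewrite WE; apply: le_trans (cabs_sum _ _ _) _; apply: le_trans (sum_majorant x0 N.+1).
  rewrite !big_nat; apply: ler_sum => b /andP[b0 _].
  rewrite cabsM cabs_real -[leRHS]mulr1; apply: ler_pM; rewrite ?normr_ge0 ?cabs_ge0//.
    by apply: mob_weight_le; rewrite ?(ltW r0).
  exact: (dc_cabs_le1 Q0 hc).
pose T := \sum_(chi <- dchars R Q | (chi (-1) == 1) && (chi != chi0)) cabs (A N chi) ^+ 2.
have phi0 : 0 <= (totient Q)%:R :> R by [].
have S1 : `|inv_mean_square R p k j - T| <= (totient Q)%:R * (eps * (2 * W + eps)).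
  have E0 : 0 <= eps * (2 * W + eps) by rewrite mulr_ge0 ?(ltW e0)//; lra.
  rewrite /inv_mean_square /T -sumrB; apply: le_trans (ler_norm_sum _ _ _) _.
  rewrite -(size_dchars R Q0) -sum1_size natr_sum mulr_suml big_mkcond big_seq [leRHS]big_seq.
  apply: ler_sum => chi hc; rewrite mul1r; case: ifP => [/andP[_ np]|_]; last exact: E0.
  have hh : chi \in [seq chi <- dchars R Q | chi != chi0] by rewrite mem_filter np.
  rewrite -exprVn -cabsV; apply: sqr_close; rewrite ?cabs_ge0//; first by apply: AW; exact: dcQ.
  apply: le_trans (hN _ hh); rewrite ler_norml.
  have := cabsD ((Lc chi 1)^-1 - A N chi) (A N chi).
  have := cabsD (A N chi - (Lc chi 1)^-1) ((Lc chi 1)^-1).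
  by rewrite !subrK (cabs_distC (A N chi)) -/Lc; lra.
have S2 : `|T - (totient Q)%:R / 2 * correlation n r (fun a => coprime a Q) Q N| <= W ^+ 2.
  rewrite /correlation -(mean_square_even N (mob_weight n r) Q0) -[in X in _ - X]big_filter.
  have c0P : dirichlet_character Q chi0.
    by rewrite /chi0 (principal_pfactor R p k0 j0); exact: principal_dc.
  rewrite (bigD1_seq chi0) ?filter_uniq ?dchars_uniq//=; last first.
    rewrite mem_filter; apply/andP; split; last by apply/mem_dchars.
    by rewrite /chi0 /principal_character /coprimez gcdNz gcd1z.
  rewrite big_filter_cond /= -/T opprD addrCA subrr addr0 normrN.
  rewrite ger0_norm ?exprn_ge0 ?cabs_ge0//; apply: lerXn2r; rewrite ?nnegrE ?cabs_ge0 ?AW//; lra.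
have S3 := @correlation_bound _ n r (fun a => coprime a Q) Q N r0 n0 Q0 W WE.
have DE : sqfree_sum R (fun a => coprime a Q) N = sqfree_sum R (fun a => coprime a p) N.
  by apply: eq_bigl => a; rewrite /Q coprime_pexpr.
rewrite DE in S3.
set G := correlation _ _ _ _ _ in S2 S3; set S := sqfree_sum _ _ _ in hDN S3.
set F : R := (totient Q)%:R in phi0 S1 S2 *.
have FQ : F / Q%:R <= 1 by rewrite ler_pdivrMr ?ltr0n// mul1r ler_nat totient_pfactor_le.
have S4 : `|F / 2 * G - F / 2 * D| <= 7 * F * r + 4 * W ^+ 2.
  rewrite -mulrBr normrM (ger0_norm (divr_ge0 phi0 (ler0n R 2))).
  have h : `|G - D| <= 13 * r + 4 * (W * ((4 + W) / Q%:R)).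
    rewrite (_ : G - D = (G - S) + (S - D)); last by ring.
    by apply: le_trans (ler_normD _ _) _; lra.
  have F20 : 0 <= F / 2 by rewrite divr_ge0.
  apply: le_trans (ler_wpM2l F20 h) _.
  have Fr : 0 <= F * r by rewrite mulr_ge0// ltW.
  have WW : W * (4 + W) <= 2 * W ^+ 2 by nra.
  have WW0 : 0 <= W * (4 + W) by rewrite mulr_ge0; lra.
  have : F / Q%:R * (W * (4 + W)) <= 2 * W ^+ 2.
    apply: le_trans WW; rewrite -[leRHS]mul1r; exact: ler_wpM2r.
  have -> : F / 2 * (13 * r + 4 * (W * ((4 + W) / Q%:R))) =
     13 / 2 * (F * r) + 2 * (F / Q%:R * (W * (4 + W))).
    by field; rewrite gt_eqF// ltr0n.
  have -> : 7 * F * r = 7 * (F * r) by ring.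
  by lra.
rewrite (_ : inv_mean_square R p k j - F / 2 * D = (inv_mean_square R p k j - T) + (T - F / 2 * G) +
   (F / 2 * G - F / 2 * D)); last by ring.
apply: le_trans (ler_normD _ _) _; apply: le_trans (lerD (ler_normD _ _) (lexx _)) _.
rewrite mulrDr (_ : F * (7 * r) = 7 * F * r); last by ring.
by lra.
Unshelve. all: by end_near. Qed.

End MeanSquare.

(** * Sums over squarefree numbers *)

Section ZetaValues.
Variable R : realType.
Implicit Types (a b m n p M N : nat).

Definition zsum m N : R := \sum_(1 <= n < N.+1) (n%:R ^+ m)^-1.
Definition zval m : R := limn (zsum m).

Lemma zsum_incr m : nondecreasing_seq (zsum m).
Proof.
apply/nondecreasing_seqP => n; rewrite /zsum [leRHS]big_nat_recr//= lerDl.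
by rewrite invr_ge0 exprn_ge0.
Qed.

Lemma zsum_cvg m : (2 <= m)%N -> zsum m n @[n --> \oo] --> zval m.
Proof.
move=> m2; apply/cvg_ex; exists (zval m); apply: nondecreasing_is_cvgn; first exact: zsum_incr.
exists 2 => _ [N _ <-]; rewrite /zsum.
apply: le_trans (_ : \sum_(1 <= n < N.+1) rpw (1 + 1) n <= _); last first.
  by have := @sum_rpw R 1 N.+1 ltr01; rewrite invr1.
rewrite !big_nat; apply: ler_sum => n /andP[n0 _].
rewrite rpwD rpw_1// -invfM -expr2 lef_pV2 ?posrE ?exprn_gt0 ?ltr0n//.
by apply: ler_weXn2l => //; rewrite ler1n.
Qed.

Lemma zsum_le m N : (2 <= m)%N -> zsum m N <= zval m.
Proof.
by move=> m2; apply: nondecreasing_cvgn_le; [exact: zsum_incr|apply/cvg_ex; exists (zval m); exact: zsum_cvg].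
Qed.

Lemma zval_ge1 m : (2 <= m)%N -> 1 <= zval m.
Proof. by move=> m2; apply: le_trans (zsum_le 1 m2); rewrite /zsum big_nat1 expr1n invr1. Qed.

Lemma rpw_natr m n : (0 < n)%N -> rpw m%:R n = (n%:R ^+ m)^-1 :> R.
Proof.
move=> n0; elim: m => [|m IH]; first by rewrite expr0 invr1 /rpw mul0r oppr0 expR0.
by rewrite -natr1 rpwD IH rpw_1// exprSr invfM.
Qed.

Lemma zeta_zval m : (2 <= m)%N -> zeta m%:R = (zval m)%:C :> R[i].
Proof.
move=> m2; rewrite /zeta; apply: cconv_limn; rewrite /cconv.
have mE : m%:R = (m%:R : R)%:C :> R[i] by rewrite rmorph_nat.
pose K : R := (cabs (1 - m%:R : R[i]))^-1.
have hb N : (0 < N)%N -> cabs (\sum_(1 <= n < N.+1) npow n (- m%:R) - npow N (1 - m%:R) / (1 - m%:R) - (zval m)%:C)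
    <= (zval m - zsum m N) + K * rpw 1 N.
  move=> N0; have -> : \sum_(1 <= n < N.+1) npow n (- m%:R) = (zsum m N)%:C :> R[i].
    rewrite /zsum rmorph_sum /= !big_nat; apply: eq_bigr => n /andP[n0 _].
    by rewrite mE -rmorphN npow_real mulNr -rpw_natr.
  rewrite addrAC -rmorphB; apply: le_trans (cabsB _ _) _; apply: lerD.
    by rewrite cabs_real distrC ger0_norm// subr_ge0 zsum_le.
  rewrite cabsM cabsV mulrC ler_wpM2l ?invr_ge0 ?cabs_ge0//.
  rewrite -[1 - _]opprB cabs_npowN; apply: rpw_ler.
  by rewrite mE -(rmorph1 (real_complex R)) -rmorphB /= lerBrDr -(natrD _ 1 1) ler_nat.
have h0 : ((zval m - zsum m N) + K * rpw 1 N) @[N --> \oo] --> (0 : R).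
  rewrite -[0](addr0 0); apply: cvgD; last by apply: cvg0_Ml; apply: rpw_cvg0.
  by rewrite -(subrr (zval m)); apply: cvgB; [exact: cvg_cst|exact: zsum_cvg].
apply: (@squeeze_cvgr _ _ _ _ (fun=> 0) (fun N => (zval m - zsum m N) + K * rpw 1 N)).
- by exists 1%N => // N /= N0; rewrite cabs_ge0 hb.
- exact: cvg_cst.
exact: h0.
Qed.

Lemma ler_sum_subset (s t : seq nat) (f : nat -> R) : (forall n, 0 <= f n) ->
  uniq s -> {subset s <= t} -> \sum_(n <- s) f n <= \sum_(n <- t) f n.
Proof.
move=> f0; elim: s t => [|x s IH] t; first by rewrite big_nil sumr_ge0.
move=> /= /andP[xs us] st; have xt : x \in t by rewrite st ?mem_head.
rewrite big_cons (big_rem x xt) /= lerD2l; apply: IH => // y ys.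
apply: rem_mem; first by apply: contraNneq xs => <-.
by rewrite st// inE ys orbT.
Qed.

(** With [sqfree_square_inj], n = a b^2 is a bijection, whence zeta(2) is zeta(4) times the sum of
    a^-2 over squarefree a. It is used through two inequalities between finite sums. *)
Lemma sqfree_square_decomp n : (0 < n)%N ->
  exists a b, [/\ sqfree a, (0 < a)%N, (0 < b)%N & n = (a * b ^ 2)%N].
Proof.
elim/ltn_ind: n => n IH n0; have [h|h] := boolP (sqfree n).
  by exists n, 1%N; rewrite exp1n muln1.
have [l ln] := allPn h; rewrite -ltnNge => l2.
have pl : prime l by move: ln; rewrite mem_primes => /andP[].
have /dvdnP[m mE] : (l ^ 2 %| n)%N by rewrite pfactor_dvdn.
have m0 : (0 < m)%N by move: n0; rewrite mE muln_gt0 => /andP[].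
have mn : (m < n)%N by rewrite mE ltn_Pmulr// (ltn_exp2l 0) ?prime_gt1.
have [a [b [sa a0 b0 E]]] := IH m mn m0.
exists a, (l * b)%N; split => //; first by rewrite muln_gt0 prime_gt0.
by rewrite mE E expnMn; ring.
Qed.

Lemma sqfree_square_inj a b a' b' : sqfree a -> sqfree a' -> (0 < a)%N -> (0 < a')%N ->
  (0 < b)%N -> (0 < b')%N -> (a * b ^ 2 = a' * b' ^ 2)%N -> a = a' /\ b = b'.
Proof.
move=> sa sa' a0 a0' b0 b0' E.
have h l : logn l a = logn l a' /\ logn l b = logn l b'.
  have := congr1 (logn l) E; rewrite !lognM ?expn_gt0 ?b0 ?b0'//.
  have /(sqfreeP a0)/(_ l) := sa; have /(sqfreeP a0')/(_ l) := sa'.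
  by lia.
by split; apply: eqn_from_log => // l; have [] := h l.
Qed.

Let sqf N := [seq n <- index_iota 1 N.+1 | sqfree n].
Let f n : R := (n%:R ^+ 2)^-1.
Lemma sq_inv_ge0 n : 0 <= f n.
Proof. by rewrite invr_ge0 exprn_ge0. Qed.
Lemma sq_invM a b : f (a * b)%N = f a * f b.
Proof. by rewrite /f natrM exprMn invfM. Qed.
Definition sq_pairs N M := [seq (a * b ^ 2)%N | a <- sqf N, b <- index_iota 1 M.+1].

Lemma sum_sq_pairs N M : \sum_(n <- sq_pairs N M) f n = sqfree_sum R xpredT N * zsum 4 M.
Proof.
rewrite big_allpairs_dep /sqfree_sum /zsum mulr_suml -[RHS]big_filter.
apply: eq_bigr => a _; rewrite mulr_sumr; apply: eq_bigr => b _.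
by rewrite sq_invM /f natrX -exprM.
Qed.

Lemma sqf_mem N n : (n \in sqf N) = [&& sqfree n, (0 < n)%N & (n <= N)%N].
Proof. by rewrite mem_filter mem_index_iota ltnS. Qed.

Lemma zsum_le_sqfree N : zsum 2 N <= sqfree_sum R xpredT N * zsum 4 N.
Proof.
rewrite -sum_sq_pairs; apply: (ler_sum_subset sq_inv_ge0); first exact: iota_uniq.
move=> n; rewrite mem_index_iota ltnS => /andP[n0 nN].
have [a [b [sa a0 b0 E]]] := sqfree_square_decomp n0.
have b1 : (b <= b ^ 2)%N by rewrite -mulnn leq_pmulr.
have ab : (a <= n)%N by rewrite E leq_pmulr// expn_gt0 b0.
have bn : (b <= n)%N by rewrite E; apply: leq_trans b1 _; rewrite leq_pmull.
rewrite E; apply: allpairs_f; first by rewrite sqf_mem sa a0 (leq_trans ab).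
by rewrite mem_index_iota b0 ltnS (leq_trans bn).
Qed.

Lemma sqfree_le_zsum N M : sqfree_sum R xpredT N * zsum 4 M <= zsum 2 (N * M ^ 2).
Proof.
rewrite -sum_sq_pairs; apply: (ler_sum_subset sq_inv_ge0).
  rewrite /sq_pairs; apply: allpairs_uniq; rewrite ?filter_uniq ?iota_uniq//.
  move=> [a b] [a' b'] /allpairsP[[x y] /= [xs ys [-> ->]]] /allpairsP[[x' y'] /= [xs' ys' [-> ->]]] E.
  move: xs xs' ys ys'; rewrite !sqf_mem !mem_index_iota => /and3P[s1 p1 _] /and3P[s2 p2 _] /andP[p3 _] /andP[p4 _].
  by have [-> ->] := sqfree_square_inj s1 s2 p1 p2 p3 p4 E.
move=> n /allpairsP[[a b] /= [ha hb ->]]; move: ha hb.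
rewrite sqf_mem !mem_index_iota !ltnS => /and3P[_ a0 aN] /andP[b0 bM].
by rewrite muln_gt0 a0 expn_gt0 b0 leq_mul// leq_sqr.
Qed.

Lemma sqfree_mul_prime p a : prime p -> ~~ (p %| a)%N -> (0 < a)%N -> sqfree (p * a) = sqfree a.
Proof.
move=> pp pa a0; have /eqP := congr1 (fun x => x ^+ 2) (mobius_mul_prime R pp pa a0).
by rewrite sqrrN !mobius_sqr eqr_nat; case: sqfree; case: sqfree.
Qed.

Section CoprimePart.
Variable p : nat.
Hypothesis pp : prime p.

Let L N := [seq n <- index_iota 1 N.+1 | coprime n p && sqfree n].
Lemma coprime_sqf_mem N n : (n \in L N) = [&& coprime n p, sqfree n, (0 < n)%N & (n <= N)%N].
Proof. by rewrite mem_filter mem_index_iota ltnS -andbA. Qed.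

Lemma sum_coprime_pairs N : \sum_(n <- L N ++ map (muln p) (L N)) f n =
  sqfree_sum R (fun a => coprime a p) N * (1 + f p).
Proof.
rewrite big_cat big_map /= mulrDr mulr1.
have <- : \sum_(n <- L N) f n = sqfree_sum R (fun a => coprime a p) N by rewrite big_filter.
by congr (_ + _); rewrite mulr_suml; apply: eq_bigr => a _; rewrite sq_invM mulrC.
Qed.

Lemma coprime_ndvd a : coprime a p = ~~ (p %| a)%N.
Proof. by rewrite coprime_sym prime_coprime. Qed.

(** A squarefree multiple of p is p times a squarefree integer prime to p; this accounts for the
    factor 1 + p^-2. *)
Lemma sqfree_le_coprime N :
  sqfree_sum R xpredT N <= sqfree_sum R (fun a => coprime a p) N * (1 + f p).
Proof.
rewrite -sum_coprime_pairs /sqfree_sum -big_filter; apply: (ler_sum_subset sq_inv_ge0).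
  by rewrite filter_uniq// iota_uniq.
move=> n; rewrite -/(sqf N) sqf_mem => /and3P[sn n0 nN]; rewrite mem_cat.
have [cn|] := boolP (coprime n p); first by rewrite coprime_sqf_mem cn sn n0 nN.
rewrite coprime_ndvd negbK => /dvdnP[a aE]; apply/orP; right; apply/mapP.
have a0 : (0 < a)%N by move: n0; rewrite aE muln_gt0 => /andP[].
exists a; last by rewrite aE mulnC.
have pa : ~~ (p %| a)%N.
  apply/negP => pa; have /(sqfreeP n0)/(_ p) := sn; rewrite leqNgt; apply/negP/negPn.
  rewrite -pfactor_dvdn// aE expnS expn1 dvdn_mul//.
rewrite coprime_sqf_mem coprime_ndvd pa a0 -(sqfree_mul_prime pp pa a0) mulnC -aE sn /=.
by apply: leq_trans nN; rewrite aE leq_pmulr// prime_gt0.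
Qed.

Lemma coprime_le_sqfree N :
  sqfree_sum R (fun a => coprime a p) N * (1 + f p) <= sqfree_sum R xpredT (p * N).
Proof.
have p0 := prime_gt0 pp.
rewrite -sum_coprime_pairs /sqfree_sum -[leRHS]big_filter; apply: (ler_sum_subset sq_inv_ge0).
  rewrite cat_uniq map_inj_uniq ?filter_uniq ?iota_uniq//= ?andbT; last first.
    by move=> x y /eqP; rewrite eqn_pmul2l// => /eqP.
  apply/hasPn => _ /mapP[x xL ->]; rewrite coprime_sqf_mem coprime_ndvd dvdn_mulr//.
move=> n; rewrite -/(sqf _) mem_cat => /orP[|/mapP[a + ->]]; rewrite coprime_sqf_mem sqf_mem.
  by move=> /and4P[_ -> -> nN] /=; apply: leq_trans nN _; rewrite leq_pmull.
move=> /and4P[ca sa a0 aN]; rewrite coprime_ndvd in ca.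
by rewrite sqfree_mul_prime// sa muln_gt0 p0 a0 leq_pmul2l.
Qed.

(** The sum times (1 + p^-2) zeta(4) lies between the partial sum of zeta(2) up to N and zeta(2)
    itself. *)
Lemma sqfree_coprime_near (e : R) : 0 < e ->
  \forall N \near \oo, `|sqfree_sum R (fun a => coprime a p) N -
     zval 2 / zval 4 * (p%:R ^+ 2 / (p%:R ^+ 2 + 1))| <= e.
Proof.
move=> e0; have z4 : 1 <= zval 4 := zval_ge1 (isT : (2 <= 4)%N).
have z40 : 0 < zval 4 by lra.
have up N : sqfree_sum R xpredT N * zval 4 <= zval 2.
  have h M : sqfree_sum R xpredT N * zsum 4 M <= zval 2.
    by apply: le_trans (sqfree_le_zsum N M) _; exact: zsum_le.
  have hc : (zval 4 - zsum 4 M) @[M --> \oo] --> (0 : R).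
    by rewrite -(subrr (zval 4)); apply: cvgB; [exact: cvg_cst|exact: zsum_cvg].
  apply: (@ler_add_cvg0 R (fun M => sqfree_sum R xpredT N * (zval 4 - zsum 4 M)) _ _ 0%N).
    exact: cvg0_Ml.
  by move=> M _; have := h M; lra.
have near1 : \forall N \near \oo, zval 2 - zsum 2 N <= e.
  apply: cvg0_near_le e0.
  by rewrite -(subrr (zval 2)); apply: cvgB; [exact: cvg_cst|exact: zsum_cvg].
apply: filterS near1 => N h.
have p0 : 0 < p%:R :> R by rewrite ltr0n prime_gt0.
set S := sqfree_sum R _ N; set t : R := 1 + f p.
have t1 : 1 <= t by rewrite lerDl sq_inv_ge0.
have -> : p%:R ^+ 2 / (p%:R ^+ 2 + 1) = t^-1 :> R.
  by rewrite /t /f; field; rewrite !gt_eqF//; lra.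
have h1 : zsum 2 N <= S * t * zval 4.
  apply: le_trans (zsum_le_sqfree N) _; apply: ler_pM; rewrite ?sumr_ge0//.
  - exact: sqfree_le_coprime.
  exact: zsum_le.
have h2 : S * t * zval 4 <= zval 2.
  apply: le_trans (up (p * N)%N); apply: ler_wpM2r; [exact: ltW|exact: coprime_le_sqfree].
have -> : S - zval 2 / zval 4 * t^-1 = (S * t * zval 4 - zval 2) / (t * zval 4).
  by field; rewrite !gt_eqF//; lra.
have tz : 1 <= t * zval 4 by rewrite -[leLHS]mulr1; apply: ler_pM.
rewrite normrM normfV [`|t * _|]ger0_norm; last lra.
rewrite ler_pdivrMr; last lra.
rewrite ler0_norm; last lra.
apply: le_trans (_ : e * 1 <= _); first lra.
by rewrite ler_wpM2l// ltW.
Qed.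

End CoprimePart.

End ZetaValues.

(** * The asymptotic formula *)

Section Asymptotics.
Variable R : realType.
Implicit Types (p k j n : nat).

Lemma ln2_lt1 : ln 2 < 1 :> R.
Proof.
rewrite -[ltRHS]expRK ltr_ln ?posrE ?expR_gt0//.
have h := @expR_ge1Dx R (1 / 2).
have -> : (1 : R) = 1 / 2 + 1 / 2 by lra.
by rewrite expRD; nra.
Qed.

Lemma ln3_gt1 : 1 < ln 3 :> R.
Proof.
rewrite -[ltLHS]expRK ltr_ln ?posrE ?expR_gt0//.
have h := @expR_ge1Dx R (- (1 / 6)).
have e0 : 0 < expR (1 / 6) :> R by exact: expR_gt0.
have h2 : expR (1 / 6) <= 6 / 5 :> R.
  have : expR (- (1 / 6)) * expR (1 / 6) = 1 :> R by rewrite -expRD addNr expR0.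
  by nra.
have -> : (1 : R) = 1 / 6 * 6%:R by lra.
rewrite expRM_natr; apply: le_lt_trans (_ : (6 / 5) ^+ 6 < _).
  by apply: lerXn2r; rewrite ?nnegrE ?(ltW e0)//; lra.
lra.
Qed.

(** k log p = log(p^k), and the integer p^k is 2 or at least 3, so this logarithm stays away from 1
    because 2 < e < 3. *)
Lemma ln_gap : exists2 X0 : R, 0 < X0 & forall p k, prime p -> (0 < k)%N ->
  X0 <= `|ln k%:R + ln (ln p%:R)|.
Proof.
have l2 := ln2_lt1; have l3 := ln3_gt1; have l2' := ln2_ge R.
have l2n : ln (ln 2) < 0 :> R by rewrite ln_lt0//; lra.
have l3p : 0 < ln (ln 3) :> R by rewrite ln_gt0.
exists (Num.min (- ln (ln 2)) (ln (ln 3))); first by rewrite lt_min oppr_gt0 l2n.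
move=> p k pp k0; rewrite ge_min.
have [/andP[/eqP -> /eqP ->]|h] := boolP ((p == 2) && (k == 1)).
  by rewrite ln1 add0r ltr0_norm// lexx.
apply/orP; right; have p2 := prime_gt1 pp.
have lp : 0 < ln p%:R :> R by rewrite ln_gt0// ltr1n.
have k0' : 0 < k%:R :> R by rewrite ltr0n.
rewrite -lnM ?posrE//; apply: le_trans (ler_norm _).
rewrite ler_ln ?posrE ?mulr_gt0//; last lra.
have -> : k%:R * ln p%:R = ln (p ^ k)%N%:R :> R.
  by rewrite natrX lnXn ?ltr0n ?prime_gt0// mulr_natl.
rewrite ler_ln ?posrE ?ltr0n ?expn_gt0 ?prime_gt0// ler_nat.
case: (ltngtP p 2) p2 => // [p3 _|p2 _].
  by apply: leq_trans p3 _; rewrite -{1}[p]expn1 leq_pexp2l// prime_gt0.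
move: h; rewrite p2 eqxx /= => k1.
have k2 : (1 < k)%N by lia.
by apply: leq_trans (_ : 2 ^ 2 <= _)%N => //; rewrite leq_pexp2l.
Qed.

(** The last level contributes u instead of u^2, and u - u^2 = u / p. *)
Lemma sum_weight_totient p k (u : R) : prime p -> (0 < k)%N -> u = 1 - p%:R^-1 ->
  \sum_(1 <= j < k.+1) cond_weight R p k j * (totient (p ^ j))%:R = k%:R * u ^+ 2 + u / p%:R.
Proof.
move=> pp k0 uE; have p0 : p%:R != 0 :> R by rewrite pnatr_eq0 -lt0n prime_gt0.
have phi j : (0 < j)%N -> (p%:R ^+ j)^-1 * (totient (p ^ j))%:R = u :> R.
  case: j => // j _; rewrite totient_pfactor//= natrM -subn1 natrB ?prime_gt0// natrX uE.
  by rewrite exprS; field; rewrite p0 expf_neq0.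
rewrite big_nat_recr//= {2}/cond_weight eqxx phi//.
rewrite (_ : \sum_(1 <= j < k) _ = \sum_(1 <= j < k) u ^+ 2); last first.
  rewrite !big_nat; apply: eq_bigr => j /andP[j0 jk].
  by rewrite /cond_weight ltn_eqF// -uE mulrAC phi.
have -> : \sum_(1 <= j < k) u ^+ 2 = (k%:R - 1) * u ^+ 2.
  by rewrite big_const_nat iter_addr_0 -[LHS]mulr_natl natrB.
by rewrite uE; field.
Qed.

(** Here the precision l^-3 is spent: against W << l log l <= l^2 it leaves 1 / l. *)
Lemma weight_error_bound (a A W0 l W : R) : 7 * a <= 1 -> 0 < A -> 0 < W0 ->
  2 <= l -> 0 <= W -> W <= W0 * (l * ln l) ->
  7 * (a / l) + 2 * (A / l ^+ 3) * (2 * W + 2 * (A / l ^+ 3)) <= (1 + 4 * A * (W0 + A)) / l.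
Proof.
move=> a7 A0 W00 l2 W_ge0 hW; have l0 : 0 < l by lra.
have -> : (1 + 4 * A * (W0 + A)) / l = 1 / l + 4 * A * (W0 + A) / l by ring.
apply: lerD; first by rewrite mulrA ler_pM2r ?invr_gt0.
have l3 : (l ^+ 3)^-1 <= l ^+ 2.
  have l1 : 1 <= l by lra.
  apply: le_trans (_ : 1 <= _); last by rewrite exprn_ege1.
  by rewrite invf_le1 ?exprn_ege1// exprn_gt0.
have lnll : ln l <= l by rewrite ltW// ln_sublinear.
have h2 : 2 * W + 2 * (A / l ^+ 3) <= 2 * (W0 + A) * l ^+ 2.
  have : W0 * (l * ln l) <= W0 * l ^+ 2.
    by apply: ler_wpM2l; [exact: ltW|rewrite expr2 ler_pM2l].
  have : A / l ^+ 3 <= A * l ^+ 2 by apply: ler_wpM2l; [exact: ltW|].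
  by lra.
have eh0 : 0 <= 2 * (A / l ^+ 3).
  by rewrite mulr_ge0// divr_ge0 ?(ltW A0)// exprn_ge0 ?(ltW l0).
apply: le_trans (ler_wpM2l eh0 h2) _.
by rewrite le_eqVlt; apply/orP; left; apply/eqP; field; rewrite gt_eqF.
Qed.

(** Used with Y = k log p, so that Y + 2 is [logq]. As Y >= 1/2, log(Y + 2) <= log 5 + log Y, and
    the lower bound [X0] for |log Y| absorbs log 5. *)
Lemma majorant_sqr_bound (X0 W0 Y W : R) : 0 < X0 -> 0 < W0 -> 1 / 2 <= Y -> 0 <= W ->
  W <= W0 * ((Y + 2) * ln (Y + 2)) -> X0 <= `|ln Y| ->
  W ^+ 2 <= (W0 * (5 * (1 + ln 5 / X0))) ^+ 2 * (Y ^+ 2 * ln Y ^+ 2).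
Proof.
move=> X00 W00 Y12 W_ge0 hW hX.
have ln5 : 0 <= ln 5 :> R by exact: (ln_nat_ge0 R 5).
have Y0 : 0 < Y by lra.
have lnl : ln (Y + 2) <= `|ln Y| * (1 + ln 5 / X0).
  have h1 : ln (Y + 2) <= ln 5 + ln Y.
    rewrite -lnM ?posrE//; rewrite ler_ln ?posrE; lra.
  have h2 : ln 5 <= `|ln Y| * (ln 5 / X0).
    rewrite mulrCA -[leLHS]mulr1; apply: ler_wpM2l => //.
    by rewrite ler_pdivlMr// mul1r.
  have := ler_norm (ln Y); lra.
have -> : ln Y ^+ 2 = `|ln Y| ^+ 2 by rewrite real_normK// num_real.
have lnl0 : 0 <= ln (Y + 2) by apply: ln_ge0; lra.
set B := 5 * _; rewrite -!exprMn; apply: lerXn2r; rewrite ?nnegrE//.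
  apply: mulr_ge0; apply: mulr_ge0; rewrite ?normr_ge0 ?(ltW W00) ?(ltW Y0)//.
  by rewrite /B mulr_ge0// addr_ge0// divr_ge0// ltW.
apply: le_trans hW _; rewrite -mulrA; apply: ler_wpM2l; first exact: ltW.
have -> : B * (Y * `|ln Y|) = (5 * Y) * (`|ln Y| * (1 + ln 5 / X0)) by rewrite /B; ring.
by apply: ler_pM => //; lra.
Qed.

Lemma Lsum_main_error (c0 : R) p k : 0 < c0 -> prime p -> (0 < k)%N ->
  ~ exceptional_zero_exists c0 (p ^ k) ->
  let l := logq R (p ^ k) in
  let eps := 2 * (approx_const c0 / l ^+ 3) in
  exists W, [/\ 0 <= W, W <= 194 / radius c0 * (l * ln l) &
    `|Lsum R (p ^ k) - zval R 2 / (2 * zval R 4) * ((p%:R - 1) ^+ 2 / (p%:R ^+ 2 + 1)) * k%:R| <=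
    k%:R * (7 * (radius c0 / l) + eps * (2 * W + eps)) + 5 * W ^+ 2 / p%:R + zval R 2 / p%:R].
Proof.
move=> c0_gt0 pp k0 noexc l eps; set a := radius c0; set K : R := k%:R.
have a0 : 0 < a := radius_gt0 c0_gt0.
have [a8 _] := radius_le c0; rewrite -/a in a8.
have A0 := approx_const_gt0 c0_gt0.
have z2 := zval_ge1 R (isT : (2 <= 2)%N); have z4 := zval_ge1 R (isT : (2 <= 4)%N).
have P2 : 2 <= p%:R :> R by rewrite ler_nat prime_gt1.
have K1 : 1 <= K by rewrite ler1n.
have l2 : 2 <= l := logq_ge2 R (p ^ k).
have l0 : 0 < l by lra.
have lnl : 1 / 2 <= ln l.
  by apply: le_trans (ln2_ge R) _; rewrite ler_ln// posrE.
have [n [n0 n48 hn]] := inv_mean_square_bound c0_gt0 pp k0 noexc.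
rewrite -/l -/a in n48 hn; set r := a / l in hn *.
have r0 : 0 < r by rewrite divr_gt0.
pose D := zval R 2 / zval R 4 * (p%:R ^+ 2 / (p%:R ^+ 2 + 1)).
pose W := majorant_sum (r / (2 * n%:R)).
have N0 : 0 < n%:R :> R by rewrite ltr0n.
have W_ge0 : 0 <= W by apply/ltW/majorant_sum_gt0; rewrite divr_gt0// mulr_gt0.
exists W; split => //.
  (* W = (2 a + 4 n l) / a with n <= 48 log l and a <= 1 <= l log l, whence 194 = 4 * 48 + 2. *)
  rewrite /W /majorant_sum /r invf_div.
  have -> : 2 * (1 + 2 * n%:R / (a / l)) = (2 * a + 4 * n%:R * l) / a.
    by field; rewrite !gt_eqF.
  have -> : 194 / a * (l * ln l) = 194 * (l * ln l) / a by ring.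
  rewrite ler_pM2r ?invr_gt0//.
  have : n%:R * l <= 48 * ln l * l by rewrite ler_pM2r.
  have : 1 <= l * ln l by nra.
  by lra.
have hj j : (0 < j)%N -> (j <= k)%N -> _ := hn W D j erefl (sqfree_coprime_near pp r0).
rewrite -/eps in hj.
have eps0 : 0 < eps by rewrite /eps mulr_gt0// divr_gt0// exprn_gt0.
set E1 := 7 * r + eps * (2 * W + eps).
have E10 : 0 <= E1.
  have e20 : 0 <= 2 * W + eps by lra.
  by have := mulr_ge0 (ltW eps0) e20; rewrite /E1; lra.
clearbody W eps.
pose u : R := 1 - p%:R^-1.
have Pi : 0 < p%:R^-1 :> R by rewrite invr_gt0; lra.
have Pi2 : p%:R^-1 <= 1 / 2 :> R by rewrite mul1r lef_pV2 ?posrE//; lra.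
have S1 : `|Lsum R (p ^ k) - D / 2 * (K * u ^+ 2 + u / p%:R)| <=
    (K * u ^+ 2 + u / p%:R) * E1 + 5 * W ^+ 2 / p%:R.
  rewrite -(sum_weight_totient pp k0 (erefl u)) Lsum_weights// mulr_sumr -sumrB.
  apply: le_trans (ler_norm_sum _ _ _) _.
  have -> : 5 * W ^+ 2 / p%:R = 5 * W ^+ 2 * \sum_(1 <= j < k.+1) cond_weight R p k j.
    by rewrite sum_cond_weight.
  rewrite mulr_suml mulr_sumr -big_split /= !big_nat; apply: ler_sum => j /andP[j0 jk].
  have v0 := cond_weight_ge0 R pp k j; set v := cond_weight _ _ _ _ in v0 *.
  set F : R := (totient (p ^ j))%:R.
  have -> : v * inv_mean_square R p k j - D / 2 * (v * F) = v * (inv_mean_square R p k j - F / 2 * D).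
    by ring.
  rewrite normrM (ger0_norm v0).
  apply: le_trans (ler_wpM2l v0 (hj j j0 jk)) _.
  rewrite -/F -/E1 le_eqVlt; apply/orP; left; apply/eqP; ring.
clear hj hn n48.
have [u0 u1] : 0 <= u /\ u <= 1 by rewrite /u; split; lra.
have hsum : K * u ^+ 2 + u / p%:R <= K.
  have h : u * u <= u by nra.
  have -> : u / p%:R = u - u * u by rewrite /u; ring.
  rewrite expr2; nra.
have z40 : 0 < zval R 4 by lra.
have z20 : 0 <= zval R 2 by lra.
have P20 : 0 <= p%:R ^+ 2 :> R by exact: sqr_ge0.
have F1 : 0 <= p%:R ^+ 2 / (p%:R ^+ 2 + 1) :> R by apply: divr_ge0 => //; lra.
have F2 : 0 <= zval R 2 / zval R 4 by apply: divr_ge0; lra.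
have D0 : 0 <= D by exact: mulr_ge0.
have Dz : D <= zval R 2.
  rewrite /D -[leRHS]mulr1; apply: ler_pM => //.
    by rewrite ler_pdivrMr//; nra.
  by rewrite ler_pdivrMr; lra.
have -> : zval R 2 / (2 * zval R 4) * ((p%:R - 1) ^+ 2 / (p%:R ^+ 2 + 1)) * K = D / 2 * (K * u ^+ 2).
  rewrite /D /u; field; rewrite !gt_eqF//; lra.
(* The surplus u / p of [sum_weight_totient] is the source of the term zeta(2) / p. *)
have -> : Lsum R (p ^ k) - D / 2 * (K * u ^+ 2) =
   (Lsum R (p ^ k) - D / 2 * (K * u ^+ 2 + u / p%:R)) + D / 2 * (u / p%:R) by ring.
apply: le_trans (ler_normD _ _) _; apply: lerD.
  by apply: le_trans S1 _; rewrite lerD2r ler_wpM2r.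
have D2 : 0 <= D / 2 * (u / p%:R).
  by apply: mulr_ge0; apply: divr_ge0 => //; lra.
rewrite (ger0_norm D2).
by rewrite mulrA; apply: ler_wpM2r; [exact: ltW|nra].
Qed.

Lemma error_term_ge0 p k : 0 <= error_term R p k.
Proof. by rewrite /error_term -!exprMn divr_ge0 ?sqr_ge0. Qed.

Lemma Lsum_asymptotic (c0 : R) : 0 < c0 -> exists2 C : R, 0 < C &
  forall p k, prime p -> (0 < k)%N -> ~ exceptional_zero_exists c0 (p ^ k) ->
  `|Lsum R (p ^ k) - zval R 2 / (2 * zval R 4) * ((p%:R - 1) ^+ 2 / (p%:R ^+ 2 + 1)) * k%:R| <=
  C * (ln p%:R)^-1 + C * error_term R p k.
Proof.
move=> c0_gt0; have [X0 X00 hX0] := ln_gap.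
have a0 := radius_gt0 c0_gt0; have [a8 _] := radius_le c0.
have A0 := approx_const_gt0 c0_gt0; set A := approx_const c0 in A0.
have z2 := zval_ge1 R (isT : (2 <= 2)%N).
pose W0 := 194 / radius c0; have W00 : 0 < W0 by rewrite divr_gt0.
pose C1 := zval R 2 + 1 + 4 * A * (W0 + A).
pose C2 := 5 * (W0 * (5 * (1 + ln 5 / X0))) ^+ 2.
have C10 : 0 < C1.
  have : 0 <= 4 * A * (W0 + A) by apply: mulr_ge0; [apply: mulr_ge0 => //|]; lra.
  by rewrite /C1; lra.
have C20 : 0 <= C2 by rewrite mulr_ge0 ?sqr_ge0.
exists (C1 + C2); first exact: ltr_wpDr.
move=> p k pp k0 noexc; set y := ln p%:R; set K : R := k%:R; set l := logq R (p ^ k).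
have P2 : 2 <= p%:R :> R by rewrite ler_nat prime_gt1.
have K1 : 1 <= K by rewrite ler1n.
have y12 : 1 / 2 <= y.
  by apply: le_trans (ln2_ge R) _; rewrite ler_ln ?posrE//; lra.
have lE : l = K * y + 2 by rewrite /l /logq natrX lnXn ?ltr0n ?prime_gt0// mulr_natl.
have Ky : 1 / 2 <= K * y by nra.
have l2 : 2 <= l by lra.
have [W [W_ge0 hW main]] := Lsum_main_error c0_gt0 pp k0 noexc.
apply: le_trans main _; rewrite -/l -/K -/A -/W0 in hW *.
have a7 : 7 * radius c0 <= 1 by lra.
have e1 := weight_error_bound a7 A0 W00 l2 W_ge0 hW.
have hX := hX0 p k pp k0; rewrite -/K -/y -lnM ?posrE in hX; [|lra|lra].
rewrite lE in hW; have e3 := majorant_sqr_bound X00 W00 Ky W_ge0 hW hX.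
have errE : error_term R p k = (K * y) ^+ 2 * ln (K * y) ^+ 2 / p%:R.
  by rewrite /error_term -/K -/y lnM ?posrE; [rewrite -exprMn|lra|lra].
have err0 := error_term_ge0 p k.
have y0 : 0 < y by lra.
have p0 : 0 < p%:R :> R by lra.
(* As l exceeds k log p, the factor k from the sum over the levels turns 1 / l into 1 / log p. *)
have ky : K / l <= y^-1.
  have l0 : 0 < l by lra.
  by rewrite ler_pdivrMr// mulrC ler_pdivlMr// lE lerDl.
have b1 : 5 * W ^+ 2 / p%:R <= C2 * error_term R p k.
  rewrite errE [leRHS]mulrA; apply: ler_wpM2r; first by rewrite invr_ge0 ltW.
  by rewrite /C2 -mulrA ler_wpM2l.
have b2 : zval R 2 / p%:R <= zval R 2 * y^-1.
  apply: ler_wpM2l; first lra.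
  by rewrite lef_pV2 ?posrE//; apply/ltW/ln_sublinear.
have b3 : K * (7 * (radius c0 / l) + 2 * (A / l ^+ 3) * (2 * W + 2 * (A / l ^+ 3))) <=
    (1 + 4 * A * (W0 + A)) * y^-1.
  have K0 : 0 <= K by lra.
  apply: le_trans (ler_wpM2l K0 e1) _; rewrite mulrCA; apply: ler_wpM2l ky.
  by move: C10; rewrite /C1; nra.
have b4 : C1 * y^-1 <= (C1 + C2) * y^-1 by apply: ler_wpM2r; [rewrite invr_ge0 ltW|rewrite lerDl].
have b5 : C2 * error_term R p k <= (C1 + C2) * error_term R p k.
  by apply: ler_wpM2r => //; rewrite lerDr ltW.
have b6 : C1 * y^-1 = (1 + 4 * A * (W0 + A)) * y^-1 + zval R 2 * y^-1 by rewrite /C1; ring.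
apply: le_trans (lerD b4 b5); rewrite b6 addrAC; apply: lerD b1; exact: lerD.
Qed.

(* [k >= c p / y^4] with [y = ln p] gives [ln (k y) >= y / 2 - O(1)], hence
   [|ln (k y)| >= kp y] for a constant [kp > 0], as [|ln (k y)|] is bounded below. *)
Lemma error_term_large (c : R) : 0 < c -> exists2 C : R, 0 < C &
  forall p k, prime p -> (0 < k)%N -> c * (p%:R / ln p%:R ^+ 4) <= k%:R ->
  k%:R <= C * error_term R p k.
Proof.
move=> c_gt0; have [X0 X00 hX0] := ln_gap.
(* From log k >= log c + y - 4 log y one gets X >= log c + y - 3 log y, and log y < y / 6 + log 6
   makes this at least y / 2 - C2. *)
pose C2 := Num.max 1 (3 * ln 6 - ln c).
have C21 : 1 <= C2 by rewrite le_max lexx.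
have C2c : 3 * ln 6 - ln c <= C2 by rewrite le_max lexx orbT.
(* For y >= 4 C2 one has y / 2 - C2 >= y / 4 >= kp y; for smaller y, kp y <= X0 and the gap of
   [ln_gap] takes over. *)
pose kp := Num.min (1 / 4) (X0 / (4 * C2)).
have kp0 : 0 < kp by rewrite lt_min !divr_gt0// mulr_gt0//; lra.
have kp1 : kp <= 1 / 4 by rewrite ge_min lexx.
have kp2 : kp * (4 * C2) <= X0.
  by rewrite -ler_pdivlMr ?ge_min ?lexx ?orbT//; lra.
exists (c * kp ^+ 2)^-1; first by rewrite invr_gt0 mulr_gt0// exprn_gt0.
move=> p k pp k0 hk.
set y := ln p%:R in hk *; set K : R := k%:R in hk *; set X := ln K + ln y.
have P2 : 2 <= p%:R :> R by rewrite ler_nat prime_gt1.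
have P0 : 0 < p%:R :> R by lra.
have y12 : 1 / 2 <= y.
  by apply: le_trans (ln2_ge R) _; rewrite ler_ln ?posrE//; lra.
have y0 : 0 < y by lra.
have K1 : 1 <= K by rewrite ler1n.
have Xlow : y / 2 - C2 <= X.
  have h : ln (c * (p%:R / y ^+ 4)) <= ln K.
    by rewrite ler_ln ?posrE ?mulr_gt0 ?invr_gt0 ?exprn_gt0//; lra.
  move: h; rewrite lnM ?posrE ?divr_gt0 ?exprn_gt0// ln_div ?posrE ?exprn_gt0// lnXn// -/y.
  have : ln (y / 6) < y / 6 by apply: ln_sublinear; rewrite divr_gt0.
  rewrite ln_div ?posrE// -[ln y *+ 4]mulr_natl /X; lra.
have Xk : kp * y <= `|X|.
  have [yC|yC] := leP (4 * C2) y.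
    have := ler_norm X; nra.
  apply: le_trans (hX0 p k pp k0); apply: le_trans kp2; apply: ler_wpM2l; lra.
have -> : error_term R p k = K * (K * y ^+ 2 * `|X| ^+ 2 / p%:R).
  by rewrite /error_term -/K -/y -/X real_normK ?num_real//; ring.
rewrite mulrCA -[leLHS]mulr1; apply: ler_wpM2l; first lra.
rewrite ler_pdivlMl ?mulr_gt0 ?exprn_gt0// mulr1.
apply: le_trans (_ : (c * (p%:R / y ^+ 4)) * y ^+ 2 * (kp * y) ^+ 2 / p%:R <= _).
  by rewrite le_eqVlt; apply/orP; left; apply/eqP; field; rewrite !gt_eqF.
have b0 : 0 <= c * (p%:R / y ^+ 4) by rewrite mulr_ge0 ?divr_ge0 ?exprn_ge0// ltW.
have y2 : 0 <= y ^+ 2 by rewrite sqr_ge0.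
apply: ler_wpM2r; first by rewrite invr_ge0 ltW.
apply: ler_pM; [exact: mulr_ge0|exact: sqr_ge0|exact: ler_wpM2r|].
by apply: lerXn2r; rewrite ?nnegrE ?mulr_ge0 ?normr_ge0// ltW.
Qed.

End Asymptotics.

Theorem theorem1p3 (R : realType) (c0 : R) (c0_gt0 : 0 < c0)
    (c0P : at_most_one_zero c0) :
  (exists2 C : R, 0 < C &
     forall (I : Type) (F : set_system I) (FF : Filter F) (p k : I -> nat),
       (forall i, [/\ prime (p i), (1 <= k i)%N
                    & ~ exceptional_zero_exists c0 (p i ^ k i)]) ->
       (k i)%:R * ln (p i)%:R ^+ 4 / (p i)%:R @[i --> F] --> (0 : R) ->
       \forall i \near F,
         cabs ((Lsum R (p i ^ k i))%:C
               - zeta 2 / (2 * zeta 4)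
                 * (((p i)%:R - 1) ^+ 2 / ((p i)%:R ^+ 2 + 1)) * (k i)%:R)
         <= C * (ln (p i)%:R)^-1 + C * error_term R (p i) (k i))
  /\
  (forall c : R, 0 < c ->
     exists2 C : R, 0 < C &
       forall p k : nat, prime p -> (1 <= k)%N ->
         ~ exceptional_zero_exists c0 (p ^ k) ->
         c * (p%:R / ln p%:R ^+ 4) <= k%:R ->
         Lsum R (p ^ k) <= C * error_term R p k).
Proof.
have [C C0 hC] := Lsum_asymptotic c0_gt0.
have z2 := zval_ge1 R (isT : (2 <= 2)%N); have z4 := zval_ge1 R (isT : (2 <= 4)%N).
split.
  exists C => // I F FF p k hpk _; apply: nearW => i; have [pp k0 noexc] := hpk i.
  apply: le_trans (hC (p i) (k i) pp k0 noexc).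
  rewrite (zeta_zval R (isT : (2 <= 2)%N)) (zeta_zval R (isT : (2 <= 4)%N)).
  rewrite -cabs_real le_eqVlt; apply/orP; left; apply/eqP; congr cabs.
  by rewrite !(rmorphB, rmorphM, rmorphD, rmorphXn, fmorphV, rmorph_nat, rmorph1).
move=> c c_gt0; have [C' C'0 hC'] := error_term_large c_gt0.
(* The main term is at most zeta(2) k, and 1 / log p <= 2 <= 2 k; both are dominated by the error
   term because k is at most [C'] times it. *)
exists ((zval R 2 + 2 * C) * C' + C).
  by rewrite addr_gt0// mulr_gt0// addr_gt0 ?mulr_gt0//; lra.
move=> p k pp k0 noexc hk; have hE := hC' p k pp k0 hk.
have := hC p k pp k0 noexc; rewrite ler_norml => /andP[_ h].
have P2 : 2 <= p%:R :> R by rewrite ler_nat prime_gt1.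
have K1 : 1 <= k%:R :> R by rewrite ler1n.
have y12 : 1 / 2 <= ln p%:R :> R.
  by apply: le_trans (ln2_ge R) _; rewrite ler_ln ?posrE//; lra.
have yi : (ln p%:R)^-1 <= 2 * k%:R :> R.
  apply: le_trans (_ : 2 <= _); last lra.
  by rewrite -[leRHS]invrK lef_pV2 ?posrE; lra.
set m := zval R 2 / _ * _ * _ in h.
have hm : m <= zval R 2 * k%:R.
  rewrite /m; apply: ler_wpM2r; first by [].
  rewrite -[leRHS]mulr1; apply: ler_pM; rewrite ?divr_ge0 ?sqr_ge0 ?addr_ge0 ?exprn_ge0//; try lra.
    by rewrite ler_pdivrMr; nra.
  by rewrite ler_pdivrMr; nra.
have h2 : C * (ln p%:R)^-1 <= C * (2 * k%:R) by rewrite ler_wpM2l// ltW.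
have h3 : (zval R 2 + 2 * C) * k%:R <= (zval R 2 + 2 * C) * (C' * error_term R p k).
  by rewrite ler_wpM2l//; lra.
set E := error_term R p k in h h3 *.
have -> : ((zval R 2 + 2 * C) * C' + C) * E = (zval R 2 + 2 * C) * (C' * E) + C * E by ring.
lra.
Qed.
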